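(* Let $\Gamma$ be any graph obtained by the construction described in the context (for any admissible choice of $m\ge 5$, $n$, and $\mathcal P$), and let $W$ be the right-angled Coxeter group with presentation graph $\Gamma$. Then $W$ contains a subgroup which is isomorphic to the fundamental group of a closed hyperbolic surface and which is (quasi-geodesically) stable in $W$.
   Context: **The graphs $\Gamma_n$.** $\Gamma_1$ has two vertices $a_1,b_1$ and no edge. Inductively, $\Gamma_n$ is obtained from $\Gamma_{n-1}$ by adding two new vertices $a_n,b_n$ (not adjacent to each other) and four new edges, joining each of $a_{n-1},b_{n-1}$ to each of $a_n,b_n$. So $\Gamma_n$ has $2n$ vertices. **Joins.** A join in $\Gamma_n$ is an induced subgraph whose vertex set is partitioned into two nonempty parts $A,B$ such that every vertex of $A$ is adjacent to every vertex of $B$. Joins are assumed non-degenerate, i.e. the induced subgraphs on $A$ and on $B$ both have diameter at least $2$ (each contains a pair of distinct non-adjacent vertices). **The graph $\Gamma$.** Fix $m\ge 5$, and choose $n$ large enough that there is a set of vertices $\mathcal P=\{p_1,\dots,p_m\}$ of $\Gamma_n$ such that for all $1\le i<j\le m$ the vertices $p_i$ and $p_j$ are not contained in a common join in $\Gamma_n$ (for example $n=14$, $m=5$, $\mathcal P=\{a_1,a_4,a_7,a_{10},a_{13}\}$). $\Gamma$ is obtained from $\Gamma_n$ by adding an edge between $p_i$ and $p_{i+1}$ for each $1\le i<m$, and an edge between $p_m$ and $p_1$. **Right-angled Coxeter group.** The right-angled Coxeter group with presentation graph $\Gamma$ is the group with one generator of order two for each vertex of $\Gamma$, and a commutation relation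 between the generators of each pair of vertices connected by an edge (and no other relations). **Stability.** A quasigeodesic $\gamma$ in a geodesic metric space is $N$-Morse, for a function $N:[1,\infty)\times[0,\infty)\to[0,\infty)$, if every $(K,C)$-quasigeodesic with endpoints on $\gamma$ lies in the $N(K,C)$-neighborhood of $\gamma$. A finitely generated subgroup $H$ of a finitely generated group $G$ is undistorted if the inclusion $H\to G$ is a quasi-isometric embedding for word metrics. An undistorted subgroup $H\le G$ is (quasi-geodesically) stable if each pair of points of $H$ is connected, in a Cayley graph of $G$ with respect to a finite generating set, by uniformly Morse quasigeodesics, i.e. there are a single function $N$ and single quasigeodesic constants such that every pair of points of $H$ is connected by an $N$-Morse quasigeodesic with those constants. *)

(* Defs.v *)
From HB Require Import structures.
From mathcomp Require Import all_boot all_order all_algebra generic_quotient.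
From mathcomp Require Import all_classical all_reals all_analysis.
From Stdlib Require Import Relations.Relation_Operators.
Set Implicit Arguments.
Unset Strict Implicit.
Unset Printing Implicit Defensive.
Import Order.TTheory GRing.Theory Num.Theory.
Import numFieldNormedType.Exports.

Local Open Scope classical_set_scope.
Local Open Scope ring_scope.

(* The vertices a_k and b_k of Gamma_n are (k - 1, false) and (k - 1, true). *)
Definition Gamma_vertex (n : nat) : finType := ('I_n * bool)%type.

Definition Gamma_n_edge (n : nat) : rel (Gamma_vertex n) :=
  fun u v => (u.1.+1 == v.1 :> nat) || (v.1.+1 == u.1 :> nat).
Arguments Gamma_n_edge n : clear implicits.

(* The vertex set of the join is A :|: B; the last two clauses are the standing
   non-degeneracy assumption (both parts have diameter at least 2). *)
Definition is_join (V : finType) (e : rel V) (A B : {set V}) : Prop :=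
  [/\ A != finset.set0, B != finset.set0, A :&: B = finset.set0,
      (forall u v, u \in A -> v \in B -> e u v) &
      (exists u v, [/\ u \in A, v \in A, u != v & ~~ e u v]) /\
      (exists u v, [/\ u \in B, v \in B, u != v & ~~ e u v])].

Definition in_common_join (V : finType) (e : rel V) (u v : V) : Prop :=
  exists A B : {set V}, [/\ is_join e A B, u \in A :|: B & v \in A :|: B].

Definition admissible (n m : nat) (p : 'I_m -> Gamma_vertex n) : Prop :=
  injective p /\
  forall i j : 'I_m, (i < j)%N -> ~ in_common_join (Gamma_n_edge n) (p i) (p j).

(* [ordS] is the cyclic successor on ['I_m]. *)
Definition Gamma_edge (n m : nat) (p : 'I_m -> Gamma_vertex n) :
    rel (Gamma_vertex n) :=
  fun u v => Gamma_n_edge n u v ||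
    [exists i : 'I_m, ((u == p i) && (v == p (ordS i))) ||
                      ((v == p i) && (u == p (ordS i)))].

(* The generators are involutions, so every element of the group is represented
   by a word in the generators alone, and the group is the quotient of the set
   of words by the congruence generated by v v = 1 and u v = v u (for edges). *)
Inductive racg_step (V : choiceType) (e : rel V) : seq V -> seq V -> Prop :=
| racg_square a b v : racg_step e (a ++ v :: v :: b) (a ++ b)
| racg_commute a b u v : e u v ->
    racg_step e (a ++ u :: v :: b) (a ++ v :: u :: b).

Definition racg_equiv (V : choiceType) (e : rel V) : seq V -> seq V -> Prop :=
  clos_refl_sym_trans (seq V) (racg_step e).

Section Racg.
Local Open Scope quotient_scope.
Variables (V : choiceType) (e : rel V).
Implicit Types (u v w : seq V).

Definition racg_eqb : rel (seq V) := fun u v => `[< racg_equiv e u v >].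

Lemma racg_eqb_refl : reflexive racg_eqb.
Proof. by move=> u; apply/asboolP; exact: rst_refl. Qed.

Lemma racg_eqb_sym : symmetric racg_eqb.
Proof.
by move=> u v; apply/asboolP/asboolP => uv; exact: rst_sym.
Qed.

Lemma racg_eqb_trans : transitive racg_eqb.
Proof.
move=> v u w /asboolP uv /asboolP vw; apply/asboolP; exact: rst_trans uv vw.
Qed.

Canonical racg_eqb_equiv :=
  EquivRel racg_eqb racg_eqb_refl racg_eqb_sym racg_eqb_trans.

Definition racg := {eq_quot racg_eqb}.
HB.instance Definition _ := Choice.on racg.
HB.instance Definition _ := EqQuotient.on racg.

Definition racg_class (w : seq V) : racg := \pi w.

Lemma racg_classP u v : racg_class u = racg_class v <-> racg_equiv e u v.
Proof. by split=> [/eqmodP/asboolP|uv] //; apply/eqmodP/asboolP. Qed.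

Lemma racg_class_repr (x : racg) : racg_class (repr x) = x.
Proof. exact: reprK. Qed.

Lemma racg_equiv_repr w : racg_equiv e (repr (racg_class w)) w.
Proof. by apply/racg_classP; rewrite racg_class_repr. Qed.

Lemma racg_equiv_cat u u' v v' :
  racg_equiv e u u' -> racg_equiv e v v' -> racg_equiv e (u ++ v) (u' ++ v').
Proof.
move=> uu' vv'; apply: (rst_trans _ _ _ (u' ++ v)).
- elim: uu' => {u u'} [_ _ [a b x|a b x y xy]|u|u u' _ |u1 u2 u3 _ + _].
  + by rewrite -!catA /=; apply: rst_step; constructor.
  + by rewrite -!catA /=; apply: rst_step; constructor.
  + exact: rst_refl.
  + exact: rst_sym.
  + exact: rst_trans.
- elim: vv' => {v v'} [_ _ [a b x|a b x y xy]|v|v v' _ |v1 v2 v3 _ + _].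
  + by rewrite !catA; apply: rst_step; constructor.
  + by rewrite !catA; apply: rst_step; constructor.
  + exact: rst_refl.
  + exact: rst_sym.
  + exact: rst_trans.
Qed.

Lemma racg_equiv_rev u v : racg_equiv e u v -> racg_equiv e (rev u) (rev v).
Proof.
elim=> {u v} [_ _ [a b x|a b x y xy]|u|u u' _ |u1 u2 u3 _ + _].
- rewrite !rev_cat !rev_cons -!cats1 -!catA /=.
  by apply: rst_step; constructor.
- rewrite !rev_cat !rev_cons -!cats1 -!catA /=.
  by apply: rst_sym; apply: rst_step; constructor.
- exact: rst_refl.
- exact: rst_sym.
- exact: rst_trans.
Qed.

Lemma racg_equiv_revK u : racg_equiv e (rev u ++ u) [::].
Proof.
elim: u => [|x u IHu]; first exact: rst_refl.
rewrite rev_cons -cats1 -catA /=; apply: rst_trans IHu.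
by apply: rst_step; constructor.
Qed.

Definition racg_one : racg := racg_class [::].
Definition racg_mul (x y : racg) : racg := racg_class (repr x ++ repr y).
Definition racg_inv (x : racg) : racg := racg_class (rev (repr x)).

Lemma racg_mul_class u v :
  racg_mul (racg_class u) (racg_class v) = racg_class (u ++ v).
Proof.
by apply/racg_classP/racg_equiv_cat; exact: racg_equiv_repr.
Qed.

Lemma racg_inv_class u : racg_inv (racg_class u) = racg_class (rev u).
Proof. by apply/racg_classP/racg_equiv_rev; exact: racg_equiv_repr. Qed.

Lemma racg_mulA : associative racg_mul.
Proof.
move=> x y z; rewrite -(racg_class_repr x) -(racg_class_repr y).
by rewrite -(racg_class_repr z) !racg_mul_class catA.
Qed.

Lemma racg_mul1 : left_id racg_one racg_mul.
Proof. by move=> x; rewrite -(racg_class_repr x) racg_mul_class. Qed.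

Lemma racg_mulr1 : right_id racg_one racg_mul.
Proof. by move=> x; rewrite -(racg_class_repr x) racg_mul_class cats0. Qed.

Lemma racg_mulV : left_inverse racg_one racg_inv racg_mul.
Proof.
move=> x; rewrite -(racg_class_repr x) racg_inv_class racg_mul_class.
by apply/racg_classP; exact: racg_equiv_revK.
Qed.

Lemma racg_mulrV : right_inverse racg_one racg_inv racg_mul.
Proof.
move=> x; rewrite -(racg_class_repr x) racg_inv_class racg_mul_class.
by apply/racg_classP; have := racg_equiv_revK (rev (repr x)); rewrite revK.
Qed.

HB.instance Definition _ := isGroup.Build racg
  racg_mulA racg_mul1 racg_mulr1 racg_mulV racg_mulrV.

Definition racg_gen (v : V) : racg := racg_class [:: v].

Lemma racg_class_prod w :
  racg_class w = (\big[*%g/1%g]_(v <- w) racg_gen v)%g.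
Proof.
elim: w => [|v w IHw]; first by rewrite big_nil.
by rewrite big_cons -IHw -[LHS](racg_mul_class [:: v]).
Qed.

Lemma racg_gen_square (v : V) : (racg_gen v * racg_gen v = 1)%g.
Proof.
rewrite [LHS]racg_mul_class; apply/racg_classP/rst_step.
exact: (racg_square e [::] [::] v).
Qed.

Lemma racg_gen_commute (u v : V) : e u v ->
  (racg_gen u * racg_gen v = racg_gen v * racg_gen u)%g.
Proof.
move=> uv; rewrite [LHS]racg_mul_class [RHS]racg_mul_class.
by apply/racg_classP/rst_step; exact: (racg_commute [::] [::] uv).
Qed.

(* The universal property: [racg] is the group presented by the generators
   [racg_gen v] and the relations of [racg_gen_square], [racg_gen_commute]. *)
Lemma racg_universal (G : groupType) (f : V -> G) :
  (forall v : V, f v * f v = 1)%g ->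
  (forall u v : V, e u v -> f u * f v = f v * f u)%g ->
  exists! phi : racg -> G,
    {morph phi : x y / (x * y)%g} /\ forall v : V, phi (racg_gen v) = f v.
Proof.
move=> f2 fC; pose F w := (\big[*%g/1%g]_(v <- w) f v)%g.
have FE u v : racg_equiv e u v -> F u = F v.
  elim=> {u v} [_ _ [a b x|a b x y xy]|u|u u' _ |u1 u2 u3 _ + _] //.
  - by rewrite /F !big_cat !big_cons /= [X in (_ * X)%g]mulgA f2 mul1g.
  - rewrite /F !big_cat !big_cons /= [X in (_ * X)%g]mulgA fC //.
    by rewrite -[X in (_ * X)%g]mulgA.
  - by move=> ->.
have Fc w : F (repr (racg_class w)) = F w by exact/FE/racg_equiv_repr.
exists (fun x => F (repr x)); split=> [|psi [psiM psif]].
  split=> [x y|v]; last by rewrite Fc /F big_seq1.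
  by rewrite -[(x * y)%g]/(racg_class (repr x ++ repr y)) Fc /F big_cat.
have psi1 : psi 1%g = 1%g.
  by apply: (@mulgI _ (psi 1%g)); rewrite -psiM !mulg1.
apply/funext => x; rewrite -[in RHS](racg_class_repr x) racg_class_prod /F.
elim: (repr x) => [|v w IHw]; first by rewrite !big_nil psi1.
by rewrite !big_cons psiM psif IHw.
Qed.

End Racg.

Definition is_subgroup (G : groupType) (H : set G) : Prop :=
  [/\ H 1%g, (forall g h, H g -> H h -> H (g * h)%g) &
      (forall g, H g -> H (g^-1)%g)].

Definition spells (G : groupType) (S : set G) (w : seq G) (g : G) : Prop :=
  (forall x, x \in w -> S x \/ S (x^-1)%g) /\ (\big[*%g/1%g]_(x <- w) x)%g = g.

Definition finite_generating_set (G : groupType) (H S : set G) : Prop :=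
  [/\ finite_set S, S `<=` H & forall h, H h -> exists w, spells S w h].

(* The value 0 given to elements outside of the subgroup generated by S is
   never used: word lengths are only taken on a subgroup generated by S. *)
Definition word_length (G : groupType) (S : set G) (g : G) : nat :=
  xget 0%N [set k | (exists2 w, spells S w g & size w = k) /\
                    (forall w, spells S w g -> (k <= size w)%N)].

Definition word_dist (R : realType) (G : groupType) (S : set G) (g h : G) : R :=
  (word_length S (g^-1 * h)%g)%:R.

(* The distance on H is the word metric of H for its own generating set T. *)
Definition undistorted (R : realType) (G : groupType) (H : set G) : Prop :=
  exists S T : set G,
    [/\ finite_generating_set [set: G] S, finite_generating_set H T &
      exists K C : R, [/\ 1 <= K, 0 <= C &
        forall g h, H g -> H h ->
          word_dist R T g h / K - C <= word_dist R S g h /\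
          word_dist R S g h <= K * word_dist R T g h + C]].

(* A point of the geometric realization of the (simplicial) Cayley graph of G
   with respect to S: the point at distance [cay_pos] from [cay_src] on the edge
   from [cay_src] to [cay_dst]. Edges with equal ends are degenerate and stand
   for vertices. A vertex, or a point inside an edge, has several such
   representations, which are at distance 0 from one another. *)
Record cayley_point (R : realType) (G : groupType) (S : set G) := CayleyPoint {
  cay_src : G;
  cay_dst : G;
  cay_pos : R;
  cay_edge : [\/ cay_src = cay_dst, S (cay_src^-1 * cay_dst)%g |
                 S (cay_dst^-1 * cay_src)%g];
  cay_pos_itv : 0 <= cay_pos <= (cay_src != cay_dst)%:R }.

(* The distance from the point to the other end of its edge. *)
Definition cay_copos (R : realType) (G : groupType) (S : set G)
    (x : cayley_point R S) : R :=
  (cay_src x != cay_dst x)%:R - cay_pos x.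

(* Points on a common edge are joined inside this edge; otherwise a shortest
   path goes through an end of each of the two edges. *)
Definition cayley_dist (R : realType) (G : groupType) (S : set G)
    (x y : cayley_point R S) : R :=
  if (cay_src x == cay_src y) && (cay_dst x == cay_dst y) then
    `|cay_pos x - cay_pos y|
  else if (cay_src x == cay_dst y) && (cay_dst x == cay_src y) then
    `|cay_pos x - cay_copos y|
  else
    Num.min
      (Num.min
        (cay_pos x + word_dist R S (cay_src x) (cay_src y) + cay_pos y)
        (cay_pos x + word_dist R S (cay_src x) (cay_dst y) + cay_copos y))
      (Num.min
        (cay_copos x + word_dist R S (cay_dst x) (cay_src y) + cay_pos y)
        (cay_copos x + word_dist R S (cay_dst x) (cay_dst y) + cay_copos y)).

Lemma cayley_vertex_itv (R : realType) (G : groupType) (g : G) :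
  0 <= (0 : R) <= (g != g)%:R.
Proof. by rewrite eqxx lexx. Qed.

Definition cayley_vertex (R : realType) (G : groupType) (S : set G) (g : G) :
    cayley_point R S :=
  CayleyPoint (Or31 _ _ erefl) (cayley_vertex_itv R g).

(* A (K, C)-quasigeodesic is a (K, C)-quasi-isometric embedding of a compact
   interval [a, b], not necessarily continuous; the values of the function
   outside of the interval are irrelevant. *)
Definition quasigeodesic (R : realType) (X : Type) (d : X -> X -> R)
    (K C a b : R) (gamma : R -> X) : Prop :=
  [/\ 1 <= K, 0 <= C, a <= b &
    forall s t, s \in `[a, b] -> t \in `[a, b] ->
      `|s - t| / K - C <= d (gamma s) (gamma t) /\
      d (gamma s) (gamma t) <= K * `|s - t| + C].

(* "Lies on gamma" is expressed by distance 0 to a point of gamma, which is the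
   same as equality in a metric space but makes sense for the pseudometric
   [cayley_dist]. *)
Definition morse (R : realType) (X : Type) (d : X -> X -> R)
    (N : R -> R -> R) (a b : R) (gamma : R -> X) : Prop :=
  forall (K C a' b' : R) (sigma : R -> X),
    quasigeodesic d K C a' b' sigma ->
    (exists2 s, s \in `[a, b] & d (sigma a') (gamma s) = 0) ->
    (exists2 s, s \in `[a, b] & d (sigma b') (gamma s) = 0) ->
    forall t, t \in `[a', b'] ->
      exists2 s, s \in `[a, b] & d (sigma t) (gamma s) <= N K C.

Definition stable (R : realType) (G : groupType) (H : set G) : Prop :=
  [/\ is_subgroup H, undistorted R H &
    exists S : set G, finite_generating_set [set: G] S /\
      exists (N : R -> R -> R) (K C : R),
        (forall K' C', 1 <= K' -> 0 <= C' -> 0 <= N K' C') /\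
        forall g h, H g -> H h -> exists (a b : R) (gamma : R -> cayley_point R S),
          [/\ quasigeodesic (@cayley_dist R G S) K C a b gamma,
              gamma a = cayley_vertex R S g, gamma b = cayley_vertex R S h &
              morse (@cayley_dist R G S) N a b gamma]].

(* The upper half-plane model of the hyperbolic plane: [cosh d] is equal to
   1 + |p - q|^2 / (2 Im p Im q), and arcosh c = ln (c + sqrt (c^2 - 1)). *)
Definition upper_half_plane (R : realType) : set (R * R) := [set p | 0 < p.2].

Definition hyp_cosh_dist (R : realType) (p q : R * R) : R :=
  1 + ((p.1 - q.1) ^+ 2 + (p.2 - q.2) ^+ 2) / (2 * p.2 * q.2).

Definition hyp_dist (R : realType) (p q : R * R) : R :=
  let c := hyp_cosh_dist p q in ln (c + Num.sqrt (c ^+ 2 - 1)).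

Definition locally_hyperbolic (R : realType) (M : metricType R) : Prop :=
  forall x : M, exists r : R, 0 < r /\ exists f : M -> R * R,
    [/\ (forall y, ball x r y -> upper_half_plane (f y)),
        (forall y z, ball x r y -> ball x r z ->
           hyp_dist (f y) (f z) = mdist y z) &
        (forall q, upper_half_plane q -> hyp_dist (f x) q < r ->
           exists2 y, ball x r y & f y = q)].

Definition closed_hyperbolic_surface (R : realType) (M : metricType R) : Prop :=
  [/\ compact [set: M], connected [set: M] & locally_hyperbolic M].

Definition is_loop (R : realType) (T : topologicalType) (x0 : T) (f : R -> T) :
    Prop :=
  [/\ {within `[0, 1], continuous f}, f 0 = x0 & f 1 = x0].

Definition loop_concat (R : realType) (T : Type) (f g : R -> T) : R -> T :=
  fun t => if t <= 2^-1 then f (2 * t) else g (2 * t - 1).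

Definition loop_homotopic (R : realType) (T : topologicalType) (x0 : T)
    (f g : R -> T) : Prop :=
  exists h : R * R -> T,
    [/\ {within [set p | p.1 \in `[0, 1] /\ p.2 \in `[0, 1]], continuous h},
        (forall t, t \in `[0, 1] -> h (t, 0) = f t /\ h (t, 1) = g t) &
        (forall s, s \in `[0, 1] -> h (0, s) = x0 /\ h (1, s) = x0)].

(* Phi induces an isomorphism from pi_1(T, x0), the group of homotopy classes of
   loops at x0 under concatenation, onto H. *)
Definition isomorphic_to_pi1 (R : realType) (T : topologicalType) (x0 : T)
    (G : groupType) (H : set G) : Prop :=
  exists Phi : (R -> T) -> G,
    [/\ (forall f, is_loop x0 f -> H (Phi f)),
        (forall h, H h -> exists2 f, is_loop x0 f & Phi f = h),
        (forall f g, is_loop x0 f -> is_loop x0 g ->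
           Phi (loop_concat f g) = (Phi f * Phi g)%g) &
        (forall f g, is_loop x0 f -> is_loop x0 g ->
           (Phi f = Phi g <-> loop_homotopic x0 f g))].

(* Main.v *)
Require Import Defs.
From HB Require Import structures.
From mathcomp Require Import all_boot all_order all_algebra generic_quotient.
From mathcomp Require Import all_classical all_reals all_analysis.
From mathcomp Require Import ring lra zify.
From Stdlib Require Import Relations.Relation_Operators.

(** The marked vertices span a cycle of length [m >= 5] in the graph, and the
subgroup that they generate (the special subgroup of the cycle) is the reflection
group of a right-angled [m]-gon of the hyperbolic plane. Its elements in which
every generator occurs an even number of times form a subgroup of finite index
that acts freely on the plane; this is the surface subgroup.

It is a surface group because of the classical facts on the polygon, proved here
through the positivity of roots ([roots_positive]): the whole group acts on the
hyperboloid with the generators of the cycle as reflections in the sides of a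
regular right-angled polygon and the other generators as the identity. Every point
is moved into the polygon ([chamber_covers]), which is bounded
([polygon_bounded]), and a nontrivial even element moves every point by at least
a fixed distance ([even_special_displacement]): the few walls near to a point
cross each other, and an even element is not a product of their reflections, so
that it has to cross another wall as well. The quotient is thus a closed
hyperbolic surface, and lifting loops to the plane, which is convex in the chosen
coordinates, identifies its fundamental group ([quotient_surface]).

Stability comes from two properties of the graph ([marked_triangle] and
[marked_square]): the cycle has no triangle, and two non-adjacent vertices of the
cycle have at most one common neighbour in the whole graph. The latter holds because
a common neighbour in the ladder would put them in a common join. In a right-angled
Coxeter group, two letters that are both initial in reduced words of the same
element commute ([ldesc_edge]). Hence a geodesic word of the special subgroup can
only be crossed by letters commuting with it, and a word of length at least 3 in
the letters of the cycle commutes with at most one letter. Two consequences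
follow for the interval between two elements [g] and [h] of the special subgroup,
the union of all geodesics between them. It is thin: it stays within distance 4 of
each of these geodesics ([interval_thin]). And its nearest point projection is
strongly contracting: if the projections of two points are at distance at least 3,
then going from one point to the other through the projections is at most two
letters longer than any other way ([interval_contraction]). A quasigeodesic far
from the interval therefore progresses too slowly along it
([quasigeodesic_close]), so that geodesics between elements of the special
subgroup are uniformly Morse. Finally a subgroup of finite index of a special
subgroup is undistorted ([even_special_undistorted]). *)

Set Implicit Arguments.
Unset Strict Implicit.
Unset Printing Implicit Defensive.
Import Order.TTheory GRing.Theory Num.Theory.
Import numFieldNormedType.Exports.
Local Open Scope classical_set_scope.
Local Open Scope ring_scope.

(** * Word length in a right-angled Coxeter group *)

Section Length.
Variables (V : finType) (e : rel V).
Local Notation W := (racg e).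
Local Notation cls := (@racg_class V e).
Local Notation gen := (@racg_gen V e).
Implicit Types (s t r : V) (w u v a : seq V) (g h x y z : W).

(** The product of [racg e] is reached through several algebraic structures.
Stating the group laws for [racg e] itself keeps all products in one form. *)
Lemma gmulA x y z : (x * (y * z) = x * y * z)%g. Proof. exact: mulgA. Qed.
Lemma gmul1 x : (1 * x = x)%g. Proof. exact: mul1g. Qed.
Lemma gmulr1 x : (x * 1 = x)%g. Proof. exact: mulg1. Qed.
Lemma gmulV x : (x^-1 * x = 1)%g. Proof. exact: mulVg. Qed.
Lemma gmulrV x : (x * x^-1 = 1)%g. Proof. exact: mulgV. Qed.
Lemma gmulK x y : (x^-1 * (x * y) = y)%g. Proof. exact: mulKg. Qed.
Lemma gmulKV x y : (x * (x^-1 * y) = y)%g. Proof. exact: mulVKg. Qed.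
Lemma ginvM x y : ((x * y)^-1 = y^-1 * x^-1)%g. Proof. exact: invgM. Qed.

Lemma racg_word_ex g : exists k, `[< exists2 w, cls w = g & size w = k >].
Proof. by exists (size (repr g)); apply/asboolP; exists (repr g) => //; exact: racg_class_repr. Qed.

Definition len g : nat := ex_minn (racg_word_ex g).

Lemma len_word g : exists2 w, cls w = g & size w = len g.
Proof. by rewrite /len; case: ex_minnP => k /asboolP. Qed.

Lemma len_cls w : (len (cls w) <= size w)%N.
Proof.
by rewrite /len; case: ex_minnP => k _ -> //; apply/asboolP; exists w.
Qed.

Lemma cls_cat u v : cls (u ++ v) = (cls u * cls v)%g.
Proof. by rewrite [RHS]racg_mul_class. Qed.

Lemma cls_cons s w : cls (s :: w) = (gen s * cls w)%g.
Proof. exact: (cls_cat [:: s]). Qed.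

Lemma cls_rcons w s : cls (rcons w s) = (cls w * gen s)%g.
Proof. by rewrite -cats1 cls_cat. Qed.

Lemma cls_nil : cls [::] = 1%g. Proof. by []. Qed.

Lemma cls_rev w : cls (rev w) = (cls w)^-1%g.
Proof. by rewrite [RHS]racg_inv_class. Qed.

Lemma gen_sq s : (gen s * gen s = 1)%g.
Proof. exact: racg_gen_square. Qed.

Lemma genK s : cancel (fun x => gen s * x)%g (fun x => gen s * x)%g.
Proof. by move=> x; rewrite mulgA gen_sq mul1g. Qed.

Lemma gen_inv s : ((gen s)^-1 = gen s)%g.
Proof. by rewrite -[gen s in LHS]/(cls [:: s]) -cls_rev. Qed.

Lemma len_mul x y : (len (x * y)%g <= len x + len y)%N.
Proof.
have [u <- <-] := len_word x; have [v <- <-] := len_word y.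
by rewrite -cls_cat -size_cat len_cls.
Qed.

Lemma len_inv x : len (x^-1)%g = len x.
Proof.
suff H y : (len (y^-1)%g <= len y)%N by apply/eqP; rewrite eqn_leq H -{1}(invgK x) H.
by have [u <- <-] := len_word y; rewrite -cls_rev -(size_rev u) len_cls.
Qed.

Lemma len1 : len (1%g : W) = 0%N.
Proof. by apply/eqP; rewrite -leqn0 -cls_nil (len_cls [::]). Qed.

Lemma len_gen s : (len (gen s) <= 1)%N.
Proof. exact: (len_cls [:: s]). Qed.

Lemma racg_equiv_odd_size u v : racg_equiv e u v -> odd (size u) = odd (size v).
Proof.
elim=> {u v} [_ _ [a b x|a b x y xy]|u|u v _ ->|u1 u2 u3 _ -> _ ->] //.
- by rewrite !size_cat /= !oddD /= negbK.
- by rewrite !size_cat.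
Qed.

Lemma odd_len w : odd (len (cls w)) = odd (size w).
Proof.
have [u Eu <-] := len_word (cls w).
by apply: racg_equiv_odd_size; apply/racg_classP.
Qed.

Lemma odd_len_gen s x : odd (len (gen s * x)%g) = ~~ odd (len x).
Proof.
by have [u <- _] := len_word x; rewrite -cls_cons !odd_len.
Qed.

Definition ldesc s x := (len (gen s * x)%g < len x)%N.

Lemma ldescT s x : ldesc s x -> len x = (len (gen s * x)%g).+1.
Proof.
rewrite /ldesc => lt; apply/eqP; rewrite eqn_leq lt andbT.
by rewrite -{1}(genK s x) (leq_trans (len_mul _ _)) // -add1n leq_add2r len_gen.
Qed.

Lemma ldescF s x : ~~ ldesc s x -> len (gen s * x)%g = (len x).+1.
Proof.
rewrite /ldesc -leqNgt => le; apply/eqP; rewrite eqn_leq.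
rewrite (leq_trans (len_mul _ _)) /=; last by rewrite -add1n leq_add2r len_gen.
rewrite ltn_neqAle le andbT; apply/eqP => E.
by have := odd_len_gen s x; rewrite -E; case: odd.
Qed.

Lemma ldesc_gen s x : ldesc s (gen s * x)%g = ~~ ldesc s x.
Proof.
rewrite {1}/ldesc genK; case: (boolP (ldesc s x)) => [/ldescT|/ldescF] E; lia.
Qed.

Definition red w := len (cls w) == size w.

Lemma red_word x : exists2 w, cls w = x & red w.
Proof. by have [w E S] := len_word x; exists w => //; rewrite /red E S. Qed.

Lemma red_catl u v : red (u ++ v) -> red u.
Proof.
rewrite /red cls_cat size_cat => /eqP E; rewrite eqn_leq len_cls /=.
by have := len_mul (cls u) (cls v); rewrite E; have := len_cls v; lia.
Qed.

Lemma red_catr u v : red (u ++ v) -> red v.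
Proof.
rewrite /red cls_cat size_cat => /eqP E; rewrite eqn_leq len_cls /=.
by have := len_mul (cls u) (cls v); rewrite E; have := len_cls u; lia.
Qed.

Lemma red_cons s w : red (s :: w) -> red w.
Proof. exact: (@red_catr [:: s]). Qed.

Lemma red_rev w : red (rev w) = red w.
Proof. by rewrite /red cls_rev len_inv size_rev. Qed.

Lemma red_rcons w s : red (rcons w s) -> red w.
Proof. by rewrite -cats1; exact: red_catl. Qed.

Lemma red_ldesc s w : red (s :: w) -> ldesc s (cls (s :: w)).
Proof.
move=> r; rewrite /ldesc (eqP r) cls_cons genK ltnS; exact: len_cls.
Qed.

End Length.
Arguments len_cls {V e} w.
Arguments len_gen {V e} s.

(** * Reflection representations and positivity of roots *)

(** Lengths of convertible group elements that are written through different
structures must be named alike before linear arithmetic can use them. *)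
Ltac len_lia :=
  repeat match goal with
    | H : context [len _] |- _ => revert H
    | H : context [size _] |- _ => revert H end;
  repeat (let k := fresh "k" in set k := (len _); clearbody k);
  repeat (let k := fresh "k" in set k := (size _); clearbody k); lia.

Section Action.
Variables (V : finType) (e : rel V).
Hypothesis e_sym : symmetric e.
Local Notation W := (racg e).
Local Notation cls := (@racg_class V e).
Local Notation gen := (@racg_gen V e).
Local Notation red := (@red V e).
Implicit Types (s t r : V) (w u v a : seq V) (g h : W).
Variables (R : realFieldType) (E : lmodType R) (B : E -> E -> R) (al : V -> E).
Hypotheses (form_sym : forall x y, B x y = B y x)
  (form_linear : forall k x y z, B (k *: x + y) z = k * B x z + B y z)
  (al1 : forall s, al s = 0 \/ B (al s) (al s) = 1)
  (al_edge : forall s t, e s t -> B (al s) (al t) = 0).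

Definition refl s (x : E) : E := x - (2 * B x (al s)) *: al s.
Definition actw w (x : E) : E := foldr refl x w.
Definition rho (g : W) : E -> E := actw (repr g).

Lemma form0 x : B 0 x = 0.
Proof. by have := form_linear 1 0 0 x; rewrite scale1r addr0 mul1r; lra. Qed.
Lemma formD x y z : B (x + y) z = B x z + B y z.
Proof. by have := form_linear 1 x y z; rewrite scale1r mul1r. Qed.
Lemma formZ k x z : B (k *: x) z = k * B x z.
Proof. by have := form_linear k x 0 z; rewrite addr0 form0 addr0. Qed.
Lemma formN x z : B (- x) z = - B x z.
Proof. by rewrite -scaleN1r formZ mulN1r. Qed.

Lemma refl_lin s k x y : refl s (k *: x + y) = k *: refl s x + refl s y.
Proof.
rewrite /refl form_linear scalerBr scalerA addrACA -opprD -scalerDl; congr (_ - _ *: _); ring.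
Qed.

Lemma refl_form s x y : B (refl s x) (refl s y) = B x y.
Proof.
rewrite /refl !(formD, formN, formZ) ![B _ (_ - _)]form_sym !(formD, formN, formZ).
rewrite ![B (al s) _]form_sym [B y x]form_sym; case: (al1 s) => ->; last by ring.
by rewrite ![B _ 0]form_sym !form0; ring.
Qed.

Lemma reflK s x : refl s (refl s x) = x.
Proof.
rewrite /refl formD formN formZ; case: (al1 s) => ->; first by rewrite !scaler0 !subr0.
rewrite mulr1 -addrA -opprD -scalerDl.
have -> : 2 * B x (al s) + 2 * (B x (al s) - 2 * B x (al s)) = 0 by ring.
by rewrite scale0r subr0.
Qed.

Lemma refl_comm s t x : e s t -> refl s (refl t x) = refl t (refl s x).
Proof.
move=> /al_edge st; rewrite /refl !(formD, formN, formZ) [B (al t) _]form_sym st.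
by rewrite !mulr0 !oppr0 !addr0 addrAC.
Qed.

Lemma actw_cat u v x : actw (u ++ v) x = actw u (actw v x).
Proof. by rewrite /actw foldr_cat. Qed.

Lemma racg_equiv_actw u v x : racg_equiv e u v -> actw u x = actw v x.
Proof.
move=> uv; elim: uv x => {u v} [_ _ [a b s|a b s t st]|u|u u' _ IH|u1 u2 u3 _ IH1 _ IH2] x //.
- by rewrite !actw_cat /= reflK.
- by rewrite !actw_cat /= refl_comm.
- by rewrite IH1.
Qed.

Lemma rho_cls w x : rho (cls w) x = actw w x.
Proof. by apply: racg_equiv_actw; exact: racg_equiv_repr. Qed.

Lemma rhoM g h x : rho (g * h)%g x = rho g (rho h x).
Proof.
have [u <- _] := len_word g; have [v <- _] := len_word h.
by rewrite -cls_cat !rho_cls actw_cat.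
Qed.

Lemma rho1 x : rho 1%g x = x.
Proof. by rewrite -cls_nil rho_cls. Qed.

Lemma rho_gen s x : rho (gen s) x = refl s x.
Proof. exact: (rho_cls [:: s]). Qed.

Lemma rhoK g x : rho (g^-1)%g (rho g x) = x.
Proof. by rewrite -rhoM mulVg rho1. Qed.

Lemma rhoKV g x : rho g (rho (g^-1)%g x) = x.
Proof. by rewrite -rhoM mulgV rho1. Qed.

Lemma rho_lin g k x y : rho g (k *: x + y) = k *: rho g x + rho g y.
Proof.
have [u <- _] := len_word g; rewrite !rho_cls.
by elim: u => //= s u ->; rewrite refl_lin.
Qed.

Lemma rho0 g : rho g 0 = 0.
Proof.
have := rho_lin g 1 0 0; rewrite !scale1r addr0 => H.
by apply: (@addrI _ (rho g 0)); rewrite -H addr0.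
Qed.
Lemma rhoD g x y : rho g (x + y) = rho g x + rho g y.
Proof. by have := rho_lin g 1 x y; rewrite !scale1r. Qed.
Lemma rhoZ g k x : rho g (k *: x) = k *: rho g x.
Proof. by have := rho_lin g k x 0; rewrite rho0 !addr0. Qed.
Lemma rhoN g x : rho g (- x) = - rho g x.
Proof. by rewrite -[- x]scaleN1r rhoZ scaleN1r. Qed.

Lemma rho_form g x y : B (rho g x) (rho g y) = B x y.
Proof.
have [u <- _] := len_word g; rewrite !rho_cls.
by elim: u => //= s u IH; rewrite refl_form.
Qed.

Lemma rho_formV g x y : B (rho g x) y = B x (rho g^-1%g y).
Proof. by rewrite -[y in LHS](rhoKV g) rho_form. Qed.

Variables (Q : pred V) (phi : E -> R) (b : R).
Hypotheses (phi_lin : forall k x y, phi (k *: x + y) = k * phi x + phi y)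
  (b_ge0 : 0 <= b) (phi_al : forall s, Q s -> b <= phi (al s))
  (alQ : forall s, Q s -> B (al s) (al s) = 1)
  (al_far : forall s t, Q s -> Q t -> s != t -> ~~ e s t -> B (al s) (al t) <= -1).

(** The two conclusions are proved together, by induction on [w]. If [s] and [t]
are not adjacent, then [al s + al t] has a non-positive product with each
[al r], so that a reflection only adds positive roots to it. And the reflection
of [r], not adjacent to [s], maps [al s] to [(al s + al r) + k *: al r] with
[1 <= k]. The form [phi] will be a coordinate in the basis of simple roots, or
the product with a point of the chamber of a polygon; for the centre of the
polygon the bound [b] is positive. *)
Lemma roots_positive w : all Q w -> red w ->
  (forall s, Q s -> red (rcons w s) -> b <= phi (actw w (al s))) /\
  (forall s t, Q s -> Q t -> s != t -> ~~ e s t ->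
     0 <= phi (actw w (al s + al t))).
Proof.
have actw_lin u k x y : actw u (k *: x + y) = k *: actw u x + actw u y.
  by rewrite -!rho_cls rho_lin.
have phiD x y : phi (x + y) = phi x + phi y.
  by have := phi_lin 1 x y; rewrite scale1r mul1r.
elim/last_ind: w => [_ _|w r IH].
  split=> [s Qs _|s t Qs Qt _ _]; first exact: phi_al.
  by rewrite phiD addr_ge0 // (le_trans b_ge0) // phi_al.
rewrite all_rcons => /andP[Qr Qw] rw; have [] := IH Qw (red_rcons rw).
move=> {IH} IH1 IH2; have ge_r := IH1 r Qr rw.
have act_r x : actw (rcons w r) x = (- (2 * B x (al r))) *: actw w (al r) + actw w x.
  by rewrite -cats1 actw_cat /= /refl addrC -scaleNr actw_lin.
have B_le0 x : Q x -> x != r -> B (al x) (al r) <= 0.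
  move=> Qx xr; case: (boolP (e x r)) => [/al_edge -> //|exr].
  by apply: le_trans (al_far Qx Qr xr exr) _; lra.
split=> [s Qs rws|s t Qs Qt st est].
  have sr : s != r.
    apply/eqP => sr; move: rws; rewrite /red sr !cls_rcons -mulgA gen_sq mulg1.
    by rewrite !size_rcons => /eqP Esz; have := @len_cls V e w; rewrite Esz; lia.
  rewrite act_r; case: (boolP (e s r)) => [esr|esr].
    rewrite al_edge // mulr0 oppr0 scale0r add0r; apply: IH1 => //.
    move: rws; rewrite /red !cls_rcons -mulgA.
    rewrite -(racg_gen_commute esr) mulgA !size_rcons => /eqP Esz.
    have := len_mul (cls w * gen s)%g (gen r); have := @len_gen V e r.
    have := @len_cls V e (rcons w s); rewrite cls_rcons size_rcons Esz => *; apply/eqP; lia.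
  have gs := al_far Qs Qr sr esr; have := IH2 _ _ Qs Qr sr esr.
  have -> : al s + al r = 1 *: al s + al r by rewrite scale1r.
  rewrite actw_lin !phi_lin => H.
  have gs' : 0 <= - (2 + 2 * B (al s) (al r)) by lra.
  have := mulr_ge0 gs' (le_trans b_ge0 ge_r); move: H ge_r.
  set A := phi _; set C := phi _; set D := B _ _ => H1 H2 H3; lra.
rewrite act_r phi_lin; have := IH2 _ _ Qs Qt st est; set A := phi _ => H.
have Hb : B (al s + al t) (al r) <= 0.
  rewrite formD; have [rs|sr] := eqVneq s r.
    subst s; rewrite alQ //; have := al_far Qt Qr; rewrite eq_sym e_sym => /(_ st est); lra.
  have Bs := B_le0 s Qs sr; have [rt|tr] := eqVneq t r.
    by subst t; rewrite alQ //; have := al_far Qs Qr st est; lra.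
  by have := B_le0 t Qt tr; lra.
apply: addr_ge0 => //; apply: mulr_ge0; last exact: le_trans ge_r.
by rewrite oppr_ge0; lra.
Qed.

End Action.

(** * Descents and the exchange condition *)

Section WordProblem.
Variables (V : finType) (e : rel V).
Hypotheses (e_sym : symmetric e) (e_irr : irreflexive e).
Local Notation W := (racg e).
Local Notation cls := (@racg_class V e).
Local Notation gen := (@racg_gen V e).
Local Notation red := (@red V e).
Implicit Types (s t r : V) (w a : seq V) (g : W).

Local Notation E := {ffun V -> rat^o}.
Definition tits_coef s t : rat := if s == t then 1 else if e s t then 0 else -1.
Definition tits_form (x y : E) : rat :=
  \sum_s \sum_t (x s : rat) * tits_coef s t * (y t : rat).
Definition tits_root s : E := [ffun t => (t == s)%:R].

Lemma tits_coefC s t : tits_coef s t = tits_coef t s.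
Proof. by rewrite /tits_coef eq_sym e_sym. Qed.

Lemma tits_form_sym x y : tits_form x y = tits_form y x.
Proof.
rewrite /tits_form exchange_big; apply: eq_bigr => s _; apply: eq_bigr => t _.
by rewrite tits_coefC; ring.
Qed.

Lemma tits_form_lin k (x y z : E) :
  tits_form (k *: x + y) z = k * tits_form x z + tits_form y z.
Proof.
rewrite /tits_form mulr_sumr -big_split; apply: eq_bigr => s _.
rewrite mulr_sumr -big_split; apply: eq_bigr => t _.
by rewrite !ffunE /= /GRing.scale /=; ring.
Qed.

Lemma tits_form_root s t : tits_form (tits_root s) (tits_root t) = tits_coef s t.
Proof.
rewrite /tits_form (bigD1 s) //= [X in _ + X]big1 => [|i /negPf si]; last first.
  by apply: big1 => j _; rewrite ffunE si !mul0r.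
rewrite addr0 (bigD1 t) //= [X in _ + X]big1 => [|i /negPf ti]; last first.
  by rewrite !ffunE ti !mulr0.
by rewrite !ffunE !eqxx addr0 mulr1 mul1r.
Qed.

Lemma tits_root1 s : tits_root s = 0 \/ tits_form (tits_root s) (tits_root s) = 1.
Proof. by right; rewrite tits_form_root /tits_coef eqxx. Qed.

Lemma tits_edge s t : e s t -> tits_form (tits_root s) (tits_root t) = 0.
Proof.
rewrite tits_form_root /tits_coef; case: eqP => [->|_ ->] //.
by rewrite e_irr.
Qed.

Local Notation act := (rho tits_form tits_root).
Local Notation refl := (refl tits_form tits_root).
Definition nonneg (x : E) := forall t, 0 <= (x t : rat).

Let actM := rhoM tits_form_sym tits_form_lin tits_root1 tits_edge.
Let act_gen := rho_gen tits_form_sym tits_form_lin tits_root1 tits_edge.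
Let actK := rhoK tits_form_sym tits_form_lin tits_root1 tits_edge.
Let actD := rhoD tits_form_sym tits_form_lin tits_root1 tits_edge.
Let actZ := rhoZ tits_form_sym tits_form_lin tits_root1 tits_edge.
Let actN := rhoN tits_form_sym tits_form_lin tits_root1 tits_edge.
Let act_form := rho_form tits_form_sym tits_form_lin tits_root1 tits_edge.
Let act_formV := rho_formV tits_form_sym tits_form_lin tits_root1 tits_edge.
Let act_cls := rho_cls tits_form_sym tits_form_lin tits_root1 tits_edge.

Lemma tits_far s t : predT s -> predT t -> s != t -> ~~ e s t ->
  tits_form (tits_root s) (tits_root t) <= -1.
Proof.
by rewrite tits_form_root /tits_coef => _ _ /negPf -> /negPf ->.
Qed.

(** The coordinates are linear forms to which [roots_positive] applies. *)
Lemma act_nonneg g :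
  (forall s, ~~ ldesc s g^-1%g -> nonneg (act g (tits_root s))) /\
  (forall s t, s != t -> ~~ e s t -> nonneg (act g (tits_root s + tits_root t))).
Proof.
have [w <- rw] := red_word g.
have lin t k (x y : E) : (k *: x + y) t = k * (x t : rat) + y t by rewrite !ffunE.
have pos t s : predT s -> 0 <= (tits_root s t : rat) by move=> _; rewrite ffunE ler0n.
have one s : predT s -> tits_form (tits_root s) (tits_root s) = 1.
  by rewrite tits_form_root /tits_coef eqxx.
have H t : (forall s, red (rcons w s) -> 0 <= (act (cls w) (tits_root s) t : rat)) /\
   (forall s r, s != r -> ~~ e s r ->
     0 <= (act (cls w) (tits_root s + tits_root r) t : rat)).
  have [H1 H2] := roots_positive e_sym tits_form_sym tits_form_lin tits_root1
    tits_edge (lin t) (lexx (0 : rat)) (pos t) one tits_far (all_predT w) rw.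
  split=> [s rs|s r sr esr]; rewrite act_cls; first exact: H1.
  exact: H2.
split=> [s + t|s r sr esr t]; last exact: (H t).2.
move=> /ldescF L; apply: (H t).1; rewrite /red cls_rcons -len_inv.
by rewrite invgM gen_inv L len_inv (eqP rw) size_rcons.
Qed.

Lemma act_nonpos g s : ldesc s g^-1%g -> nonneg (- act g (tits_root s)).
Proof.
move=> L; have [H _] := act_nonneg (g * gen s)%g.
have := H s; rewrite invgM gen_inv ldesc_gen L => /(_ isT).
rewrite actM act_gen /refl tits_form_root /tits_coef eqxx.
have -> : tits_root s - (2 * 1) *: tits_root s = - tits_root s.
  by rewrite -{1}[tits_root s]scale1r -scalerBl -scaleN1r; congr (_ *: _); ring.
by rewrite actN.
Qed.

Lemma nonneg_anti x : nonneg x -> nonneg (- x) -> x = 0.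
Proof.
move=> x1 x2; apply/ffunP => t; rewrite ffunE; have := x1 t; have := x2 t.
by rewrite ffunE => ? ?; apply/eqP; rewrite eq_le; apply/andP; split; lra.
Qed.

Lemma act_root_neq0 g s : act g (tits_root s) <> 0.
Proof.
move=> H; have := act_form g (tits_root s) (tits_root s).
rewrite H tits_form_root /tits_coef eqxx.
by rewrite (form0 tits_form_lin) => /esym/eqP; rewrite oner_eq0.
Qed.

(** Descents are signs of roots: this reduces statements on lengths to linear
algebra. *)
Lemma ldesc_sign s g : ldesc s g <-> nonneg (- act g^-1%g (tits_root s)).
Proof.
split=> [L|H]; first by apply: act_nonpos; rewrite invgK.
apply: contrapT => /negP L; have [H1 _] := act_nonneg g^-1%g.
apply: (act_root_neq0 (nonneg_anti _ H)); apply: H1; by rewrite invgK.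
Qed.

(** If [s] and [t] were not adjacent, the image of [tits_root s + tits_root t]
would be nonnegative, while the images of the two roots are nonpositive. *)
Lemma ldesc_edge s t (z : W) : s != t -> ldesc s z -> ldesc t z -> e s t.
Proof.
move=> st /ldesc_sign Hs /ldesc_sign Ht; apply: contrapT => /negP est.
have [_ H] := act_nonneg z^-1%g; have {}H := H s t st est.
apply: (@act_root_neq0 z^-1%g s); apply: nonneg_anti Hs => r.
by have := H r; have := Ht r; rewrite actD !ffunE => ? ?; lra.
Qed.

Lemma ldesc_comm s t (z : W) : e s t -> ldesc s (gen t * z)%g = ldesc s z.
Proof.
move=> est; suff H : ldesc s (gen t * z)%g <-> ldesc s z by apply/idP/idP => /H.
rewrite !ldesc_sign invgM gen_inv actM act_gen /refl tits_edge //.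
by rewrite mulr0 scale0r subr0.
Qed.

(** The inverse of an element other than 1 has a descent [s], and then [g] maps the
simple root of [s] to a nonpositive vector. *)
Lemma act_faithful g : (forall x, act g x = x) -> g = 1%g.
Proof.
move=> H; have [w Ew rw] := red_word g; case/lastP: w => [|w s] in Ew rw *.
  by rewrite -Ew.
have : ldesc s g^-1%g.
  by rewrite -Ew -cls_rev rev_rcons red_ldesc // -rev_rcons red_rev.
move=> /act_nonpos; rewrite H => /(_ s); rewrite !ffunE eqxx.
by rewrite oppr_ge0 ler10.
Qed.

(** A reflection changes only one coordinate, so that a positive root which it makes
negative is a multiple of its own simple root. Hence [s] and the conjugate of
[r] by [y] act by the same reflection. *)
Lemma exchange s (y : W) r :
  ~~ ldesc s y -> ldesc s (y * gen r)%g -> (gen s * y = y * gen r)%g.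
Proof.
move=> L1 /ldesc_sign; rewrite invgM gen_inv actM act_gen => H2.
have [+ _] := act_nonneg y^-1%g; rewrite invgK => /(_ s L1) H1.
set v := act _ _ in H1 H2; set c : rat := v r.
have Ev : v = c *: tits_root r.
  apply/ffunP => t; rewrite !ffunE; have [->|tr] := eqVneq t r.
    by rewrite /GRing.scale /= mulr1.
  have := H1 t; have := H2 t; rewrite !ffunE (negPf tr) /GRing.scale /= !mulr0 subr0.
  by move=> ? ?; apply/eqP; rewrite eq_le; apply/andP; split; lra.
have c1 : c = 1.
  have := act_form y^-1%g (tits_root s) (tits_root s); rewrite -/v Ev.
  rewrite (formZ tits_form_lin) tits_form_sym (formZ tits_form_lin) !tits_form_root.
  rewrite /tits_coef !eqxx mulr1 => /eqP; rewrite -expr2 sqrf_eq1 => /orP[/eqP //|/eqP cN].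
  by have := H1 r; rewrite -/c cN.
suff E1 : (gen r * (y^-1 * gen s * y) = 1)%g.
  have : (y * gen r * (gen r * (y^-1 * gen s * y)) = y * gen r)%g by rewrite E1 mulg1.
  by rewrite -mulgA genK !mulgA mulgV mul1g.
apply: act_faithful => x; rewrite !actM !act_gen.
have -> : act y^-1%g (refl s (act y x)) = refl r x.
  by rewrite {1}/refl actD actN actZ actK act_formV -/v Ev c1 scale1r.
exact: (reflK tits_form_lin tits_root1).
Qed.

(** A path that crosses the wall of [s] does so along an edge, and by [exchange] the
reflection in this wall exchanges the two ends of this edge; reflecting the rest
of the path saves the edge. *)
Lemma fold_word s g w : ~~ ldesc s g -> ldesc s (g * cls w)%g ->
  exists w1 r w2, w = w1 ++ r :: w2 /\ (gen s * g * cls w = g * cls (w1 ++ w2))%g.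
Proof.
elim: w g => [|r w IH] g L1; first by rewrite cls_nil gmulr1 (negPf L1).
rewrite cls_cons gmulA => L2; case: (boolP (ldesc s (g * gen r)%g)) => L3.
  exists [::], r, w; split=> //.
  by rewrite /= gmulA (exchange L1 L3) -(mulgA g) gen_sq gmulr1.
have [w1 [q [w2 [Ew H]]]] := IH _ L3 L2.
exists (r :: w1), q, w2; split; first by rewrite Ew.
by rewrite cat_cons cls_cons !gmulA -H !gmulA.
Qed.

Lemma fold_len s g (z : W) : ~~ ldesc s g -> ldesc s z ->
  (len (g^-1 * gen s * z)%g < len (g^-1 * z)%g)%N.
Proof.
have [w Ew rw] := red_word (g^-1 * z)%g => L1.
have -> : z = (g * cls w)%g by rewrite Ew gmulA gmulrV gmul1.
move=> /(fold_word L1)[w1 [r [w2 [Dw H]]]].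
rewrite -gmulA [X in (_ * X)%g]mulgA H !gmulA gmulV !gmul1 (eqP rw).
by apply: leq_ltn_trans (len_cls _) _; rewrite Dw !size_cat /= addnS.
Qed.

(** A descent of a reduced product that is not a descent of the first factor is moved
through this factor one letter after the other by [ldesc_edge]. *)
Lemma ldesc_additive s a (z : W) :
  len (cls a * z)%g = (size a + len z)%N -> ldesc s (cls a * z)%g ->
  ~~ ldesc s (cls a) -> all (e s) a /\ ldesc s z.
Proof.
elim: a => [|t a IH]; first by rewrite cls_nil gmul1.
move=> La Ls Ls'; have {}La : len (cls (t :: a) * z)%g = ((size a).+1 + len z)%N by [].
have ra : len (cls a * z)%g = (size a + len z)%N.
  apply/eqP; rewrite eqn_leq; rewrite (leq_trans (len_mul _ _)) ?leq_add2r ?len_cls //.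
  have := len_mul (gen t) (cls a * z)%g; rewrite gmulA -cls_cons La.
  by have := @len_gen V e t => *; lia.
have Lt : ldesc t (cls (t :: a) * z)%g.
  by rewrite /ldesc La cls_cons -gmulA genK ra.
have st : s != t.
  apply/eqP => st; move/negP: Ls'; apply; rewrite st /ldesc cls_cons genK.
  have := len_mul (cls (t :: a)) z; rewrite La cls_cons => ?.
  have := @len_cls V e a => ?; lia.
have est := ldesc_edge st Ls Lt.
move: Ls Ls'; rewrite cls_cons -gmulA !ldesc_comm // => Ls Ls'.
by have [H1 H2] := IH ra Ls Ls'; split=> //; apply/andP.
Qed.

Lemma ldesc_mem s w : red w -> ldesc s (cls w) -> s \in w.
Proof.
elim: w => [|t w IH] rw Ls; first by move: Ls; rewrite /ldesc cls_nil len1.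
rewrite inE; have [//|st] := eqVneq s t; apply: IH; first exact: red_cons rw.
have est := ldesc_edge st Ls (red_ldesc rw).
by move: Ls; rewrite cls_cons ldesc_comm.
Qed.

Lemma commute_word s w : all (e s) w -> (gen s * cls w = cls w * gen s)%g.
Proof.
elim: w => [|t w IH] /=; first by rewrite cls_nil gmulr1 gmul1.
case/andP => est /IH H; rewrite cls_cons gmulA (racg_gen_commute est).
by rewrite -gmulA H gmulA.
Qed.

(** Two occurrences of the same letter could be brought together and cancelled. *)
Lemma red_uniq w : red w -> {in w &, forall s t, s != t -> e s t} -> uniq w.
Proof.
elim: w => [|s w IH] //= rw H.
have uw : uniq w.
  by apply: IH (red_cons rw) _ => a b aw bw; apply: H; rewrite inE ?aw ?bw orbT.
rewrite uw andbT; apply/negP => sw; case/splitPr: sw => w1 w2 in rw H uw.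
have sw1 : all (e s) w1.
  apply/allP => t tw1; apply: H; rewrite ?inE ?eqxx ?mem_cat ?tw1 ?orbT //.
  apply/eqP => st; move: uw; rewrite cat_uniq => /and3P[_ /hasPn/(_ s)].
  by rewrite inE eqxx st tw1 => /(_ isT).
move: rw; rewrite /red cls_cons cls_cat cls_cons gmulA (commute_word sw1).
rewrite -gmulA genK -cls_cat => /eqP.
by have := @len_cls V e (w1 ++ w2); rewrite /= !size_cat /= => + E2; rewrite E2; lia.
Qed.
End WordProblem.

(** * Projections to intervals *)

Section Intervals.
Variables (V : finType) (e : rel V).
Hypotheses (e_sym : symmetric e) (e_irr : irreflexive e).
Local Notation W := (racg e).
Local Notation cls := (@racg_class V e).
Local Notation gen := (@racg_gen V e).
Local Notation red := (@red V e).
Implicit Types (s t r : V) (w a X U : seq V) (g h m x y z : W).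

Lemma first_cancellation X y : (len (cls X * y)%g < size X + len y)%N ->
  exists X' s U, [/\ X = X' ++ s :: U, len (cls U * y)%g = (size U + len y)%N &
    ldesc s (cls U * y)%g].
Proof.
elim: X => [|s X IH]; first by rewrite cls_nil gmul1 ltnn.
case: (ltnP (len (cls X * y)%g) (size X + len y)) => [/IH[X' [r [U [-> H1 H2]]]] _|L1 L2].
  by exists (s :: X'), r, U.
exists [::], s, X.
have L3 : len (cls X * y)%g = (size X + len y)%N.
  apply/eqP; rewrite eqn_leq L1 andbT (leq_trans (len_mul _ _)) ?leq_add2r //.
  exact: len_cls.
split=> //; apply: contraTT L2 => /ldescF L4.
by rewrite cls_cons -gmulA L4 L3 -leqNgt.
Qed.

Lemma red_cons_ldescF s w : red (s :: w) -> ~~ ldesc s (cls w).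
Proof.
by move=> r; rewrite /ldesc -cls_cons (eqP r) -leqNgt (leq_trans (len_cls w)).
Qed.

(** Reading [X] from its end, the first letter that cancels in the product does so
against [y], and commutes with everything in between. *)
Lemma cancel_letter X U y : red (X ++ U) ->
  len (cls U * y)%g = (size U + len y)%N ->
  (len (cls X * cls U * y)%g < size X + size U + len y)%N ->
  exists X' s X'', [/\ X = X' ++ s :: X'', all (e s) (X'' ++ U) & ldesc s y].
Proof.
move=> rXU addU L.
have [X' [s [X'' [EX H1 H2]]]] := @first_cancellation X (cls U * y)%g
  ltac:(by rewrite gmulA addU addnA).
have rs : red (s :: X'' ++ U) by move: rXU; rewrite EX -catA; exact: red_catr.
have [] := @ldesc_additive V e e_sym e_irr s (X'' ++ U) y _ _ (red_cons_ldescF rs).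
- by rewrite cls_cat -gmulA H1 size_cat addU addnA.
- by rewrite cls_cat -gmulA.
by move=> ? ?; exists X', s, X''.
Qed.

(** Each letter that cancels commutes with [U], and there is only one such letter by
hypothesis. A second cancellation would bring two copies of it together in the
reduced word [X]. *)
Lemma contraction X U y :
  (forall s t, all (e s) U -> all (e t) U -> s = t) ->
  red (X ++ U) -> len (cls U * y)%g = (size U + len y)%N ->
  (size X + size U + len y <= len (cls X * cls U * y)%g + 2)%N.
Proof.
move=> H rXU addU; rewrite leqNgt; apply/negP => L.
have L1 : (len (cls X * cls U * y)%g < size X + size U + len y)%N by lia.
(* The letter s of X cancels against y; what remains is a product of the same form. *)
have [X' [s [X'' [EX asU sy]]]] := cancel_letter rXU addU L1.
move: (asU); rewrite all_cat => /andP[asX sU].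
have EXs : cls X = (cls (X' ++ X'') * gen s)%g.
  by rewrite EX !cls_cat cls_cons (commute_word asX) gmulA.
have sUc := commute_word sU.
have Ey : (cls X * cls U * y = cls (X' ++ X'') * cls U * (gen s * y))%g.
  by rewrite EXs -!gmulA [X in (_ * X)%g]gmulA sUc !gmulA.
have rXU1 : red ((X' ++ X'') ++ U).
  rewrite /red eqn_leq len_cls /=.
  have E1 : cls (X ++ U) = (cls ((X' ++ X'') ++ U) * gen s)%g.
    by rewrite !(cls_cat, EXs) -!gmulA sUc.
  have := len_mul (cls ((X' ++ X'') ++ U)) (gen s); rewrite -E1 (eqP rXU).
  have := @len_gen V e s; rewrite EX !size_cat /= => *; lia.
have ysy := ldescT sy.
have addU1 : len (cls U * (gen s * y))%g = (size U + len (gen s * y)%g)%N.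
  apply/eqP; rewrite eqn_leq (leq_trans (len_mul _ _)) ?leq_add2r ?len_cls //.
  have := len_mul (gen s) (cls U * (gen s * y))%g.
  rewrite (gmulA (gen s) (cls U)) sUc -gmulA genK addU.
  by have := @len_gen V e s => *; lia.
have sX : size X = (size (X' ++ X'')).+1 by rewrite EX !size_cat addnS.
have L2 : (len (cls (X' ++ X'') * cls U * (gen s * y))%g <
   size (X' ++ X'') + size U + len (gen s * y)%g)%N by rewrite -Ey; lia.
have [Y' [t [Y'' [EY atU ty]]]] := cancel_letter rXU1 addU1 L2.
have : s = t by apply: H => //; move: atU; rewrite all_cat => /andP[].
move=> st; subst t; move: atU; rewrite all_cat => /andP[asY _].
have : cls X = cls (Y' ++ Y'').
  rewrite EXs EY !cls_cat cls_cons (commute_word asY).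
  by rewrite gmulA -gmulA gen_sq gmulr1.
have := red_catl rXU => /eqP rX EXY; move: rX; rewrite EXY.
have := @len_cls V e (Y' ++ Y''); have : size X = (size (Y' ++ Y'')).+2.
  by rewrite sX EY !size_cat addnS.
by move=> -> + E2; rewrite E2; lia.
Qed.

Lemma common_prefix x y : exists c x1 y1, [/\ x = (c * x1)%g, y = (c * y1)%g,
  len x = (len c + len x1)%N, len y = (len c + len y1)%N &
  forall s, ldesc s x1 -> ~~ ldesc s y1].
Proof.
have [k] := ubnP (len x); elim: k x y => // k IH x y lt.
case: (pselect (exists s, ldesc s x && ldesc s y)) => [[s /andP[sx sy]]|N].
  have [|c [x1 [y1 [E1 E2 L1 L2 D]]]] := IH (gen s * x)%g (gen s * y)%g.
    by have := ldescT sx => ?; lia.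
  have lx := ldescT sx; have ly := ldescT sy.
  have Ex : x = (gen s * c * x1)%g by rewrite -gmulA -E1 genK.
  have lc : len (gen s * c)%g = (len c).+1.
    have := len_mul (gen s * c)%g x1; rewrite -Ex; have := len_mul (gen s) c.
    by have := @len_gen V e s => *; lia.
  exists (gen s * c)%g, x1, y1; split=> //; rewrite ?lc.
  - by rewrite -gmulA -E2 genK.
  - by rewrite lx L1.
  - by rewrite ly L2.
exists 1%g, x, y; rewrite !gmul1 len1; split=> // s sx; apply/negP => sy.
by apply: N; exists s; rewrite sx.
Qed.

(** The first letter of [a] is a descent of the common product that does not come
from [a'], so that it commutes with [a'] by [ldesc_additive]. Geometrically, the
two paths span a grid of squares. *)
Lemma disjoint_commute a a' x x' : red a -> red a' ->
  (cls a * x = cls a' * x')%g ->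
  len (cls a * x)%g = (size a + len x)%N ->
  len (cls a' * x')%g = (size a' + len x')%N ->
  (forall s, ldesc s (cls a) -> ~~ ldesc s (cls a')) ->
  forall s t, s \in a -> t \in a' -> e s t.
Proof.
elim: a x' => [|s a IH] // x' ra ra' E L L' D.
have sa := red_ldesc ra.
have sh : ldesc s (cls a' * x')%g.
  rewrite -E /ldesc L cls_cons -gmulA genK.
  by apply: leq_ltn_trans (len_mul _ _) _; rewrite ltn_add2r ltnS len_cls.
have [asa' sx'] := ldesc_additive e_sym e_irr L' sh (D _ sa).
move=> r t; rewrite inE => /predU1P[->|ra1] ta'; first exact: (allP asa').
have lx' := ldescT sx'.
apply: (IH (gen s * x')%g) ra1 ta' => //; first exact: red_cons ra.
- rewrite gmulA -(commute_word asa') -gmulA -E cls_cons -gmulA genK //.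
- have := len_mul (gen s) (cls a * x)%g; rewrite gmulA -cls_cons L.
  have := @len_gen V e s; have := len_mul (cls a) x; have := @len_cls V e a.
  by move=> /= *; lia.
- have := len_mul (gen s) (cls a' * (gen s * x'))%g.
  have -> : (gen s * (cls a' * (gen s * x')) = cls a' * x')%g.
    by rewrite gmulA (commute_word asa') -gmulA genK.
  rewrite L'; have := @len_gen V e s; have := len_mul (cls a') (gen s * x')%g.
  by have := @len_cls V e a' => *; lia.
- move=> q qa; apply/negP => qa'.
  have esq : e s q by apply: (allP asa'); exact: ldesc_mem qa'.
  have := D q; rewrite cls_cons ldesc_comm //; first by rewrite qa' => /(_ qa).
  by rewrite e_sym.
Qed.

Definition between g h z :=
  (len (g^-1 * z)%g + len (z^-1 * h)%g == len (g^-1 * h)%g)%N.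

Lemma len_triangle g h z : (len (g^-1 * h)%g <= len (g^-1 * z)%g + len (z^-1 * h)%g)%N.
Proof. by have := len_mul (g^-1 * z)%g (z^-1 * h)%g; rewrite -gmulA gmulKV. Qed.

Lemma len_swap g h : len (g^-1 * h)%g = len (h^-1 * g)%g.
Proof. by rewrite -len_inv ginvM invgK. Qed.

Lemma interval_left g h : between g h g.
Proof. by rewrite /between gmulV len1. Qed.

(** Intervals are convex: if the wall that separates [m] from [m * gen s] separated
[z] from both [g] and [h], then folding along it would give too short a path from
[g] to [h]. *)
Lemma interval_step g h m z s : between g h m -> between g h z ->
  ldesc s (m^-1 * z)%g -> between g h (m * gen s)%g.
Proof.
move=> Im Iz sz; rewrite /between eqn_leq len_triangle andbT ginvM gen_inv.
have T1 := len_mul (g^-1 * m)%g (gen s); rewrite -gmulA in T1.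
have T2 := len_mul (gen s) (m^-1 * h)%g.
have ls := @len_gen V e s.
rewrite -(eqP Im).
case: (boolP (ldesc s (m^-1 * h)%g)) => [/ldescT sh|sh]; first by rewrite -gmulA; len_lia.
case: (boolP (ldesc s (m^-1 * g)%g)) => [/ldescT sg|sg].
  have : len (g^-1 * (m * gen s))%g = len (gen s * (m^-1 * g))%g.
    by rewrite -len_inv !ginvM gen_inv invgK gmulA.
  by move: T2 sg; rewrite len_swap -!gmulA (len_swap g m) => ? ? ->; len_lia.
have := fold_len e_sym e_irr sh sz; have := fold_len e_sym e_irr sg sz.
rewrite !ginvM !invgK -!gmulA !gmulKV => F1 F2.
have := len_mul (g^-1 * (m * (gen s * (m^-1 * z))))%g (z^-1 * (m * (gen s * (m^-1 * h))))%g.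
have -> : ((g^-1 * (m * (gen s * (m^-1 * z)))) * (z^-1 * (m * (gen s * (m^-1 * h)))) = g^-1 * h)%g.
  by rewrite -!gmulA gmulKV gmulK genK gmulKV.
have -> : len (z^-1 * (m * (gen s * (m^-1 * h))))%g = len (h^-1 * (m * (gen s * (m^-1 * z))))%g.
  by rewrite -len_inv !ginvM gen_inv !invgK -!gmulA.
by rewrite -(eqP Iz); rewrite (len_swap z h) => ?; len_lia.
Qed.

Definition nearest g h x m := between g h m /\
  forall z, between g h z -> (len (m^-1 * x)%g <= len (z^-1 * x)%g)%N.

Lemma nearest_ex g h x : exists m, nearest g h x m.
Proof.
have ex : exists k, `[< exists2 z, between g h z & len (z^-1 * x)%g = k >].
  by exists (len (g^-1 * x)%g); apply/asboolP; exists g => //; exact: interval_left.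
case: (ex_minnP ex) => k /asboolP[m Im <-] H; exists m; split=> // z Iz.
by apply: H; apply/asboolP; exists z.
Qed.

(** If a letter cancelled, crossing its wall from [m] would lead, by
[interval_step], to a point of the interval that is nearer to [x]. *)
Lemma gate g h x m z : nearest g h x m -> between g h z ->
  len (x^-1 * z)%g = (len (x^-1 * m)%g + len (m^-1 * z)%g)%N.
Proof.
move=> [Im near] Iz; apply/eqP; rewrite eqn_leq len_triangle /= leqNgt; apply/negP.
have [X EX rX] := red_word (x^-1 * m)%g; rewrite -EX (eqP rX) => L.
have [] := @cancel_letter X [::] (m^-1 * z)%g.
- by rewrite cats0.
- by rewrite cls_nil gmul1.
- by rewrite cls_nil gmulr1 EX -gmulA gmulKV addn0.
move=> X' [s [X'' [EX' + sz]]]; rewrite cats0 => asX.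
have := near _ (interval_step Im Iz sz).
rewrite len_swap (len_swap (m * gen s)%g) gmulA -EX (eqP rX) EX'.
rewrite cls_cat cls_cons (commute_word asX) -!gmulA gen_sq gmulr1 -cls_cat.
by have := @len_cls V e (X' ++ X''); rewrite !size_cat /= => *; len_lia.
Qed.

Variable Q : pred V.
Definition special g := exists2 w, all Q w & cls w = g.

Lemma special1 : special 1%g. Proof. by exists [::]. Qed.

Lemma specialM g h : special g -> special h -> special (g * h)%g.
Proof.
by move=> [u Qu <-] [w Qw <-]; exists (u ++ w); rewrite ?all_cat ?Qu // cls_cat.
Qed.

Lemma specialV g : special g -> special g^-1%g.
Proof. by move=> [u Qu <-]; exists (rev u); rewrite ?all_rev // cls_rev. Qed.

(** Erasing the letters outside of [Q] defines a retraction onto the special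
subgroup. *)
Lemma racg_equiv_filter u w : racg_equiv e u w ->
  racg_equiv e (seq.filter Q u) (seq.filter Q w).
Proof.
elim=> {u w} [_ _ [a b s|a b s t st]|u|u v _|u v w _ + _]; last first.
- exact: rst_trans.
- exact: rst_sym.
- exact: rst_refl.
- rewrite !filter_cat /=; case: (Q s); case: (Q t) => /=; try exact: rst_refl.
  by apply: rst_step; constructor.
- rewrite !filter_cat /=; case: (Q s) => /=; last exact: rst_refl.
  by apply: rst_step; constructor.
Qed.

(** The retraction onto the special subgroup fixes the element and shortens all words
with a letter outside of [Q]. *)
Lemma special_red w : red w -> special (cls w) -> all Q w.
Proof.
move=> rw [u Qu E]; have : cls (seq.filter Q w) = cls w.
  rewrite -E; apply/racg_classP; have /racg_classP := E.
  by move=> H1; have := racg_equiv_filter H1; rewrite (all_filterP Qu); exact: rst_sym.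
move=> E2; rewrite all_count -size_filter eqn_leq size_filter count_size /=.
by rewrite -size_filter; move/eqP: rw => <-; rewrite -E2 len_cls.
Qed.

Lemma special_interval g h z : special (g^-1 * h)%g -> between g h z ->
  special (g^-1 * z)%g.
Proof.
move=> S /eqP I; have [a Ea /eqP ra] := red_word (g^-1 * z)%g.
have [b Eb /eqP rb] := red_word (z^-1 * h)%g.
have E : cls (a ++ b) = (g^-1 * h)%g by rewrite cls_cat Ea Eb -gmulA gmulKV.
have : red (a ++ b) by rewrite /red E -I -Ea -Eb ra rb size_cat.
move=> /special_red; rewrite E => /(_ S); rewrite all_cat => /andP[Qa _].
by exists a.
Qed.

Hypotheses (no_triangle : forall s t r, Q s -> Q t -> Q r -> e s t -> e t r -> e s r -> False)
  (no_square : forall s t c c', Q s -> Q t -> s != t -> ~~ e s t ->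
     e c s -> e c t -> e c' s -> e c' t -> c = c').

Lemma long_word a : red a -> all Q a -> (2 < size a)%N ->
  exists s t, [/\ s \in a, t \in a, s != t & ~~ e s t].
Proof.
move=> ra Qa sa; apply: contrapT => N.
have cl : {in a &, forall s t, s != t -> e s t}.
  move=> s t sa' ta st; apply: contrapT => /negP est; apply: N.
  by exists s, t.
have := red_uniq ra cl; case: a ra Qa sa N cl => [|s [|t [|r a]]] //= _.
move=> /and4P[Qs Qt Qr _] _ _ cl /and4P[]; rewrite !inE !negb_or => /and3P[st sr _] /andP[tr _] _ _.
by apply: (no_triangle Qs Qt Qr); apply: cl; rewrite ?inE ?eqxx ?orbT.
Qed.

Lemma long_word_link a : red a -> all Q a -> (2 < size a)%N ->
  forall c c', all (e c) a -> all (e c') a -> c = c'.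
Proof.
move=> ra Qa sa c c' /allP ca /allP ca'; have [s [t [sa' ta st est]]] := long_word ra Qa sa.
by apply: (no_square (allP Qa _ sa') (allP Qa _ ta) st est); auto.
Qed.

(** This is strong contraction: a path from [x] to [y] whose projection to the
interval is long is at most two letters shorter than the detour through [mx] and
[my]. The projections differ by a long word in [Q], which only commutes with one
letter, so that [contraction] applies. *)
Lemma interval_contraction g h x y mx my : special (g^-1 * h)%g ->
  nearest g h x mx -> nearest g h y my -> (2 < len (mx^-1 * my)%g)%N ->
  (len (x^-1 * mx)%g + len (mx^-1 * my)%g + len (my^-1 * y)%g
     <= len (x^-1 * y)%g + 2)%N.
Proof.
move=> S nx ny L; have [Ix _] := nx; have [Iy _] := ny.
have [X EX rX] := red_word (x^-1 * mx)%g.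
have [U EU rU] := red_word (mx^-1 * my)%g.
have QU : all Q U.
  apply: (special_red rU); rewrite EU.
  have -> : (mx^-1 * my = (g^-1 * mx)^-1 * (g^-1 * my))%g by rewrite ginvM invgK -gmulA gmulKV.
  by apply: specialM; [apply: specialV|]; apply: special_interval S _.
have sU : (2 < size U)%N by rewrite -(eqP rU) EU.
have := @contraction X U (my^-1 * y)%g (long_word_link rU QU sU) _ _.
rewrite /red cls_cat EX EU -!gmulA !gmulKV -(eqP rX) -(eqP rU) EX EU => H.
apply: H; first by rewrite size_cat -(eqP rX) -(eqP rU) EX EU (gate nx Iy).
have := gate ny Ix; rewrite (len_swap y mx) (len_swap y my) (len_swap my mx).
by move=> ?; len_lia.
Qed.

(** After their common start, the two paths from [g] commute letter by letter
([disjoint_commute]). If they had three letters or more, one would contain two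
non-adjacent letters, and the other one could only repeat their unique common
neighbour. *)
Lemma interval_thin g h z z' : special (g^-1 * h)%g ->
  between g h z -> between g h z' -> len (g^-1 * z)%g = len (g^-1 * z')%g ->
  (len (z^-1 * z')%g <= 4)%N.
Proof.
move=> S Iz Iz' Lz; have [c [x [y [Ex Ey Lx Ly D]]]] := common_prefix (g^-1 * z)%g (g^-1 * z')%g.
have [a Ea ra] := red_word x; have [a' Ea' ra'] := red_word y.
have -> : (z^-1 * z' = x^-1 * y)%g.
  have : ((g^-1 * z)^-1 * (g^-1 * z') = x^-1 * y)%g by rewrite Ex Ey ginvM -gmulA gmulK.
  by rewrite ginvM invgK -gmulA gmulKV.
have saa' : size a = size a' by rewrite -(eqP ra) -(eqP ra') Ea Ea'; len_lia.
apply: leq_trans (len_mul _ _) _; rewrite len_inv -Ea -Ea' (eqP ra) (eqP ra') -saa'.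
suff H2 : (size a <= 2)%N by len_lia.
rewrite leqNgt; apply/negP => sa.
(* Past the common start c, both paths are initial parts of geodesics to h. *)
have Lh u v (Iu : between g h u) : (g^-1 * u = c * v)%g -> len (g^-1 * u)%g = (len c + len v)%N ->
    (c^-1 * (g^-1 * h) = v * (u^-1 * h))%g /\
    len (v * (u^-1 * h))%g = (len v + len (u^-1 * h)%g)%N.
  move=> Eu Lu; have E1 : (c^-1 * (g^-1 * h) = v * (u^-1 * h))%g.
    by rewrite -[v](gmulK c) -Eu -!gmulA gmulKV.
  split=> //; apply/eqP; rewrite eqn_leq len_mul /= -E1.
  have := len_mul c (c^-1 * (g^-1 * h))%g; rewrite gmulKV -(eqP Iu) Lu; len_lia.
have [E1 L1] := Lh z x Iz Ex Lx; have [E2 L2] := Lh z' y Iz' Ey Ly.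
have com := @disjoint_commute a a' (z^-1 * h)%g (z'^-1 * h)%g ra ra'
  ltac:(by rewrite Ea Ea' -E1 -E2) ltac:(by rewrite Ea L1 -Ea (eqP ra))
  ltac:(by rewrite Ea' L2 -Ea' (eqP ra')) ltac:(by rewrite Ea Ea').
have Sa' : all Q a'.
  have [b Eb rb] := red_word c; suff : all Q (b ++ a') by rewrite all_cat => /andP[].
  apply: special_red; first by rewrite /red cls_cat Eb Ea' -Ey Ly size_cat -(eqP rb) -(eqP ra') Eb Ea'.
  by rewrite cls_cat Eb Ea' -Ey; apply: special_interval S _.
have link := long_word_link ra' Sa' ltac:(by rewrite -saa').
have la s : s \in a -> all (e s) a' by move=> sa1; apply/allP => t; exact: com.
case: a ra sa la {Ea saa' com} => [|s [|t a]] // ra _ la.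
have st : s = t by apply: link; apply: la; rewrite !inE eqxx ?orbT.
move: ra; rewrite /red st !cls_cons genK => /eqP E3.
by have := @len_cls V e a; rewrite E3 /=; len_lia.
Qed.

End Intervals.

(** * Quasigeodesics near an interval *)

Section CoarseMorse.
Variables (V : finType) (e : rel V).
Hypotheses (e_sym : symmetric e) (e_irr : irreflexive e).
Local Notation W := (racg e).
Local Notation cls := (@racg_class V e).
Local Notation gen := (@racg_gen V e).
Local Notation red := (@red V e).
Variable Q : pred V.
Hypotheses (no_triangle : forall s t r, Q s -> Q t -> Q r -> e s t -> e t r -> e s r -> False)
  (no_square : forall s t c c', Q s -> Q t -> s != t -> ~~ e s t ->
     e c s -> e c t -> e c' s -> e c' t -> c = c').
Implicit Types (g h : W).
Local Notation d g h := (len (g^-1 * h)%g).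

Lemma gdist_sym g h : d g h = d h g. Proof. exact: len_swap. Qed.
Lemma gdist_triangle g z h : (d g h <= d g z + d z h)%N. Proof. exact: len_triangle. Qed.
Lemma gdist_xx g : d g g = 0%N. Proof. by rewrite gmulV len1. Qed.

Section Quasigeodesic.
Variables (g h : W) (x m : nat -> W) (L K C b : nat).
Hypotheses (gh : special Q (g^-1 * h)%g)
  (xm : forall i, nearest g h (x i) (m i))
  (lower : forall i j, (i <= j <= L)%N -> (j - i <= K * d (x i) (x j) + C)%N)
  (step : forall i, (i < L)%N -> (d (x i) (x i.+1) <= b)%N)
  (start : (d (x 0) (m 0) <= b)%N) (finish : (d (x L) (m L) <= b)%N).

Local Notation D i := (d (x i) (m i)).

Let Dlip i j : (D j <= D i + d (x i) (x j))%N.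
Proof.
have [Ii _] := xm i; have [_ /(_ _ Ii)] := xm j.
have := gdist_triangle (x j) (x i) (m i); rewrite (gdist_sym (x j) (x i)) !(gdist_sym (m _)) => *; len_lia.
Qed.

Let steps i k : (i + k <= L)%N -> (d (x i) (x (i + k)) <= k * b)%N.
Proof.
elim: k => [|k IH] ik; first by rewrite addn0 gdist_xx.
have := IH ltac:(lia); have := gdist_triangle (x i) (x (i + k)) (x (i + k).+1).
have := @step (i + k)%N ltac:(lia); rewrite addnS mulSn => *; len_lia.
Qed.

Let q := (4 * K).+1.
Let rad := (q * b).+1.

Let block i j : (i <= j <= L)%N -> (j <= i + q)%N -> (rad <= D i)%N ->
  (d (m i) (m j) <= 2)%N.
Proof.
move=> ij jq Di; rewrite leqNgt; apply/negP => far.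
have := interval_contraction e_sym e_irr no_triangle no_square gh (xm i) (xm j) far.
have Ej : j = (i + (j - i))%N by lia.
have := @steps i (j - i)%N ltac:(lia); rewrite -Ej.
have : ((j - i) * b <= q * b)%N by rewrite leq_mul2r; apply/orP; right; lia.
move: Di; rewrite /rad => *; len_lia.
Qed.

Let blocks k i j : (i <= j <= L)%N -> (j <= i + k * q)%N ->
  (forall l, (i <= l <= j)%N -> (rad <= D l)%N) -> (d (m i) (m j) <= 2 * k)%N.
Proof.
elim: k i => [|k IH] i ij jk Dl.
  have ji : j = i by lia.
  by rewrite ji gdist_xx.
case: (leqP j (i + q)) => jq.
  have := block ij jq (Dl i ltac:(lia)); rewrite mulnS => *; len_lia.
have := @block i (i + q)%N ltac:(lia) (leqnn _) (Dl i ltac:(lia)).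
have := IH (i + q)%N ltac:(lia) ltac:(lia) _.
move=> /(_ (fun l hl => Dl l ltac:(lia))).
have := gdist_triangle (m i) (m (i + q)) (m j); rewrite mulnS => *; len_lia.
Qed.

(** With steps of length at most [b], a path of [q] steps that starts at distance
[rad] from the interval is too short for its projection to move by more than
[2]. The choice of [q] makes a movement of [2] for every [q] steps slower than
half of the speed which the lower bound of a [(K, C)]-quasigeodesic imposes. *)
Definition morse_gauge := let q := (4 * K).+1 in let rad := (q * b).+1 in
  (rad + b + b * (2 * (K * (2 * (rad + b) + 2) + C)))%N.

(** On a maximal stretch outside of the [rad]-neighbourhood, both the ends are near to
the interval and their projections are near to each other in comparison with the
length [n] of the stretch, which bounds [n]. *)
Lemma quasigeodesic_close i : (i <= L)%N -> (D i <= morse_gauge)%N.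
Proof.
move=> iL; rewrite /morse_gauge -/q -/rad.
case: (leqP (D i) rad) => [Di|Di]; first by lia.
have b_rad : (b <= rad)%N by rewrite /rad /q; lia.
have exa : exists k, (k < i)%N && (D k <= rad)%N.
  exists 0%N; rewrite (leq_trans start) // andbT lt0n; apply/eqP => i0.
  by move: Di; rewrite i0 ltnNge (leq_trans start).
(* The maximal stretch around i outside of the neighbourhood is ]a0, b0[. *)
have [a0 /andP[ai Da] maxa] := ex_maxnP exa (fun k H => ltnW (andP H).1).
have exb : exists k, (i < k <= L)%N && (D k <= rad)%N.
  exists L; rewrite (leq_trans finish) // andbT leqnn andbT ltn_neqAle iL andbT.
  by apply/eqP => i0; move: Di; rewrite i0 ltnNge (leq_trans finish).
have [b0 /andP[/andP[ib bL] Db] minb] := ex_minnP exb.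
have out l : (a0.+1 <= l <= b0.-1)%N -> (rad <= D l)%N.
  move=> hl; rewrite leqNgt; apply/negP => lt.
  case: (ltngtP l i) => li; last by move: lt; rewrite li; lia.
    by have := maxa l; rewrite li (ltnW lt) => /(_ isT); lia.
  by have := minb l; rewrite li (ltnW lt) => /(_ ltac:(lia)); lia.
pose n := (b0.-1 - a0.+1)%N.
have D1 : (D a0.+1 <= rad + b)%N.
  by have := Dlip a0 a0.+1; have := @step a0 ltac:(lia) => *; len_lia.
have D2 : (D b0.-1 <= rad + b)%N.
  have := Dlip b0 b0.-1; have := @step b0.-1 ltac:(lia).
  have -> : b0.-1.+1 = b0 by lia.
  by rewrite (gdist_sym (x b0) (x b0.-1)) => *; len_lia.
have nq := divn_eq n q; have nq' := @ltn_pmod n q isT.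
have mm := @blocks (n %/ q).+1 a0.+1 b0.-1 ltac:(lia) ltac:(rewrite mulSn; lia) out.
have low := @lower a0.+1 b0.-1 ltac:(lia); rewrite -/n in low.
have dx : (d (x a0.+1) (x b0.-1) <= 2 * (rad + b) + 2 + 2 * (n %/ q))%N.
  have := gdist_triangle (x a0.+1) (m a0.+1) (x b0.-1); have := gdist_triangle (m a0.+1) (m b0.-1) (x b0.-1).
  rewrite (gdist_sym (m b0.-1)) => *; move: mm; rewrite mulnS => ?; len_lia.
have n_le : (n <= 2 * (K * (2 * (rad + b) + 2) + C))%N.
  have : (K * d (x a0.+1) (x b0.-1) <= K * (2 * (rad + b) + 2 + 2 * (n %/ q)))%N.
    by rewrite leq_mul2l dx orbT.
  move: low; set A := (K * d _ _)%N; rewrite mulnDr => H1 H2.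
  have : (2 * (K * (2 * (n %/ q))) <= n)%N.
    have -> : (2 * (K * (2 * (n %/ q))) = n %/ q * (4 * K))%N by ring.
    by rewrite [X in (_ <= X)%N]nq /q mulnS -addnA addnCA leq_addr.
  lia.
have := Dlip a0.+1 i; have := @steps a0.+1 (i - a0.+1)%N ltac:(lia).
have -> : (a0.+1 + (i - a0.+1))%N = i by lia.
have : ((i - a0.+1) * b <= b * (2 * (K * (2 * (rad + b) + 2) + C)))%N.
  by rewrite [X in (X <= _)%N]mulnC leq_mul2l; apply/orP; right; rewrite /n in n_le; lia.
by move=> *; len_lia.
Qed.

End Quasigeodesic.
End CoarseMorse.

(** * Word metrics and the subgroup of even elements *)

Section WordLength.
Variable G : groupType.
Implicit Types (H S : set G).

Lemma word_lengthP S g w : spells S w g ->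
  (exists2 w', spells S w' g & size w' = word_length S g) /\
  (word_length S g <= size w)%N.
Proof.
move=> Sw; have ex : exists k, `[< exists2 w', spells S w' g & size w' = k >].
  by exists (size w); apply/asboolP; exists w.
have [k /asboolP ek mink] := ex_minnP ex.
have [[w0 S0 E0] H] : (exists2 w', spells S w' g & size w' = word_length S g) /\
    forall w', spells S w' g -> (word_length S g <= size w')%N.
  apply: (@xgetPex _ 0%N [set l | (exists2 w', spells S w' g & size w' = l) /\
    forall w', spells S w' g -> (l <= size w')%N]).
  by exists k; split=> // w' Sw'; apply: mink; apply/asboolP; exists w'.
by split; [exists w0|exact: H].
Qed.
End WordLength.

Section StandardGenerators.
Variables (V : finType) (e : rel V).
Local Notation W := (racg e).
Local Notation cls := (@racg_class V e).
Local Notation gen := (@racg_gen V e).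
Implicit Types (g h : W).

Definition standard_generators : set W := range gen.
Local Notation S0 := standard_generators.

Lemma spells_word w : spells S0 [seq gen s | s <- w] (cls w).
Proof.
split=> [g /mapP[s _ ->]|]; first by left; exists s.
by rewrite big_map -racg_class_prod.
Qed.

Lemma word_length_standard g : word_length S0 g = len g.
Proof.
have [w Ew /eqP rw] := red_word g.
have := word_lengthP (spells_word w); rewrite Ew size_map -rw Ew => -[[u [Su Eu] <-] le].
apply/eqP; rewrite eqn_leq {}le /= -{}Eu; elim: u Su => [|x u IH] Su.
  by rewrite big_nil len1.
rewrite big_cons (leq_trans (len_mul _ _)) // -[size _]add1n leq_add //; last first.
  by apply: IH => y yu; apply: Su; rewrite inE yu orbT.
have [] := Su x (mem_head _ _) => -[s _ E]; first by rewrite -E len_gen.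
by rewrite -len_inv -E len_gen.
Qed.

Lemma finite_ball n : finite_set [set g : W | (len g <= n)%N].
Proof.
apply: (@sub_finite_set _ _ [set cls (b : seq V) | b in [set: n.-bseq V]]).
  move=> g /= gn; have [w Ew /eqP rw] := red_word g.
  have wn : (size w <= n)%N by rewrite -rw Ew.
  by exists (Bseq wn).
exact/finite_image/finite_finset.
Qed.

Lemma standard_generators_fin : finite_generating_set [set: W] S0.
Proof.
split=> // [|g _]; first exact/finite_image/finite_finset.
by have [w <- _] := red_word g; exists [seq gen s | s <- w]; exact: spells_word.
Qed.

End StandardGenerators.

Section EvenSubgroup.
Variables (V : finType) (e : rel V) (Q : pred V).
Local Notation W := (racg e).
Local Notation cls := (@racg_class V e).
Local Notation gen := (@racg_gen V e).
Implicit Types (g h : W).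

Definition parity (v : V) g := odd (count_mem v (repr g)).

Lemma parity_cls v w : parity v (cls w) = odd (count_mem v w).
Proof.
suff H u u' : racg_equiv e u u' -> odd (count_mem v u) = odd (count_mem v u').
  by apply: H; exact: racg_equiv_repr.
elim=> {u u'} [_ _ [a b s|a b s t st]|u|u u' _ ->|u1 u2 u3 _ -> _ ->] //.
- by rewrite !count_cat /= !oddD [X in _ (+) X]addbA addbb.
- by rewrite !count_cat /= !oddD [in LHS](addbCA (odd (s == v))).
Qed.

Lemma parityM v g h : parity v (g * h)%g = parity v g (+) parity v h.
Proof.
have [u <- _] := red_word g; have [w <- _] := red_word h.
by rewrite -cls_cat !parity_cls count_cat oddD.
Qed.

Lemma parity1 v : parity v (1%g : W) = false.
Proof. by rewrite -[1%g]/(cls [::]) parity_cls. Qed.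

Lemma parityV v g : parity v g^-1%g = parity v g.
Proof. by have [u <- _] := red_word g; rewrite -cls_rev !parity_cls count_rev. Qed.

(** A subgroup of finite index without torsion in the special subgroup: a product of
distinct commuting generators is even only if it is empty. *)
Definition even_special : set W := [set g | special Q g /\ forall v, ~~ parity v g].
Local Notation H := even_special.

Lemma even_special_subgroup : is_subgroup H.
Proof.
split=> [|g h [Sg Pg] [Sh Ph]|g [Sg Pg]].
- by split=> [|v]; [exact: special1|rewrite parity1].
- by split=> [|v]; [exact: specialM|rewrite parityM (negPf (Pg v)) Ph].
- by split=> [|v]; [exact: specialV|rewrite parityV].
Qed.

Definition coset_word g := [seq v <- enum V | parity v g].

Lemma coset_word_special g : special Q g -> all Q (coset_word g).
Proof.
move=> [w Qw <-]; apply/allP => v; rewrite mem_filter parity_cls => /andP[odv _].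
by apply: (allP Qw); rewrite -has_pred1 has_count; case: count odv.
Qed.

Lemma parity_coset_word v g : parity v (cls (coset_word g)) = parity v g.
Proof.
have u : uniq (coset_word g) by apply: filter_uniq; exact: enum_uniq.
rewrite parity_cls (count_uniq_mem _ u).
by rewrite mem_filter mem_enum andbT; case: parity.
Qed.

Lemma len_coset_word g : (len (cls (coset_word g)) <= #|V|)%N.
Proof.
apply: leq_trans (len_cls _) _; rewrite size_filter cardE; exact: count_size.
Qed.

Lemma coset_word_even g : H g -> coset_word g = [::].
Proof.
move=> [_ Pg]; apply/eqP; rewrite -size_eq0 size_filter -leqn0 leqNgt -has_count.
by apply/hasPn => v _; exact: Pg.
Qed.

Definition schreier_generators : set W := [set h | H h /\ (len h <= #|V|.*2.+1)%N].
Local Notation T := schreier_generators.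

(** This is Schreier's method: each prefix of [w] is corrected to an even element by
its coset word, and the quotients of consecutive even elements are short. *)
Lemma schreier_word w : all Q w ->
  exists2 u, spells T u (cls w * (cls (coset_word (cls w)))^-1)%g & size u = size w.
Proof.
elim/last_ind: w => [_|w s IH].
  exists [::] => //; split=> //; rewrite big_nil coset_word_even ?mulgV //.
  by have [] := even_special_subgroup.
rewrite all_rcons => /andP[Qs Qw]; have [u [Tu Eu] Su] := IH Qw.
set c := cls (coset_word _) in Eu; set c' := cls (coset_word _).
have Sw : special Q (cls w) by exists w.
have Sws : special Q (cls (rcons w s)) by exists (rcons w s); rewrite ?all_rcons ?Qs.
exists (rcons u (c * gen s * c'^-1)%g); last by rewrite !size_rcons Su.
split=> [x|]; last first.
  rewrite big_rcons /= Eu [LHS](_ : _ = cls w * c^-1 * (c * gen s * c'^-1))%g //.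
  by rewrite -!gmulA gmulK !gmulA -cls_rcons.
rewrite mem_rcons inE => /predU1P[->|]; last exact: Tu.
left; split; first split=> [|v].
- apply: specialM; last by apply: specialV; eexists; first exact: coset_word_special Sws.
  apply: specialM; first by eexists; first exact: coset_word_special Sw.
  by exists [:: s]; rewrite //= Qs.
- rewrite !parityM parityV !parity_coset_word cls_rcons parityM.
  by case: (parity v (cls w)); case: (parity v (gen s)).
- have := len_mul (c * gen s)%g c'^-1%g; have := len_mul c (gen s).
  have := @len_gen V e s; have := len_coset_word (cls w).
  have := len_coset_word (cls (rcons w s)).
  by rewrite -/c -/c' len_inv -addnn => *; len_lia.
Qed.

Lemma schreier_spells h : H h -> exists2 u, spells T u h & size u = len h.
Proof.
move=> Hh; have [w Ew rw] := red_word h.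
have Qw : all Q w by apply: special_red rw _; rewrite Ew; case: Hh.
have [u] := schreier_word Qw; rewrite Ew coset_word_even // cls_nil invg1 mulg1.
by move=> Su E; exists u; rewrite // E -(eqP rw) Ew.
Qed.

Lemma even_special_undistorted (R : realType) : undistorted R H.
Proof.
exists (@standard_generators V e), T; split; first exact: standard_generators_fin.
  split=> [|h [] //|h Hh]; last by have [u] := schreier_spells Hh; exists u.
  by apply: sub_finite_set (@finite_ball V e #|V|.*2.+1) => h [].
have [_ HM HV] := even_special_subgroup.
have bound h : H h -> (word_length T h <= len h)%N /\
    (len h <= #|V|.*2.+1 * word_length T h)%N.
  move=> Hh; have [u Su Eu] := schreier_spells Hh.
  have [[w [Tw Ew] Sw] le] := word_lengthP Su; split; first by rewrite -Eu.
  rewrite -Sw -Ew => {u Su Hh Eu le Sw Ew}.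
  elim: w Tw => [|x w IH] Tw; first by rewrite big_nil len1.
  rewrite big_cons; apply: leq_trans (len_mul x _) _; rewrite /= mulnS leq_add //.
    by have [[_ //]|[_]] := Tw x (mem_head _ _); rewrite len_inv.
  by apply: IH => y yw; apply: Tw; rewrite inE yw orbT.
exists (#|V|.*2.+1%:R), 0; split=> // [|g h Hg Hh]; first by rewrite ler1n.
have [] := bound _ (HM _ _ (HV _ Hg) Hh).
rewrite /word_dist word_length_standard; set a := word_length _ _; set b := len _.
rewrite subr0 addr0 -natrM !ler_nat => ab ba; split; last by [].
rewrite ler_pdivrMr ?ltr0n // -natrM ler_nat (leq_trans ab) // mulnC leq_pmull //.
Qed.

End EvenSubgroup.

(** * Stability of undistorted subgroups of a special subgroup *)

Section Stability.
Variables (V : finType) (e : rel V) (R : realType).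
Hypotheses (e_sym : symmetric e) (e_irr : irreflexive e).
Local Notation W := (racg e).
Local Notation cls := (@racg_class V e).
Local Notation gen := (@racg_gen V e).
Local Notation red := (@red V e).
Local Notation S0 := (@standard_generators V e).
Local Notation pt := (cayley_point R S0).
Implicit Types (g h : W) (p q : pt).
Local Notation d g h := (len (g^-1 * h)%g).
Local Notation cd := (@cayley_dist R W S0).

Lemma word_dist_len g h : word_dist R S0 g h = (d g h)%:R.
Proof. by rewrite /word_dist word_length_standard. Qed.

Lemma cay_edge_le1 p : (d (cay_src p) (cay_dst p) <= 1)%N.
Proof.
case: (cay_edge p) => [->|[s _ <-]|[s _ E]]; first by rewrite gdist_xx.
  exact: len_gen.
by rewrite gdist_sym -E len_gen.
Qed.

Lemma cay_pos01 p : 0 <= cay_pos p <= 1.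
Proof.
have /andP[-> H] := cay_pos_itv p; apply: le_trans H _; by case: (_ != _).
Qed.

Lemma cay_copos01 p : 0 <= cay_copos p <= 1.
Proof.
have /andP[H0 H] := cay_pos_itv p; rewrite /cay_copos subr_ge0 H /=.
by move: H; case: (_ != _) => /= ?; lra.
Qed.

(** Points of the realization are replaced by vertices at a bounded cost. *)
Lemma cayley_dist_src p q : `|cd p q - (d (cay_src p) (cay_src q))%:R| <= 4 :> R.
Proof.
set a := cay_src p; set b := cay_dst p; set c := cay_src q; set f := cay_dst q.
have Hp := cay_pos01 p; have Hq := cay_pos01 q.
have Cp := cay_copos01 p; have Cq := cay_copos01 q.
have ab := cay_edge_le1 p; have cf := cay_edge_le1 q; rewrite -/a -/b -/c -/f in ab cf.
rewrite /cayley_dist -/a -/b -/c -/f.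
case: ifP => [/andP[/eqP -> _]|_].
  by rewrite gdist_xx subr0 normr_id ler_norml; lra.
case: ifP => [/andP[/eqP E _]|_].
  have : ((d a c)%:R <= 1 :> R) by rewrite E gdist_sym -[leRHS]/(1%:R) ler_nat.
  have : 0 <= (d a c)%:R :> R by [].
  move: (_%:R) => r r0 r1; rewrite ler_norml.
  have : `|cay_pos p - cay_copos q| <= 1 by rewrite ler_norml; lra.
  have : 0 <= `|cay_pos p - cay_copos q| by [].
  by move: `|_| => y; lra.
rewrite !word_dist_len.
have tri : [/\ (d a c <= d a f + 1)%N, (d a c <= d b c + 1)%N & (d a c <= d b f + 2)%N].
  have := gdist_triangle a f c; have := gdist_triangle a b c; have := gdist_triangle b f c.
  by rewrite (gdist_sym f c) => *; split; len_lia.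
have [] := tri; rewrite -!(ler_nat R) !natrD => t1 t2 t3.
move: t1 t2 t3; set x := (d a c)%:R; set y := (d a f)%:R.
set z := (d b c)%:R; set w := (d b f)%:R => t1 t2 t3.
rewrite ler_norml; apply/andP; split.
  by rewrite lerBrDr !le_min; apply/andP; split; apply/andP; split; lra.
rewrite lerBlDr !ge_min; apply/orP; left; apply/orP; left; lra.
Qed.

Lemma cayley_dist_vertex g h : cd (cayley_vertex R S0 g) (cayley_vertex R S0 h) = (d g h)%:R.
Proof.
rewrite /cayley_dist /cay_copos /= !eqxx /= !andbb subrr.
have [->|gh] := eqVneq g h; first by rewrite gdist_xx normr0.
by rewrite !add0r !addr0 word_dist_len !minxx.
Qed.

Section Geodesic.
Variables (g : W) (w : seq V).
Hypothesis rw : red w.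

Definition geodesic_vertex i := (g * cls (take i w))%g.

Lemma geodesic_dist i j : (i <= j <= size w)%N ->
  d (geodesic_vertex i) (geodesic_vertex j) = (j - i)%N.
Proof.
move=> ij; rewrite /geodesic_vertex ginvM -gmulA gmulK.
have Ej : take j w = take i w ++ drop i (take j w).
  by rewrite -{1}(cat_take_drop i (take j w)) take_takel //; case/andP: ij.
rewrite Ej cls_cat gmulK.
have : red (drop i (take j w)).
  apply: (@red_catr _ _ (take i w)); rewrite -Ej.
  by apply: (@red_catl _ _ _ (drop j w)); rewrite cat_take_drop.
by move=> /eqP ->; rewrite size_drop size_takel //; case/andP: ij.
Qed.

Definition geodesic (t : R) : pt := cayley_vertex R S0 (geodesic_vertex (Num.truncn t)).

Lemma geodesic_quasi : quasigeodesic cd 1 1 0 (size w)%:R geodesic.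
Proof.
split=> // s t; rewrite !in_itv /= => /andP[s0 sw] /andP[t0 tw].
wlog st : s t s0 sw t0 tw / s <= t => [H|].
  case: (leP s t) => [|/ltW] st; first exact: H.
  by have := H t s t0 tw s0 sw st; rewrite distrC !cayley_dist_vertex gdist_sym.
rewrite cayley_dist_vertex geodesic_dist; last first.
  rewrite le_truncn //= -(ler_nat R); apply: le_trans tw; by rewrite truncn_le.
rewrite natrB ?le_truncn // distrC ger0_norm ?subr_ge0 // divr1 mul1r.
have := truncn_itv s0; have := truncn_itv t0; rewrite -!natr1.
set a := (Num.truncn s)%:R; set b := (Num.truncn t)%:R => ? ?; lra.
Qed.

End Geodesic.

Variable Q : pred V.
Hypotheses (no_triangle : forall s t r, Q s -> Q t -> Q r -> e s t -> e t r -> e s r -> False)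
  (no_square : forall s t c c', Q s -> Q t -> s != t -> ~~ e s t ->
     e c s -> e c t -> e c' s -> e c' t -> c = c').

Lemma interval_near_geodesic g w z : red w -> all Q w ->
  between g (g * cls w)%g z -> exists2 i, (i <= size w)%N & (d z (geodesic_vertex g w i) <= 4)%N.
Proof.
move=> rw Qw Iz; have S : special Q (g^-1 * (g * cls w))%g by rewrite gmulK; exists w.
have L : (d g (g * cls w)%g = size w)%N by rewrite gmulK (eqP rw).
have iw : (d g z <= size w)%N by rewrite -L -(eqP Iz) leq_addr.
exists (d g z) => //; have [D0 Dw] :
   d g (geodesic_vertex g w (d g z)) = d g z /\
   d (geodesic_vertex g w (d g z)) (g * cls w)%g = (size w - d g z)%N.
  have := @geodesic_dist g w rw 0 (d g z) iw; rewrite subn0 /geodesic_vertex take0 gmulr1 => ->.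
  split=> //; have := @geodesic_dist g w rw (d g z) (size w).
  by rewrite /geodesic_vertex iw leqnn take_size => /(_ isT).
apply: (interval_thin e_sym e_irr no_triangle no_square S Iz).
  by rewrite /between D0 Dw L subnKC.
by rewrite D0.
Qed.

Lemma geodesic_interval g w i : red w -> (i <= size w)%N ->
  between g (g * cls w)%g (geodesic_vertex g w i).
Proof.
move=> rw iw; rewrite /between; have := @geodesic_dist g w rw 0 i iw.
have := @geodesic_dist g w rw i (size w); rewrite iw leqnn => /(_ isT).
rewrite /geodesic_vertex take0 take_size gmulr1 => -> ->.
by rewrite gmulK (eqP rw) subn0 subnKC.
Qed.

Lemma nat_bound (k : R) : exists n : nat, k <= n%:R.
Proof. by exists (Num.truncn k).+1; exact/ltW/truncnS_gt. Qed.

(** The path [sigma], which need not be continuous, is sampled at unit steps of its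
parameter, and [quasigeodesic_close] is applied to the samples. The projection to
the interval is then near to the geodesic by [interval_thin]. *)
Lemma geodesic_morse_ex (K C : R) : exists N : R, 0 <= N /\
  forall g w, red w -> all Q w -> forall a' b' (sigma : R -> pt),
    quasigeodesic cd K C a' b' sigma ->
    (exists2 s, s \in `[0, (size w)%:R] & cd (sigma a') (geodesic g w s) = 0) ->
    (exists2 s, s \in `[0, (size w)%:R] & cd (sigma b') (geodesic g w s) = 0) ->
    forall t, t \in `[a', b'] ->
      exists2 s, s \in `[0, (size w)%:R] & cd (sigma t) (geodesic g w s) <= N.
Proof.
have [K1 HK] := nat_bound K; have [C1 HC] := nat_bound C.
pose b := (K1 + C1 + 4)%N; pose Cn := (K1 * (C1 + 4) + 1)%N.
exists (b + morse_gauge K1 Cn b + 4 + 4)%:R; split=> // g w rw Qw a' b' sigma qs.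
have [K0 C0 ab qg] := qs => -[s0 s0w sa] [s1 s1w sb].
(* Truncation at b' makes the last sample the end of the path. *)
pose tau i := Num.min (a' + i%:R) b'; pose x i := cay_src (sigma (tau i)).
pose L := (Num.truncn (b' - a')).+1.
have tau_itv i : tau i \in `[a', b'].
  by rewrite in_itv /= le_min ge_min lexx orbT lerDl ler0n ab.
have src_upper s t : s \in `[a', b'] -> t \in `[a', b'] -> `|s - t| <= 1 ->
    (d (cay_src (sigma s)) (cay_src (sigma t)) <= b)%N.
  move=> si ti st; have [_ up] := qg s t si ti.
  have := cayley_dist_src (sigma s) (sigma t); rewrite ler_norml => /andP[lo _].
  rewrite -(ler_nat R) /b !natrD; set D := _%:R in lo *.
  have := ler_wpM2l (le_trans ler01 K0) st; move: up lo.
  by move: (cd _ _) `|_| => y r; lra.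
have taud i j : (i <= j <= L)%N -> `|tau i - tau j| <= (j - i)%:R /\
    (j - i)%:R <= `|tau i - tau j| + 1.
  move=> /andP[ij jL]; rewrite natrB //.
  have ijR : (i%:R <= j%:R :> R) by rewrite ler_nat.
  have bL : a' + L%:R <= b' + 1.
    by have := truncn_le (b' - a'); rewrite subr_ge0 ab /L -natr1; lra.
  have jLR : (j%:R <= L%:R :> R) by rewrite ler_nat.
  rewrite distrC /tau.
  have [?|?] := leP (a' + i%:R) b'; have [?|?] := leP (a' + j%:R) b';
    rewrite ?subrr ?normr0 ?ger0_norm; lra.
have gw : special Q (g^-1 * (g * cls w))%g by rewrite gmulK; exists w.
have [m xm] := choice (fun i => nearest_ex g (g * cls w)%g (x i)).
have ends t s : t \in `[a', b'] -> s \in `[0, (size w)%:R] -> cd (sigma t) (geodesic g w s) = 0 ->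
    forall k, nearest g (g * cls w)%g (cay_src (sigma t)) k ->
    (d (cay_src (sigma t)) k <= b)%N.
  move=> ti; rewrite in_itv /= => /andP[s_ge0 s_le] E k [_ near].
  have tw : (Num.truncn s <= size w)%N by rewrite -(ler_nat R) (le_trans _ s_le) ?truncn_le.
  have := near _ (geodesic_interval g rw tw); rewrite !(gdist_sym _ (cay_src _)) => H.
  apply: leq_trans H _; rewrite -(ler_nat R).
  have := cayley_dist_src (sigma t) (geodesic g w s); rewrite E /= sub0r normrN normr_nat => H.
  by apply: le_trans H _; rewrite ler_nat /b leq_addl.
have tau0 : tau 0%N = a' by rewrite /tau addr0; apply/min_idPl.
have tauL : tau L = b'.
  apply/min_idPr; have := truncnS_gt (b' - a'); rewrite -/L; lra.
have close : forall i, (i <= L)%N -> (d (x i) (m i) <= morse_gauge K1 Cn b)%N.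
  apply: (quasigeodesic_close e_sym e_irr no_triangle no_square gw xm).
  - move=> i j ij; have [_ h] := taud i j ij.
    have [lo _] := qg _ _ (tau_itv i) (tau_itv j).
    have := cayley_dist_src (sigma (tau i)) (sigma (tau j)); rewrite ler_norml -/(x i) -/(x j) => /andP[_ up].
    rewrite -(ler_nat R) /Cn !(natrD, natrM); move: h lo up.
    set D := (d _ _)%:R; move: (cd _ _) `|_| (_ - _)%:R => y r k kr lo up.
    have D0 : 0 <= D by [].
    have : r <= K * (D + 4 + C) by rewrite mulrC -ler_pdivrMr; lra.
    have C1_0 : 0 <= C1%:R :> R by [].
    have : K * (D + 4 + C) <= K1%:R * (D + 4 + C1%:R) by apply: ler_pM; lra.
    by rewrite !mulrDr; lra.
  - move=> i iL; apply: src_upper => //; have [h _] := taud i i.+1 ltac:(lia).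
    by apply: le_trans h _; rewrite subSnn.
  - by apply: (ends _ s0 (tau_itv 0%N)) (xm 0%N); rewrite ?tau0.
  - by apply: (ends _ s1 (tau_itv L)) (xm L); rewrite ?tauL.
move=> t ti; move: (ti); rewrite in_itv /= => /andP[ta tb].
pose i := Num.truncn (t - a').
have t0 : 0 <= t - a' by rewrite subr_ge0.
have iL : (i <= L)%N by rewrite /L leqW // le_truncn //; lra.
have it := truncn_itv t0; rewrite -/i -natr1 in it.
have taui : tau i = a' + i%:R by apply/min_idPl; lra.
have ti1 : `|t - tau i| <= 1 by rewrite taui ler_norml; lra.
have D1 := src_upper _ _ ti (tau_itv i) ti1.
have D2 := close i iL; have [k kw D3] := interval_near_geodesic rw Qw (xm i).1.
exists k%:R; first by rewrite in_itv /= ler0n ler_nat.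
have := cayley_dist_src (sigma t) (geodesic g w k%:R); rewrite ler_norml => /andP[_].
rewrite /= natrK -lerBrDr opprK => H; apply: le_trans H _.
rewrite addrC -natrD ler_nat leq_add2r.
apply: leq_trans (gdist_triangle _ (x i) _) _; rewrite -addnA leq_add //.
by apply: leq_trans (gdist_triangle _ (m i) _) _; exact: leq_add.
Qed.

Theorem special_subgroup_stable (H : set W) :
  is_subgroup H -> H `<=` special Q -> undistorted R H -> stable R H.
Proof.
move=> HG HQ uH; split=> //; exists S0; split; first exact: standard_generators_fin.
have [N HN] := choice (fun kc : R * R => geodesic_morse_ex kc.1 kc.2).
exists (fun k c => N (k, c)), 1, 1; split=> [k c _ _|g h Hg Hh].
  by have [] := HN (k, c).
have [_ HM HV] := HG.
have [w Ew rw] := red_word (g^-1 * h)%g.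
have Qw : all Q w by apply: special_red rw _; rewrite Ew; apply: HQ; apply: HM => //; apply: HV.
exists 0, (size w)%:R, (geodesic g w); split.
- exact: geodesic_quasi.
- by rewrite /geodesic truncn0 /geodesic_vertex take0 gmulr1.
- by rewrite /geodesic natrK /geodesic_vertex take_size Ew gmulKV.
move=> k c a' b' sigma qs e1 e2 t ti.
by have [_ /(_ g w rw Qw a' b' sigma qs e1 e2 t ti)] := HN (k, c).
Qed.

End Stability.

(** * The hyperbolic plane *)

Section HyperbolicPlane.
Variable R : realType.
Local Notation E3 := (R^o * R^o * R^o)%type.
Implicit Types (u v w : E3) (p q r : R * R) (x y c : R).

Definition mink u v : R := (u.1.1 : R) * v.1.1 + (u.1.2 : R) * v.1.2 - (u.2 : R) * v.2.
Definition on_sheet u := mink u u = -1 /\ 0 < (u.2 : R).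
(** The hyperboloid is parametrized by its vertical projection to the whole plane, in
which straight segments provide the paths and homotopies that are needed for the
fundamental group. *)
Definition hlift p : E3 := (p, Num.sqrt (1 + p.1 ^+ 2 + p.2 ^+ 2)).
Definition hcosh p q := - mink (hlift p) (hlift q).
Definition arcosh c := ln (c + Num.sqrt (c ^+ 2 - 1)).
Definition hdist p q := arcosh (hcosh p q).

Lemma mink_sym u v : mink u v = mink v u.
Proof. by rewrite /mink; ring. Qed.

Lemma mink_lin k u v w : mink (k *: u + v) w = k * mink u w + mink v w.
Proof. by rewrite /mink /= /GRing.scale /=; ring. Qed.

Lemma hlift_sheet p : on_sheet (hlift p).
Proof.
have H : 0 < 1 + p.1 ^+ 2 + p.2 ^+ 2.
  by have := sqr_ge0 p.1; have := sqr_ge0 p.2; lra.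
split; last by rewrite /= sqrtr_gt0.
by rewrite /mink /= -[X in _ - X]expr2 sqr_sqrtr ?ltW //; ring.
Qed.

Lemma sheet_lift u : on_sheet u -> hlift u.1 = u.
Proof.
case: u => [[a b] z] []; rewrite /mink /= => H z0; rewrite /hlift /=; congr (_, _).
have -> : 1 + a ^+ 2 + b ^+ 2 = z ^+ 2 by rewrite !expr2; lra.
by rewrite sqrtr_sqr gtr0_norm.
Qed.

Lemma hcosh_sym p q : hcosh p q = hcosh q p.
Proof. by rewrite /hcosh mink_sym. Qed.

Lemma hcosh_ge1 p q : 1 <= hcosh p q.
Proof.
rewrite /hcosh; have [] := hlift_sheet p; have [] := hlift_sheet q.
case: (hlift p) (hlift q) => [[a b] z] [[a' b'] z']; rewrite /mink /=.
move=> H' z0' H z0; have zz : 0 < z * z' by rewrite mulr_gt0.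
have H2 : (a * a' + b * b' + 1) ^+ 2 <= (z * z') ^+ 2.
  have -> : (z * z') ^+ 2 = (a ^+ 2 + b ^+ 2 + 1) * (a' ^+ 2 + b' ^+ 2 + 1).
    rewrite exprMn; congr (_ * _); rewrite !expr2; lra.
  rewrite -subr_ge0.
  have -> : (a ^+ 2 + b ^+ 2 + 1) * (a' ^+ 2 + b' ^+ 2 + 1) - (a * a' + b * b' + 1) ^+ 2
    = (a * b' - b * a') ^+ 2 + (a - a') ^+ 2 + (b - b') ^+ 2 by ring.
  by rewrite !addr_ge0 ?sqr_ge0.
have := ler_sqrt ((z * z') ^+ 2) (ltac:(by apply: sqr_ge0)).
have : a * a' + b * b' + 1 <= z * z'.
  by apply: le_trans (ler_norm _) _; rewrite -[leRHS]gtr0_norm // -ler_sqr ?nnegrE // !real_normK ?num_real.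
lra.
Qed.

Lemma hcosh_eq1 p q : hcosh p q = 1 -> p = q.
Proof.
rewrite /hcosh; have [] := hlift_sheet p; have [] := hlift_sheet q.
have : (hlift p).1 = p by []. have : (hlift q).1 = q by [].
case: (hlift p) (hlift q) => [[a b] z] [[a' b'] z']; rewrite /mink /= => <- <-.
move=> H' z0' H z0 E.
have H2 : (a * b' - b * a') ^+ 2 + (a - a') ^+ 2 + (b - b') ^+ 2 = 0.
  have -> : (a * b' - b * a') ^+ 2 + (a - a') ^+ 2 + (b - b') ^+ 2 =
     (a ^+ 2 + b ^+ 2 + 1) * (a' ^+ 2 + b' ^+ 2 + 1) - (a * a' + b * b' + 1) ^+ 2 by ring.
  have -> : a ^+ 2 + b ^+ 2 + 1 = z ^+ 2 by rewrite !expr2; lra.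
  have -> : a' ^+ 2 + b' ^+ 2 + 1 = z' ^+ 2 by rewrite !expr2; lra.
  have -> : a * a' + b * b' + 1 = z * z' by lra.
  by ring.
have h1 := sqr_ge0 (a * b' - b * a'); have h2 := sqr_ge0 (a - a'); have h3 := sqr_ge0 (b - b').
have /eqP : (a - a') ^+ 2 = 0 by lra.
have /eqP : (b - b') ^+ 2 = 0 by lra.
by rewrite !sqrf_eq0 !subr_eq0 => /eqP -> /eqP ->.
Qed.

Lemma hcosh_xx p : hcosh p p = 1.
Proof. by rewrite /hcosh (hlift_sheet p).1 opprK. Qed.

(** The left-hand side is the Gram determinant of three vectors for a form of
signature (2,1), which is minus the square of their determinant. *)
Lemma gram u v w :
  mink u u * (mink v v * mink w w - mink v w ^+ 2)
  - mink u v * (mink u v * mink w w - mink v w * mink u w)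
  + mink u w * (mink u v * mink v w - mink v v * mink u w) <= 0.
Proof.
case: u v w => [[a b] c] [[a' b'] c'] [[a2 b2] c2]; rewrite /mink /=.
set X := (X in X <= 0).
have -> : X = - (a * (b' * c2 - c' * b2) - b * (a' * c2 - c' * a2) + c * (a' * b2 - b' * a2)) ^+ 2.
  by rewrite /X; ring.
by rewrite oppr_le0 sqr_ge0.
Qed.

Lemma hcosh_gram p q r :
  0 <= 1 + 2 * hcosh p q * hcosh q r * hcosh p r - hcosh p q ^+ 2 - hcosh q r ^+ 2 - hcosh p r ^+ 2.
Proof.
have := gram (hlift p) (hlift q) (hlift r); rewrite /hcosh.
rewrite (hlift_sheet p).1 (hlift_sheet q).1 (hlift_sheet r).1.
move: (mink _ _) (mink _ _) (mink _ _) => x y z; rewrite !expr2; lra.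
Qed.

Lemma hcosh_triangle p q r :
  hcosh p r <= hcosh p q * hcosh q r + Num.sqrt (hcosh p q ^+ 2 - 1) * Num.sqrt (hcosh q r ^+ 2 - 1).
Proof.
have := hcosh_gram p q r; have := hcosh_ge1 p q; have := hcosh_ge1 q r.
move: (hcosh p q) (hcosh q r) (hcosh p r) => x y z y1 x1 H.
have x2 : 0 <= x ^+ 2 - 1 by rewrite subr_ge0 -(expr1n _ 2) ler_sqr ?nnegrE; lra.
have y2 : 0 <= y ^+ 2 - 1 by rewrite subr_ge0 -(expr1n _ 2) ler_sqr ?nnegrE; lra.
rewrite -lerBlDl -sqrtrM //; apply: le_trans (ler_norm _) _.
rewrite -sqrtr_sqr; rewrite ler_sqrt ?mulr_ge0 //.
rewrite -subr_ge0; apply: le_trans H _; rewrite le_eqVlt; apply/orP; left; apply/eqP.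
by ring.
Qed.

Lemma hcosh_triangle2 p q r : hcosh p r <= 2 * hcosh p q * hcosh q r.
Proof.
have := hcosh_triangle p q r; have := hcosh_ge1 p q; have := hcosh_ge1 q r.
have sq x : 1 <= x -> Num.sqrt (x ^+ 2 - 1) <= x.
  move=> x1; rewrite -{2}[x]gtr0_norm ?(lt_le_trans ltr01) // -sqrtr_sqr.
  by rewrite ler_sqrt ?sqr_ge0 // gerBl.
move: (hcosh p q) (hcosh q r) (hcosh p r) => x y z y1 x1.
have := ler_pM (sqrtr_ge0 _) (sqrtr_ge0 _) (sq _ x1) (sq _ y1); lra.
Qed.

Definition cosh x := (expR x + expR (- x)) / 2.

Lemma arcosh_ge0 c : 1 <= c -> 0 <= arcosh c.
Proof. by move=> c1; apply: ln_ge0; have := sqrtr_ge0 (c ^+ 2 - 1); lra. Qed.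

Lemma cosh_arcosh c : 1 <= c -> cosh (arcosh c) = c.
Proof.
move=> c1; have s0 := sqrtr_ge0 (c ^+ 2 - 1).
have c2 : 0 <= c ^+ 2 - 1 by rewrite subr_ge0 -(expr1n _ 2) ler_sqr ?nnegrE; lra.
rewrite /cosh /arcosh expRN lnK ?posrE; last by lra.
have s2 := sqr_sqrtr c2; move: (Num.sqrt _) s0 s2 => s s0 s2.
have -> : (c + s)^-1 = c - s.
  apply: (@mulfI _ (c + s)); first by rewrite gt_eqF //; lra.
  rewrite mulfV; first by rewrite [RHS]mulrC -subr_sqr s2; ring.
  by rewrite gt_eqF //; lra.
by field.
Qed.

Lemma cosh_lt : {in Num.nneg &, {mono cosh : x y / x < y}}.
Proof.
suff H x y : 0 <= x -> x < y -> cosh x < cosh y.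
  move=> x y; rewrite !nnegrE => x0 y0; apply/idP/idP; last exact: H.
  by case: (ltgtP x y) => [//|/(H y x y0)|->]; rewrite ?ltxx // => /lt_trans h /h; rewrite ltxx.
move=> x0 xy; rewrite /cosh ltr_pM2r ?invr_gt0 // !expRN.
have ex : 1 <= expR x by rewrite -expR0 ler_expR.
have exy : expR x < expR y by rewrite ltr_expR.
move: (expR x) (expR y) ex exy => a b a1 ab.
rewrite -subr_gt0; have -> : b + b^-1 - (a + a^-1) = (b - a) * (a * b - 1) * (a * b)^-1.
  by field; rewrite !gt_eqF //; lra.
have ab1 : 1 < a * b by apply: lt_le_trans (ler_peMl _ a1); lra.
by rewrite mulr_gt0 ?invr_gt0 ?mulr_gt0 ?subr_gt0 //; lra.
Qed.

Lemma arcosh_lt c x : 1 <= c -> 0 <= x -> (arcosh c < x) = (c < cosh x).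
Proof. by move=> c1 x0; rewrite -cosh_lt ?nnegrE ?arcosh_ge0 // cosh_arcosh. Qed.

Lemma arcosh_le c x : 1 <= c -> 0 <= x -> (arcosh c <= x) = (c <= cosh x).
Proof. by move=> c1 x0; rewrite !leNgt -cosh_lt ?nnegrE ?arcosh_ge0 // cosh_arcosh. Qed.

Lemma arcosh1 : arcosh 1 = 0.
Proof. by rewrite /arcosh expr1n subrr sqrtr0 addr0 ln1. Qed.

Lemma hdist_ge0 p q : 0 <= hdist p q.
Proof. exact: arcosh_ge0 (hcosh_ge1 p q). Qed.

Lemma hdist_xx p : hdist p p = 0.
Proof. by rewrite /hdist hcosh_xx arcosh1. Qed.

Lemma hdist_sym p q : hdist p q = hdist q p.
Proof. by rewrite /hdist hcosh_sym. Qed.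

Lemma hdist_eq0 p q : hdist p q = 0 -> p = q.
Proof.
move=> H; apply: hcosh_eq1; rewrite -(cosh_arcosh (hcosh_ge1 p q)) -/(hdist p q) H.
by rewrite /cosh oppr0 expR0; lra.
Qed.

Lemma hdist_triangle q p r : hdist p r <= hdist p q + hdist q r.
Proof.
rewrite arcosh_le ?hcosh_ge1 ?addr_ge0 ?hdist_ge0 //.
apply: le_trans (hcosh_triangle p q r) _; rewrite /cosh.
have := hcosh_ge1 p q; have := hcosh_ge1 q r; rewrite /hdist.
move: (hcosh p q) (hcosh q r) => x y y1 x1.
rewrite opprD !expRD !expRN /arcosh.
have inv (z : R) : 1 <= z -> expR (ln (z + Num.sqrt (z ^+ 2 - 1))) = z + Num.sqrt (z ^+ 2 - 1) /\
    (z + Num.sqrt (z ^+ 2 - 1))^-1 = z - Num.sqrt (z ^+ 2 - 1).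
  move=> z1; have s0 := sqrtr_ge0 (z ^+ 2 - 1).
  have z2 : 0 <= z ^+ 2 - 1 by rewrite subr_ge0 -(expr1n _ 2) ler_sqr ?nnegrE; lra.
  split; first by rewrite lnK ?posrE //; lra.
  have s2 := sqr_sqrtr z2; move: (Num.sqrt _) s0 s2 => s s0 s2.
  have n0 : z + s != 0 by rewrite gt_eqF //; lra.
  by apply: (mulfI n0); rewrite mulfV // [RHS]mulrC -subr_sqr s2; ring.
have [-> ->] := inv x x1; have [-> ->] := inv y y1.
by move: (Num.sqrt _) (Num.sqrt _) => s t; lra.
Qed.

(** The difference of heights enters the form with a negative sign. Hence the
hyperbolic distance is continuous for the topology of the plane. *)
Lemma hcosh_le p q : hcosh p q <= 1 + ((p.1 - q.1) ^+ 2 + (p.2 - q.2) ^+ 2) / 2.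
Proof.
rewrite /hcosh; have [] := hlift_sheet p; have [] := hlift_sheet q.
rewrite /mink /=; set z := Num.sqrt _; set z' := Num.sqrt _ => H _ H' _.
have := sqr_ge0 (z - z'); rewrite !expr2; lra.
Qed.

Lemma hdist_small p q x : 0 < x ->
  (p.1 - q.1) ^+ 2 + (p.2 - q.2) ^+ 2 < 2 * (cosh x - 1) -> hdist p q < x.
Proof.
move=> x0 H; rewrite arcosh_lt ?hcosh_ge1 ?ltW //.
by apply: le_lt_trans (hcosh_le p q) _; lra.
Qed.

Lemma cosh_gt1 x : 0 < x -> 1 < cosh x.
Proof.
move=> x0; have -> : 1 = cosh 0 by rewrite /cosh oppr0 expR0; lra.
by rewrite cosh_lt ?nnegrE // ltW.
Qed.

(** The vector [hlift q - hcosh p q *: hlift p] is orthogonal to [hlift p], so that its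
horizontal part is controlled by its norm. This gives the converse comparison of
the two topologies. *)
Lemma hcosh_close p q :
  (q.1 - hcosh p q * p.1) ^+ 2 + (q.2 - hcosh p q * p.2) ^+ 2
   <= (1 + p.1 ^+ 2 + p.2 ^+ 2) * (hcosh p q ^+ 2 - 1).
Proof.
have E : hcosh p q = - mink (hlift p) (hlift q) by [].
have [] := hlift_sheet p; have [] := hlift_sheet q; move: E.
rewrite /mink /=; set z := Num.sqrt _; set z' := Num.sqrt _.
set c := hcosh p q; move: p.1 p.2 q.1 q.2 => a b a' b' E H' _ H _.
have -> : 1 + a ^+ 2 + b ^+ 2 = z ^+ 2 by rewrite !expr2; lra.
set f := a' - c * a; set g := b' - c * b; set h := z' - c * z.
have orth : a * f + b * g = z * h.
  apply/eqP; rewrite -subr_eq0; apply/eqP.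
  have -> : a * f + b * g - z * h = (a * a' + b * b' - z * z') - c * (a * a + b * b - z * z).
    by rewrite /f /g /h; ring.
  by rewrite H; lra.
have norm : f ^+ 2 + g ^+ 2 - h ^+ 2 = c ^+ 2 - 1.
  have -> : f ^+ 2 + g ^+ 2 - h ^+ 2 = (a' * a' + b' * b' - z' * z') + c ^+ 2 * (a * a + b * b - z * z)
     - 2 * c * (a * a' + b * b' - z * z') by rewrite /f /g /h; ring.
  have -> : a * a' + b * b' - z * z' = - c by lra.
  by rewrite H' H; ring.
rewrite -norm; rewrite mulrBr -[X in _ - X]exprMn -orth.
have -> : z ^+ 2 = 1 + a ^+ 2 + b ^+ 2 by rewrite !expr2; lra.
rewrite -subr_ge0.
have -> : (1 + a ^+ 2 + b ^+ 2) * (f ^+ 2 + g ^+ 2) - (a * f + b * g) ^+ 2 - (f ^+ 2 + g ^+ 2)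
   = (a * g - b * f) ^+ 2 by ring.
exact: sqr_ge0.
Qed.

End HyperbolicPlane.

Section UpperHalfPlane.
Variable R : realType.
Implicit Types (p q : R * R).

(** The inverse of the isometry that maps the point [(x, y)] of the half-plane to the
point [(X, Y, z)] of the hyperboloid with [z + X = (x ^+ 2 + y ^+ 2) / y],
[z - X = 1 / y] and [Y = x / y]. *)
Definition uhp_chart p : R * R :=
  let u := hlift p in (u.1.2 / (u.2 - u.1.1), (u.2 - u.1.1)^-1).

Lemma hlift_gt p : 0 < (hlift p).2 - (hlift p).1.1.
Proof.
have [H z0] := hlift_sheet p; rewrite subr_gt0.
apply: le_lt_trans (ler_norm _) _; rewrite -[ltRHS]gtr0_norm // -ltr_sqr ?nnegrE //.
rewrite !real_normK ?num_real //; move: H; rewrite /mink => H.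
by have := sqr_ge0 ((hlift p).1.2 : R); rewrite !expr2; lra.
Qed.

Lemma uhp_chart_in p : upper_half_plane (uhp_chart p).
Proof. by rewrite /upper_half_plane /= invr_gt0; exact: hlift_gt. Qed.

Lemma uhp_chart_dist p q : hyp_dist (uhp_chart p) (uhp_chart q) = hdist p q.
Proof.
suff E : hyp_cosh_dist (uhp_chart p) (uhp_chart q) = hcosh p q by rewrite /hyp_dist E.
rewrite /hyp_cosh_dist /hcosh /uhp_chart.
have := hlift_gt p; have := hlift_gt q; have [] := hlift_sheet p; have [] := hlift_sheet q.
rewrite /mink; move: (hlift p) (hlift q) => [[X Y] z] [[X' Y'] z'] /=.
move=> H' _ H _; set D := z - X; set D' := z' - X' => D'0 D0.
have nD : D != 0 by rewrite gt_eqF. have nD' : D' != 0 by rewrite gt_eqF.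
have EX : X = ((1 + Y ^+ 2) / D - D) / 2.
  have : (1 + Y ^+ 2) = (z + X) * D by rewrite /D expr2; lra.
  by move=> ->; rewrite mulfK // /D; lra.
have Ez : z = ((1 + Y ^+ 2) / D + D) / 2.
  have : (1 + Y ^+ 2) = (z + X) * D by rewrite /D expr2; lra.
  by move=> ->; rewrite mulfK // /D; lra.
have EX' : X' = ((1 + Y' ^+ 2) / D' - D') / 2.
  have : (1 + Y' ^+ 2) = (z' + X') * D' by rewrite /D' expr2; lra.
  by move=> ->; rewrite mulfK // /D'; lra.
have Ez' : z' = ((1 + Y' ^+ 2) / D' + D') / 2.
  have : (1 + Y' ^+ 2) = (z' + X') * D' by rewrite /D' expr2; lra.
  by move=> ->; rewrite mulfK // /D'; lra.
rewrite EX Ez EX' Ez'; clearbody D D'.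
by field; rewrite nD nD'.
Qed.

Lemma uhp_chart_surj q : upper_half_plane q -> exists p, uhp_chart p = q.
Proof.
case: q => x y; rewrite /upper_half_plane /= => y0; have ny : y != 0 by rewrite gt_eqF.
pose X := ((x ^+ 2 + y ^+ 2) / y - y^-1) / 2; pose z := ((x ^+ 2 + y ^+ 2) / y + y^-1) / 2.
have S : on_sheet ((X, x / y, z) : (R^o * R^o * R^o)%type).
  split; rewrite /mink /= /X /z; first by field.
  rewrite divr_gt0 // addr_gt0 ?invr_gt0 // divr_gt0 //.
  by apply: ltr_wpDl; rewrite ?sqr_ge0 ?exprn_gt0.
exists (X, x / y); rewrite /uhp_chart (sheet_lift S) /=.
have -> : z - X = y^-1 by rewrite /z /X; lra.
by rewrite invrK divfK.
Qed.

End UpperHalfPlane.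

(** * Closed surfaces as quotients of the plane, and their fundamental groups *)

Section UniformContinuity.
Variables (R : realType) (X Y : pseudoMetricType R).

Lemma compact_unif_continuous (K : set X) (f : X -> Y) :
  compact K -> {within K, continuous f} -> forall eps : R, 0 < eps ->
  exists2 eta : R, 0 < eta & forall x y, K x -> K y -> ball x eta y -> ball (f x) eps (f y).
Proof.
move=> /compact_near_coveringP cK cf eps eps0.
pose P (eta : R) x := forall y, K x -> K y -> ball x eta y -> ball (f x) eps (f y).
have : \forall eta \near (0 : R)^'+, K `<=` P eta.
  apply: cK => x Kx.
  have e2 : 0 < eps / 2 by rewrite divr_gt0.
  have : \forall y \near within K (nbhs x), ball (f x) (eps / 2) (f y).
    exact: (subspace_continuousP K f).1 cf x Kx _ (nbhsx_ballx (f x) _ e2).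
  rewrite near_withinE => /nbhs_ballP[r /= r0 Hr].
  exists (ball x (r / 2), [set eta : R | eta < r / 2]) => /=.
    split; first by apply: nbhsx_ballx; rewrite divr_gt0.
    by apply: nbhs_right_lt; rewrite divr_gt0.
  move=> [x' eta] /= [xx' eta_r] y Kx' Ky x'y.
  have r2 : r / 2 <= r by lra.
  apply: (ball_split (z := f x)).
    by apply: ball_sym; apply: Hr => //; exact: le_ball xx'.
  apply: Hr => //; rewrite [r]splitr; apply: ball_triangle xx' _.
  exact: le_ball (ltW eta_r) _ _.
move=> /(@nbhs_ballP R R^o)[eta /= eta0 Heta]; exists (eta / 2); first by rewrite divr_gt0.
move=> x y Kx; apply: Heta => //; rewrite ?divr_gt0 //.
by rewrite /ball /= sub0r normrN gtr0_norm ?divr_gt0 // ltr_pdivrMr // ltr_pMr // ltr1n.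
Qed.
End UniformContinuity.

Section Quotient.
Variables (R : realType) (G : groupType) (H : set G) (act : G -> R * R -> R * R).
Variables (delta rad : R).
Hypotheses (HG : is_subgroup H) (act1 : forall p, act 1%g p = p)
  (actM : forall g h p, act (g * h)%g p = act g (act h p))
  (act_hcosh : forall g p q, hcosh (act g p) (act g q) = hcosh p q)
  (delta0 : 0 < delta)
  (act_far : forall g p, H g -> g <> 1%g -> delta <= hdist p (act g p))
  (act_near : forall p, exists2 g, H g & `|(act g p).1| <= rad /\ `|(act g p).2| <= rad).
Implicit Types (g h : G) (p q r : R * R).

Let H1 : H 1%g. Proof. by case: HG. Qed.
Let HM g h : H g -> H h -> H (g * h)%g. Proof. by case: HG => _ + _; apply. Qed.
Let HV g : H g -> H g^-1%g. Proof. by case: HG => _ _; apply. Qed.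

Lemma actK g p : act g^-1%g (act g p) = p.
Proof. by rewrite -actM mulVg act1. Qed.
Lemma actKV g p : act g (act g^-1%g p) = p.
Proof. by rewrite -actM mulgV act1. Qed.
Lemma act_hdist g p q : hdist (act g p) (act g q) = hdist p q.
Proof. by rewrite /hdist act_hcosh. Qed.

Lemma act_gap g p : H g -> hdist p (act g p) < delta -> g = 1%g.
Proof.
move=> Hg lt; apply: contrapT => g1; have := act_far p Hg g1; lra.
Qed.

Definition orbit_rel : rel (R * R) := fun p q => `[< exists2 g, H g & act g p = q >].

Lemma orbit_refl : reflexive orbit_rel.
Proof. by move=> p; apply/asboolP; exists 1%g. Qed.

Lemma orbit_sym : symmetric orbit_rel.
Proof.
suff S p q : orbit_rel p q -> orbit_rel q p by move=> p q; apply/idP/idP; exact: S.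
by move=> /asboolP[g Hg <-]; apply/asboolP; exists g^-1%g; [exact: HV|rewrite actK].
Qed.

Lemma orbit_trans : transitive orbit_rel.
Proof.
move=> q p r /asboolP[g Hg <-] /asboolP[h Hh <-]; apply/asboolP.
by exists (h * g)%g; [exact: HM|rewrite actM].
Qed.

Local Open Scope quotient_scope.
Canonical orbit_equiv := EquivRel orbit_rel orbit_refl orbit_sym orbit_trans.

Definition surface := {eq_quot orbit_rel}.
HB.instance Definition _ := Choice.on surface.
HB.instance Definition _ := EqQuotient.on surface.
Definition proj p : surface := \pi_surface p.

Lemma proj_act g p : H g -> proj (act g p) = proj p.
Proof. by move=> Hg; apply/eqmodP/asboolP; exists g^-1%g; [exact: HV|rewrite actK]. Qed.

Lemma projP p q : proj p = proj q -> exists2 g, H g & act g p = q.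
Proof. by move=> /eqmodP/asboolP. Qed.

Lemma proj_repr (x : surface) : proj (repr x) = x. Proof. exact: reprK. Qed.

Definition sdist (x y : surface) : R :=
  inf [set hdist (repr x) (act g (repr y)) | g in H].

Lemma sdistE p q : sdist (proj p) (proj q) = inf [set hdist p (act g q) | g in H].
Proof.
rewrite /sdist; have [a Ha <-] := projP (esym (proj_repr (proj p))).
have [b Hb <-] := projP (esym (proj_repr (proj q))); congr inf.
apply/seteqP; split=> _ [g Hg <-].
  exists (a^-1 * (g * b))%g; first by apply: HM; [exact: HV|exact: HM].
  by rewrite -(act_hdist a) !actM actKV.
exists (a * (g * b^-1))%g; first by apply: HM => //; apply: HM => //; exact: HV.
by rewrite !actM actK act_hdist.
Qed.

Lemma sdist_inf p q : has_inf [set hdist p (act g q) | g in H].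
Proof.
split; first by exists (hdist p (act 1%g q)), 1%g.
by exists 0 => _ [g _ <-]; exact: hdist_ge0.
Qed.

Lemma sdist_le g p q : H g -> sdist (proj p) (proj q) <= hdist p (act g q).
Proof. by move=> Hg; rewrite sdistE; apply: (ge_inf (sdist_inf p q).2); exists g. Qed.

Lemma sdist_le1 p q : sdist (proj p) (proj q) <= hdist p q.
Proof. by have := sdist_le p q H1; rewrite act1. Qed.

Lemma sdist_lt p q (eps : R) : sdist (proj p) (proj q) < eps ->
  exists2 g, H g & hdist p (act g q) < eps.
Proof.
rewrite sdistE => lt; have [_ [g Hg <-] Hlt] := inf_lt (sdist_inf p q).1 lt.
by exists g.
Qed.

(** The other translates of [q] are at distance at least [delta / 2] from [p]. *)
Lemma sdist_local p q : hdist p q < delta / 2 -> sdist (proj p) (proj q) = hdist p q.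
Proof.
move=> pq; apply/eqP; rewrite eq_le sdist_le1 /= sdistE.
apply: lb_le_inf; first exact: (sdist_inf p q).1.
move=> _ [g Hg <-]; have [->|g1] := pselect (g = 1%g); first by rewrite act1.
have := act_far q Hg g1; have := hdist_triangle p q (act g q); rewrite (hdist_sym q p); lra.
Qed.

Lemma proj_gap p q : proj p = proj q -> hdist p q < delta -> p = q.
Proof. by move=> /projP[g Hg <-] /(act_gap Hg) ->; rewrite act1. Qed.

Lemma surfaceP (x : surface) : exists p, x = proj p.
Proof. by exists (repr x); rewrite proj_repr. Qed.

Lemma sdist_xx x : sdist x x = 0.
Proof.
have [p ->] := surfaceP x; rewrite sdist_local hdist_xx // divr_gt0 //.
Qed.

Lemma sdist_eq0 x y : sdist x y = 0 -> x = y.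
Proof.
have [p ->] := surfaceP x; have [q ->] := surfaceP y => E.
have : sdist (proj p) (proj q) < delta / 2 by rewrite E divr_gt0.
move=> /sdist_lt[g Hg lt]; have := sdist_local lt; rewrite proj_act // E.
by move=> /esym/hdist_eq0 ->; rewrite proj_act.
Qed.

Lemma sdist_sym x y : sdist x y = sdist y x.
Proof.
have [p ->] := surfaceP x; have [q ->] := surfaceP y; rewrite !sdistE; congr inf.
apply/seteqP; split=> _ [g Hg <-]; exists g^-1%g; try exact: HV.
  by rewrite -(act_hdist g) actKV hdist_sym.
by rewrite -(act_hdist g) actKV hdist_sym.
Qed.

Lemma sdist_triangle y x z : sdist x z <= sdist x y + sdist y z.
Proof.
have [p ->] := surfaceP x; have [q ->] := surfaceP y; have [r ->] := surfaceP z.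
apply/ler_addgt0Pr => eps eps0.
have e2 : 0 < eps / 2 by rewrite divr_gt0.
have [g Hg lt1] := @sdist_lt p q (sdist (proj p) (proj q) + eps / 2) ltac:(by rewrite ltrDl).
have [h Hh lt2] := @sdist_lt q r (sdist (proj q) (proj r) + eps / 2) ltac:(by rewrite ltrDl).
have := sdist_le p r (HM Hg Hh); rewrite actM.
have := hdist_triangle (act g q) p (act g (act h r)); rewrite act_hdist; lra.
Qed.

HB.instance Definition _ := isMetric.Build R surface
  sdist_xx sdist_eq0 sdist_sym sdist_triangle.

Lemma ball_hdist (eps : R) : 0 < eps ->
  exists2 r : R, 0 < r & forall p q, ball p r q -> hdist p q < eps.
Proof.
move=> e0; have c0 := cosh_gt1 e0; pose r := Num.min 1 (cosh eps - 1).
have r0 : 0 < r by rewrite lt_min ltr01 subr_gt0.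
exists r => // p q [] /= b1 b2; apply: hdist_small => //.
have sq x : `|x| < r -> x ^+ 2 < cosh eps - 1.
  move=> xr; rewrite -real_normK ?num_real // expr2.
  have x0 := normr_ge0 x; have : `|x| * `|x| < r * 1.
    apply: ltr_pM => //; apply: lt_le_trans xr _; by rewrite ge_min lexx.
  by rewrite mulr1 => /lt_le_trans; apply; by rewrite ge_min lexx orbT.
by have := sq _ b1; have := sq _ b2; lra.
Qed.

Lemma proj_continuous : continuous (proj : R * R -> surface).
Proof.
move=> p; apply/metricType_numDomainType.cvgrPdist_lt => eps e0.
have [r r0 Hr] := ball_hdist e0; exists (ball p.1 r, ball p.2 r) => [|q /= pq].
  by split; exact: nbhsx_ballx.
exact: le_lt_trans (sdist_le1 p q) (Hr _ _ pq).
Qed.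

Lemma surface_compact : compact [set: surface].
Proof.
have -> : [set: surface] = proj @` (`[- rad, rad]%classic `*` `[- rad, rad]%classic).
  apply/seteqP; split=> // x _; have [p ->] := surfaceP x.
  have [g Hg [h1 h2]] := act_near p; exists (act g p); last exact: proj_act.
  by split; rewrite /= in_itv /= -ler_norml.
apply: continuous_compact; last by apply: compact_setX; exact: segment_compact.
by apply: continuous_subspaceT; exact: proj_continuous.
Qed.

(** Each point is joined to the image of the origin by the image of a segment. *)
Lemma surface_connected : connected [set: surface].
Proof.
pose ray p (t : R) := proj (t *: (p : R^o * R^o)%type).
have -> : [set: surface] = \bigcup_(p in [set: R * R]) (ray p @` `[0, 1]%classic).
  apply/seteqP; split=> // x _; have [p ->] := surfaceP x.
  exists p => //; exists 1; last by rewrite /ray scale1r.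
  by rewrite /= in_itv /= ler01 lexx.
apply: bigcup_connected.
  by exists (proj 0) => p _; exists 0; rewrite ?/ray ?scale0r //= in_itv /= lexx ler01.
move=> p _; apply: connected_continuous_connected; first exact: segment_connected.
apply: continuous_subspaceT => t; apply: continuous_comp; last exact: proj_continuous.
exact: scalel_continuous.
Qed.

Implicit Types (s t eps : R) (f : R -> surface) (c : R -> R * R).

(** The arguments on lifts proceed by small steps of equal length, for which uniform
continuity is the natural form of continuity. *)
Definition unif_path f := forall eps, 0 < eps -> exists2 eta : R, 0 < eta &
  forall s t, 0 <= s <= 1 -> 0 <= t <= 1 -> `|s - t| < eta -> sdist (f s) (f t) < eps.

Definition unif_lift f c := (forall t, 0 <= t <= 1 -> proj (c t) = f t) /\
  forall eps, 0 < eps -> exists2 eta : R, 0 < eta &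
    forall s t, 0 <= s <= 1 -> 0 <= t <= 1 -> `|s - t| < eta -> hdist (c s) (c t) < eps.

Definition lift_near (x : surface) q := xget q [set r | proj r = x /\ hdist q r < delta / 8].

Lemma lift_nearP (x : surface) q : sdist (proj q) x < delta / 8 ->
  proj (lift_near x q) = x /\ hdist q (lift_near x q) < delta / 8.
Proof.
have [r ->] := surfaceP x => /sdist_lt[g Hg lt].
rewrite /lift_near; apply: (@xgetPex _ q [set a | proj a = proj r /\ hdist q a < delta / 8]);
exists (act g r); split=> //; exact: proj_act.
Qed.

(** The interval is cut into [N] pieces that are so short that [f] moves by less than
[delta / 8] along each of them. The ends of the pieces are lifted one after the
other, and the other points are lifted near to the last end before them. By
[sdist_local] this lift is a local isometry onto [f]. *)
Lemma lift_exists f p : unif_path f -> proj p = f 0 ->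
  exists2 c, unif_lift f c & c 0 = p.
Proof.
have lin (u v x y : R) : v - u < y -> u < x + y -> v < x + 2 * y by lra.
have lin2 (u v x : R) : u < delta / 8 -> v < delta / 8 -> x < delta / 8 ->
  u + (v + x) < delta / 2 by move: delta0; lra.
move=> uf fp; have d8 : 0 < delta / 8 by rewrite divr_gt0.
have [eta eta0 Heta] := uf _ d8; pose N : R := (Num.truncn eta^-1).+1%:R.
have N0 : 0 < N by rewrite ltr0n.
have NE : N^-1 < eta by rewrite invf_plt ?posrE // /N truncnS_gt.
have Ni : 0 < N^-1 by rewrite invr_gt0.
pose q := fix q k := if k is k'.+1 then lift_near (f (k'.+1%:R / N)) (q k') else p.
have close s t : 0 <= s <= 1 -> 0 <= t <= 1 -> `|s - t| <= N^-1 -> sdist (f s) (f t) < delta / 8.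
  by move=> s01 t01 st; apply: Heta => //; exact: le_lt_trans st NE.
have k01 k : k%:R <= N -> 0 <= k%:R / N <= 1.
  move=> kN; apply/andP; split; last by rewrite ler_pdivrMr // mul1r.
  by rewrite divr_ge0 // ltW.
have qS k : proj (q k) = f (k%:R / N) -> k.+1%:R <= N ->
    proj (q k.+1) = f (k.+1%:R / N) /\ hdist (q k) (q k.+1) < delta / 8.
  move=> qk kN; apply: lift_nearP; rewrite qk; apply: close.
  - by apply: k01; apply: le_trans kN; rewrite ler_nat.
  - exact: k01.
  - by rewrite -mulrBl -[in X in _ - X]natr1 opprD addrA subrr add0r mulN1r normrN gtr0_norm ?invr_gt0.
have qP k : k%:R <= N -> proj (q k) = f (k%:R / N).
  elim: k => [|k IH] kN; first by rewrite mul0r.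
  by apply: (qS k _ kN).1; apply: IH; apply: le_trans kN; rewrite ler_nat.
pose idx t := Num.truncn (t * N); pose c t := lift_near (f t) (q (idx t)).
have idxP t : 0 <= t <= 1 -> [/\ (idx t)%:R <= N, (idx t)%:R / N <= t & t < (idx t)%:R / N + N^-1].
  move=> /andP[t0 t1]; have tN : 0 <= t * N by rewrite mulr_ge0 // ltW.
  have /andP[h1 h2] := truncn_itv tN; rewrite -/(idx t) in h1 h2.
  split; [|by rewrite ler_pdivrMr|].
    by apply: le_trans h1 _; rewrite ler_piMl // ltW.
  by rewrite -[X in _ + X]mul1r -mulrDl natr1 ltr_pdivlMr.
have cP t : 0 <= t <= 1 -> proj (c t) = f t /\ hdist (q (idx t)) (c t) < delta / 8.
  move=> t01; have [h1 h2 h3] := idxP t t01; apply: lift_nearP; rewrite qP //.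
  apply: close => //; first exact: k01.
  move: h2 h3 Ni; rewrite ler_norml; move: (N^-1) (_ / N) => y x h2 h3 {}Ni.
  by apply/andP; split; lra.
exists c; last first.
  have [|h1 h2] := cP 0; first by rewrite lexx ler01.
  have i0 : idx 0 = 0%N by rewrite /idx mul0r truncn0.
  rewrite i0 /= in h2; apply/esym/proj_gap; first by rewrite h1.
  by apply: lt_trans h2 _; lra.
split=> [t /cP[]//|eps eps0]; have [eta2 eta20 Heta2] := uf _ eps0.
exists (Num.min eta2 N^-1); first by rewrite lt_min eta20 invr_gt0.
move=> s t s01 t01; wlog st : s t s01 t01 / s <= t => [W|].
  case: (leP s t) => [|/ltW] st; first exact: W.
  by rewrite distrC hdist_sym; exact: W.
rewrite lt_min => /andP[st1 st2].
have [cs hs] := cP s s01; have [ct ht] := cP t t01.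
have [s1 s2 s3] := idxP s s01; have [t1 t2 t3] := idxP t t01.
have qq : hdist (q (idx s)) (q (idx t)) < delta / 8.
  have st' : (idx s <= idx t)%N by apply: le_truncn; rewrite ler_pM2r.
  have ts' : (idx t <= (idx s).+1)%N.
    have : (idx t)%:R / N < ((idx s)%:R + 2) / N.
      apply: le_lt_trans t2 _; rewrite mulrDl; move: st2 s3.
      by rewrite distrC ger0_norm ?subr_ge0 //; exact: lin.
    by rewrite ltr_pM2r // -natrD ltr_nat addn2 ltnS.
  have [E|E] : idx t = idx s \/ idx t = (idx s).+1.
    move: ts'; rewrite leq_eqVlt ltnS => /predU1P[->|ts']; [by right|left].
    by apply/eqP; rewrite eqn_leq ts'.
    by rewrite E hdist_xx.
  by rewrite E; apply: (qS _ (qP _ s1) _).2; rewrite -E.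
have d2 : hdist (c s) (c t) < delta / 2.
  apply: le_lt_trans (hdist_triangle (q (idx s)) _ _) _.
  apply: le_lt_trans (lerD (lexx _) (hdist_triangle (q (idx t)) _ _)) _.
  by rewrite (hdist_sym (c s)); exact: lin2.
by rewrite -(sdist_local d2) cs ct; apply: Heta2.
Qed.

Lemma unit_interval_ind (P : R -> Prop) : P 0 ->
  (exists2 eta : R, 0 < eta & forall s t, 0 <= s <= 1 -> 0 <= t <= 1 ->
     `|s - t| < eta -> P s -> P t) ->
  forall t, 0 <= t <= 1 -> P t.
Proof.
move=> P0 [eta eta0 Hs].
(* The number of steps of length eta / 2 from 0 to t is the induction variable. *)
have e2 : 0 < eta / 2 by rewrite divr_gt0.
suff ind k t : 0 <= t <= 1 -> t <= k%:R * (eta / 2) -> P t.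
  move=> t t01; apply: (ind (Num.truncn (t / (eta / 2))).+1 t t01).
  by rewrite -ler_pdivrMr //; exact/ltW/truncnS_gt.
elim: k t => [|k IH] t /andP[t0 t1] tk.
  by have -> : t = 0 by apply/eqP; rewrite eq_le t0 andbT; lra.
have [te|te] := leP t (eta / 2).
  apply: (Hs 0) => //; rewrite ?lexx ?ler01 ?t0 //.
  by rewrite sub0r normrN ger0_norm //; lra.
apply: (Hs (t - eta / 2)); try (apply/andP; split); try lra.
  by rewrite ler0_norm; lra.
apply: IH; first by (apply/andP; split; lra).
by move: tk; rewrite -natr1; lra.
Qed.

(** While the lifts are within [delta / 4], a small step keeps them close enough for
the element of [H] that would bring them within [delta / 4] to be 1. *)
Lemma lift_close f f' c c' : unif_lift f c -> unif_lift f' c' ->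
  (forall t, 0 <= t <= 1 -> sdist (f t) (f' t) < delta / 4) ->
  hdist (c 0) (c' 0) < delta / 4 ->
  forall t, 0 <= t <= 1 -> hdist (c t) (c' t) < delta / 4.
Proof.
move=> [fc uc] [fc' uc'] ff' start; apply: unit_interval_ind => //.
have d4 : 0 < delta / 4 by rewrite divr_gt0.
have [e1 e10 H1'] := uc _ d4; have [e2 e20 H2'] := uc' _ d4.
exists (Num.min e1 e2); first by rewrite lt_min e10.
move=> s t s01 t01; rewrite lt_min => /andP[st1 st2] cs.
have h1 := H1' s t s01 t01 st1; have h2 := H2' s t s01 t01 st2.
have := ff' t t01; rewrite -fc // -fc' // => /sdist_lt[g Hg lt].
suff E : g = 1%g by rewrite E act1 in lt.
apply: (@act_gap g (c' t)) => //.
have := hdist_triangle (c t) (c' t) (act g (c' t)).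
have := hdist_triangle (c' s) (c t) (c' t); have := hdist_triangle (c s) (c t) (c' s).
rewrite (hdist_sym (c t) (c s)) (hdist_sym (c' t) (c t)); lra.
Qed.

Lemma lift_unique f c c' : unif_lift f c -> unif_lift f c' -> c 0 = c' 0 ->
  forall t, 0 <= t <= 1 -> c t = c' t.
Proof.
move=> fc fc' E t t01; apply: proj_gap; first by rewrite fc.1 // fc'.1.
have d4 : 0 < delta / 4 by rewrite divr_gt0.
have : hdist (c t) (c' t) < delta / 4.
  apply: (lift_close fc fc') => // [s _|]; first by rewrite sdist_xx.
  by rewrite E hdist_xx.
lra.
Qed.

(** By [hcosh_close]: [t] is such that [hcosh p q < 1 + t] makes both the horizontal
displacement and the dilation of [p] by [hcosh p q] small. *)
Lemma hdist_near p eps : 0 < eps -> exists2 eta : R, 0 < eta &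
  forall q, hdist p q < eta -> `|p.1 - q.1| < eps /\ `|p.2 - q.2| < eps.
Proof.
move=> eps0; set Z := 1 + p.1 ^+ 2 + p.2 ^+ 2; set M := 1 + `|p.1| + `|p.2|.
have Z0 : 0 < Z by rewrite /Z; have := sqr_ge0 p.1; have := sqr_ge0 p.2; lra.
have M0 : 0 < M by rewrite /M; have := normr_ge0 p.1; have := normr_ge0 p.2; lra.
pose t := Num.min 1 (Num.min (eps / (2 * M)) (eps ^+ 2 / (12 * Z))).
have t0 : 0 < t by rewrite !lt_min ltr01 !divr_gt0 ?mulr_gt0 ?exprn_gt0.
have t1 : t <= 1 by rewrite ge_min lexx.
have tM : t * M <= eps / 2.
  have : t <= eps / (2 * M) by rewrite !ge_min lexx orbT.
  by rewrite ler_pdivlMr ?mulr_gt0 // => ?; lra.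
have tZ : Z * (3 * t) <= (eps / 2) ^+ 2.
  have : t <= eps ^+ 2 / (12 * Z) by rewrite !ge_min lexx !orbT.
  by rewrite ler_pdivlMr ?mulr_gt0 // => ?; rewrite exprMn; lra.
have ct : 1 <= 1 + t by lra.
exists (arcosh (1 + t)).
  have c0 : cosh 0 = 1 :> R by rewrite /cosh oppr0 expR0; lra.
  rewrite -cosh_lt ?nnegrE ?arcosh_ge0 // cosh_arcosh // c0; lra.
move=> q pq; have : cosh (hdist p q) < cosh (arcosh (1 + t)).
  by rewrite cosh_lt ?nnegrE ?hdist_ge0 ?arcosh_ge0.
rewrite /hdist !cosh_arcosh ?hcosh_ge1 // {pq}.
have := hcosh_close p q; have := hcosh_ge1 p q; set k := hcosh p q; rewrite -/Z => k1 ck kt.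
have kZ : Z * (k ^+ 2 - 1) <= (eps / 2) ^+ 2.
  apply: le_trans tZ; rewrite ler_pM2l //.
  have -> : k ^+ 2 - 1 = (k + 1) * (k - 1) by ring.
  by apply: ler_pM; lra.
have bound (x y : R) : `|x| < M -> (y - k * x) ^+ 2 <= (eps / 2) ^+ 2 -> `|x - y| < eps.
  move=> xM h; have {}h : `|y - k * x| <= eps / 2.
    by rewrite -ler_sqr ?nnegrE ?real_normK ?num_real //; lra.
  have -> : x - y = - (k - 1) * x - (y - k * x) by ring.
  apply: le_lt_trans (ler_normB _ _) _; rewrite normrM normrN (@ger0_norm _ (k - 1)); last by lra.
  have : (k - 1) * `|x| < eps / 2.
    by apply: lt_le_trans tM; apply: ltr_pM => //; lra.
  lra.
have h1 := sqr_ge0 (q.1 - k * p.1); have h2 := sqr_ge0 (q.2 - k * p.2).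
by split; apply: bound; rewrite /M; have := normr_ge0 p.1; have := normr_ge0 p.2; lra.
Qed.

Definition clamp t : R := Num.max 0 (Num.min 1 t).

Lemma clamp01 t : 0 <= clamp t <= 1.
Proof. by rewrite /clamp le_max lexx /= ge_max ler01 ge_min lexx. Qed.

Lemma clamp_id t : 0 <= t <= 1 -> clamp t = t.
Proof. by move=> /andP[t0 t1]; rewrite /clamp min_r // max_r. Qed.

Lemma clamp_lip s t : `|clamp s - clamp t| <= `|s - t|.
Proof.
  rewrite /clamp; have [s1|s1] := leP 1 s; have [t1|t1] := leP 1 t;
    rewrite ?(max_r ler01); try (have [s0|s0] := leP 0 s); try (have [t0|t0] := leP 0 t);
    rewrite ?subrr ?normr0 // ler_norml; have := ler_norm (s - t);
    have := ler_norm (t - s); rewrite (distrC t s) => *; apply/andP; split; lra.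
Qed.

Lemma lift_continuous f c : unif_lift f c -> continuous (c \o clamp : R -> R * R).
Proof.
move=> [_ uc] t A [[A1 A2] /= [/nbhs_ballP[r1 r10 h1] /nbhs_ballP[r2 r20 h2]] sub].
have r0 : 0 < Num.min r1 r2 by rewrite lt_min r10.
have [eta eta0 He] := hdist_near (c (clamp t)) r0; have [z z0 Hz] := uc eta eta0.
apply/nbhs_ballP; exists z => //= s ts; apply: sub.
have /He[] : hdist (c (clamp t)) (c (clamp s)) < eta.
  by apply: Hz; rewrite ?clamp01 //; apply: le_lt_trans (clamp_lip _ _) ts.
rewrite !lt_min => /andP[b1 _] /andP[_ b2].
by split; [apply: h1|apply: h2].
Qed.

Let p0 : R * R := 0.
Let x0 : surface := proj p0.

Lemma I01P t : 0 <= t <= 1 <-> `[0, 1]%classic t.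
Proof. by rewrite /= in_itv. Qed.

Lemma path_unif f : {within `[0, 1], continuous f} -> unif_path f.
Proof.
move=> cf eps eps0.
have [eta eta0 He] := compact_unif_continuous (@segment_compact R 0 1) cf eps0.
by exists eta.
Qed.

Lemma curve_lift c : {within `[0, 1], continuous c} -> unif_lift (proj \o c) c.
Proof.
move=> cc; split=> // eps eps0; have [r r0 Hr] := ball_hdist eps0.
have [eta eta0 He] := compact_unif_continuous (@segment_compact R 0 1) cc r0.
by exists eta => // s t /I01P s01 /I01P t01 st; apply: Hr; exact: He.
Qed.

(** The deck transformation that maps the start of the lift of [f] to its end. *)
Definition deck f : G :=
  xget 1%g [set g | H g /\ exists2 c, unif_lift f c & c 0 = p0 /\ c 1 = act g p0].

Lemma zero01 : 0 <= (0 : R) <= 1. Proof. by rewrite lexx ler01. Qed.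
Lemma one01 : 0 <= (1 : R) <= 1. Proof. by rewrite lexx ler01. Qed.

Lemma deck_of_lift f c g : H g -> unif_lift f c -> c 0 = p0 -> c 1 = act g p0 ->
  deck f = g.
Proof.
move=> Hg fc c0 c1.
have [Hd [c' fc' [c'0 c'1]]] : [set g | H g /\ exists2 c, unif_lift f c & c 0 = p0 /\ c 1 = act g p0] (deck f).
  by apply: xgetPex; exists g; split=> //; exists c.
have := lift_unique fc fc' _ one01; rewrite c0 c'0 c1 c'1 => /(_ erefl) E.
have : (g^-1 * deck f = 1)%g.
  apply: (@act_gap _ p0); first by apply: HM => //; exact: HV.
  by rewrite actM -E actK hdist_xx.
by move=> /(congr1 (fun k => (g * k)%g)); rewrite mulgA mulgV mul1g mulg1.
Qed.

Lemma deck_lift f : unif_path f -> f 0 = x0 -> f 1 = x0 ->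
  H (deck f) /\ exists2 c, unif_lift f c & c 0 = p0 /\ c 1 = act (deck f) p0.
Proof.
move=> uf f0 f1; have [c fc c0] := lift_exists uf (esym f0).
have : proj p0 = proj (c 1) by rewrite fc.1 ?one01 // f1.
move=> /projP[g Hg E]; have -> := deck_of_lift Hg fc c0 (esym E).
by split=> //; exists c.
Qed.

Lemma loop_deck f : is_loop x0 f ->
  H (deck f) /\ exists2 c, unif_lift f c & c 0 = p0 /\ c 1 = act (deck f) p0.
Proof. by move=> [cf f0 f1]; apply: deck_lift => //; exact: path_unif. Qed.

Lemma deck_surj g : H g -> exists2 f, is_loop x0 f & deck f = g.
Proof.
move=> Hg; pose c (t : R) : R * R := t *: (act g p0 : (R^o * R^o)%type).
have cc : continuous c by exact: scalel_continuous.
have ccw : {within `[0, 1], continuous c} by exact: continuous_subspaceT.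
have c0 : c 0 = p0 by rewrite /c scale0r.
have c1 : c 1 = act g p0 by rewrite /c scale1r.
exists (proj \o c); last exact: deck_of_lift Hg (curve_lift ccw) c0 c1.
split=> /=; rewrite ?c0 ?c1 ?proj_act //.
apply: continuous_subspaceT => t; apply: continuous_comp; first exact: cc.
exact: proj_continuous.
Qed.

Lemma deck_concat f f' : is_loop x0 f -> is_loop x0 f' ->
  deck (loop_concat f f') = (deck f * deck f')%g.
Proof.
move=> lf lg; have [Hf [c [fc uc] [c0 c1]]] := loop_deck lf.
have [Hg [c' [gc uc'] [c'0 c'1]]] := loop_deck lg.
pose k t := if t <= 2^-1 then c (2 * t) else act (deck f) (c' (2 * t - 1)).
have k01 : k 0 = p0 by rewrite /k invr_ge0 ler0n mulr0.
have k1 : k 1 = act (deck f * deck f')%g p0.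
  rewrite /k ifF; last by apply/negbTE; rewrite -ltNge; lra.
  have -> : 2 * 1 - 1 = 1 :> R by lra.
  by rewrite c'1 actM.
apply: (@deck_of_lift _ k) => //; first exact: HM.
split=> [t /andP[t0 t1]|eps eps0].
  rewrite /k /loop_concat; case: ifP => t2.
    by apply: fc; apply/andP; split; lra.
  move: t2 => /negbT; rewrite -ltNge => t2.
  by rewrite proj_act //; apply: gc; apply/andP; split; lra.
have e2 : 0 < eps / 2 by rewrite divr_gt0.
have [e1 e10 He1] := uc _ e2; have [e3 e30 He3] := uc' _ e2.
exists (Num.min e1 e3 / 2); first by rewrite divr_gt0 // lt_min e10.
move=> s t s01 t01; wlog st : s t s01 t01 / s <= t => [W|].
  case: (leP s t) => [|/ltW] st; first exact: W.
  by rewrite distrC hdist_sym; exact: W.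
rewrite distrC ger0_norm ?subr_ge0 // ltr_pdivlMr // lt_min => /andP[d1 d2].
have [s0 s1] := andP s01; have [t0 t1] := andP t01.
rewrite /k; have [s2|s2] := leP s 2^-1; have [t2|t2] := leP t 2^-1.
- apply: lt_le_trans (He1 _ _ _ _ _) _; try (apply/andP; split); try lra.
  by rewrite distrC ger0_norm; lra.
- apply: le_lt_trans (hdist_triangle (c 1) _ _) _; rewrite [eps]splitr; apply: ltrD.
    apply: He1; try (apply/andP; split); try lra.
    by rewrite distrC ger0_norm; lra.
  rewrite c1 act_hdist -c'0; apply: He3; try (apply/andP; split); try lra.
  by rewrite distrC ger0_norm; lra.
- lra.
- rewrite act_hdist; apply: lt_le_trans (He3 _ _ _ _ _) _; try (apply/andP; split); try lra.
  by rewrite distrC ger0_norm; lra.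
Qed.

(** By [lift_close] the end of the lift of the intermediate loops does not change
along the homotopy. *)
Lemma deck_homotopic f f' : is_loop x0 f -> is_loop x0 f' ->
  loop_homotopic x0 f f' -> deck f = deck f'.
Proof.
move=> lf lg [h [ch h01 hend]].
pose F s t := h (t, s).
set sq := [set p : R * R | _] in ch.
have csq : compact sq.
  have -> : sq = `[0, 1]%classic `*` `[0, 1]%classic by [].
  by apply: compact_setX; exact: segment_compact.
have uh eps (eps0 : 0 < eps) := compact_unif_continuous csq ch eps0.
have uF s : 0 <= s <= 1 -> unif_path (F s).
  move=> s01 eps eps0; have [eta eta0 He] := uh eps eps0.
  exists eta => // t t' t01 t'01 tt'.
  have : ball (h (t, s)) eps (h (t', s)).
    apply: He; rewrite /sq /= ?in_itv //=.
    by split=> //=; exact: ballxx.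
  by rewrite ballEmdist.
have [Hf [cf fc [cf0 cf1]]] := loop_deck lf; have [Hg [cg gc [cg0 cg1]]] := loop_deck lg.
pose P s := forall c, unif_lift (F s) c -> c 0 = p0 -> c 1 = act (deck f) p0.
suff P1 : P 1.
  apply/esym/(deck_of_lift Hf gc cg0); apply: P1 => //.
  split; last exact: gc.2.
  by move=> t t01; have [_ E1] := h01 t ltac:(by rewrite in_itv); rewrite gc.1 // /F E1.
apply: unit_interval_ind one01.
  move=> c Fc c0; rewrite -cf1; apply: (lift_unique Fc) one01; last by rewrite c0.
  split; last exact: fc.2.
  by move=> t t01; have [E1 _] := h01 t ltac:(by rewrite in_itv); rewrite fc.1 // /F E1.
have d4 : 0 < delta / 4 by rewrite divr_gt0.
have [eta eta0 He] := uh _ d4; exists eta => // s t s01 t01 st Ps c Fc c0.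
have Fend (z : R) : 0 <= z <= 1 -> F z 0 = x0 /\ F z 1 = x0.
  by move=> z01; apply: hend; rewrite in_itv.
have [cs Fcs cs0] := lift_exists (uF s s01) (esym (Fend s s01).1).
rewrite -(Ps cs Fcs cs0); apply/esym/proj_gap.
  by rewrite Fcs.1 ?one01 // Fc.1 ?one01 // (Fend s s01).2 (Fend t t01).2.
have : hdist (cs 1) (c 1) < delta / 4.
  apply: (lift_close Fcs Fc) one01; last by rewrite cs0 c0 hdist_xx.
  move=> z z01; have : ball (h (z, s)) (delta / 4) (h (z, t)).
    apply: He; rewrite /sq /= ?in_itv //=.
    by split=> //=; exact: ballxx.
  by rewrite ballEmdist.
lra.
Qed.

(** The two lifts have the same ends, and the straight homotopy between them is
projected to the surface. *)
Lemma homotopic_deck f f' : is_loop x0 f -> is_loop x0 f' ->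
  deck f = deck f' -> loop_homotopic x0 f f'.
Proof.
move=> lf lg E; have [Hf [cf fc [cf0 cf1]]] := loop_deck lf.
have [Hg [cg gc [cg0 cg1]]] := loop_deck lg.
pose E2 := (R^o * R^o)%type.
pose k (u : R * R) : E2 := (1 - u.2) *: (cf (clamp u.1) : E2) + u.2 *: (cg (clamp u.1) : E2).
exists (fun u => proj (k u)); split.
- apply: continuous_subspaceT => u; apply: continuous_comp; last exact: proj_continuous.
  have c1 : {for u, continuous (fun u : R * R => cf (clamp u.1) : E2)}.
    by apply: (@continuous_comp _ _ _ fst (cf \o clamp) u); [exact: cvg_fst|exact: (lift_continuous fc)].
  have c2 : {for u, continuous (fun u : R * R => cg (clamp u.1) : E2)}.
    by apply: (@continuous_comp _ _ _ fst (cg \o clamp) u); [exact: cvg_fst|exact: (lift_continuous gc)].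
  have s1 : {for u, continuous (fun u : R * R => u.2)} by exact: cvg_snd.
  apply: continuousD; apply: continuousZ => //.
  by apply: continuousB => //; exact: cvg_cst.
- move=> t; rewrite in_itv => t01; rewrite /k /= clamp_id //.
  by rewrite subr0 scale1r scale0r addr0 subrr scale0r scale1r add0r fc.1 // gc.1.
- move=> s _; rewrite /k /= !clamp_id ?zero01 ?one01 // cf0 cg0 cf1 cg1 -E.
  rewrite -!scalerDl subrK !scale1r; split=> //; exact: proj_act.
Qed.

Lemma surface_pi1 : isomorphic_to_pi1 R x0 H.
Proof.
exists deck; split.
- by move=> f /loop_deck[].
- exact: deck_surj.
- exact: deck_concat.
- by move=> f f' lf lf'; split; [exact: homotopic_deck|exact: deck_homotopic].
Qed.

(** A small ball is lifted around a point over its centre, where [sdist_local]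
compares the distances. *)
Lemma surface_locally_hyperbolic : locally_hyperbolic surface.
Proof.
move=> x; have [p ->] := surfaceP x; have d4 : 0 < delta / 4 by rewrite divr_gt0.
exists (delta / 4); split=> //.
pose near y := xget p [set q | proj q = y /\ hdist p q < delta / 4].
have nearP y : ball (proj p) (delta / 4) y -> proj (near y) = y /\ hdist p (near y) < delta / 4.
  rewrite ballEmdist /= => py.
  apply: (@xgetPex _ p [set q | proj q = y /\ hdist p q < delta / 4]).
  have [q Eq] := surfaceP y; move: py; rewrite Eq => /sdist_lt[g Hg lt].
  by exists (act g q); split=> //; exact: proj_act.
have near_uniq q : hdist p q < delta / 4 -> near (proj q) = q.
  move=> pq; have [|E lt] := nearP (proj q).
    by rewrite ballEmdist /=; apply: le_lt_trans (sdist_le1 _ _) pq.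
  apply: proj_gap => //; have := hdist_triangle p (near (proj q)) q.
  rewrite (hdist_sym _ p); lra.
exists (fun y => uhp_chart (near y)); split=> [y _|y z by_ bz|q uq pq].
- exact: uhp_chart_in.
- rewrite uhp_chart_dist; have [Ey py] := nearP y by_; have [Ez pz] := nearP z bz.
  have -> : mdist y z = sdist (proj (near y)) (proj (near z)) by rewrite Ey Ez.
  apply/esym/sdist_local.
  have := hdist_triangle p (near y) (near z); rewrite (hdist_sym _ p); lra.
have [r Er] := uhp_chart_surj uq; move: pq; rewrite -Er uhp_chart_dist.
rewrite near_uniq ?hdist_xx // => pr; exists (proj r); last by rewrite near_uniq.
by rewrite ballEmdist /=; apply: le_lt_trans (sdist_le1 _ _) pr.
Qed.

Theorem quotient_surface : exists (M : metricType R) (y : M),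
  closed_hyperbolic_surface M /\ isomorphic_to_pi1 R y H.
Proof.
exists surface, x0; split; last exact: surface_pi1.
split; [exact: surface_compact|exact: surface_connected|exact: surface_locally_hyperbolic].
Qed.

End Quotient.

(** * The reflection group of a right-angled polygon *)

Section PolygonAction.
Variables (V : finType) (e : rel V) (R : realType) (Q : pred V).
Hypothesis e_sym : symmetric e.
Local Notation W := (racg e).
Local Notation cls := (@racg_class V e).
Local Notation gen := (@racg_gen V e).
Local Notation red := (@red V e).
Local Notation E3 := (R^o * R^o * R^o)%type.
Variables (al : V -> E3) (gap inrad Z : R).
Hypotheses (al_out : forall s, ~~ Q s -> al s = 0)
  (al_unit : forall s, Q s -> mink (al s) (al s) = 1)
  (al_edge : forall s t, e s t -> mink (al s) (al t) = 0)
  (gap1 : 1 < gap)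
  (al_gap : forall s t, Q s -> Q t -> s != t -> ~~ e s t -> mink (al s) (al t) <= - gap)
  (inrad0 : 0 < inrad) (al_center : forall s, Q s -> mink (hlift 0) (al s) = inrad)
  (chamber_bounded : forall p, (forall s, Q s -> 0 <= mink (hlift p) (al s)) -> hcosh 0 p <= Z).
Implicit Types (s t : V) (w u : seq V) (g h : W) (p q x y : R * R).

Let al1 s : al s = 0 \/ mink (al s) (al s) = 1.
Proof. by case: (boolP (Q s)) => [/al_unit|/al_out]; [right|left]. Qed.

Let al_far s t : Q s -> Q t -> s != t -> ~~ e s t -> mink (al s) (al t) <= -1.
Proof. move=> Qs Qt st est; have := al_gap Qs Qt st est; have := gap1; lra. Qed.

Local Notation lin := (rho (@mink R) al).
Local Notation refl := (refl (@mink R) al).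
Let linM := rhoM (@mink_sym R) (@mink_lin R) al1 al_edge.
Let lin_gen := rho_gen (@mink_sym R) (@mink_lin R) al1 al_edge.
Let lin1 := rho1 (@mink_sym R) (@mink_lin R) al1 al_edge.
Let linD := rhoD (@mink_sym R) (@mink_lin R) al1 al_edge.
Let linZ := rhoZ (@mink_sym R) (@mink_lin R) al1 al_edge.
Let linN := rhoN (@mink_sym R) (@mink_lin R) al1 al_edge.
Let lin_form := rho_form (@mink_sym R) (@mink_lin R) al1 al_edge.
Let lin_formV := rho_formV (@mink_sym R) (@mink_lin R) al1 al_edge.
Let lin_cls := rho_cls (@mink_sym R) (@mink_lin R) al1 al_edge.

Let minkBZ (u v w : E3) k : mink u (v - k *: w) = mink u v - k * mink u w.
Proof. by rewrite /mink /= /GRing.scale /=; ring. Qed.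

Let linBZ g k (u v : E3) : lin g (u - k *: v) = lin g u - k *: lin g v.
Proof. by rewrite linD linN linZ. Qed.

Lemma lin_refl_root s : Q s -> refl s (al s) = - al s.
Proof.
move=> Qs; rewrite /refl al_unit // -{1}[al s]scale1r -scalerBl -[RHS]scaleN1r.
by congr (_ *: _); ring.
Qed.

(** If [v] were on the lower sheet, its product with [u] would be at least 1. *)
Lemma same_sheet (u v : E3) : on_sheet u -> mink v v = -1 -> mink u v < 0 -> on_sheet v.
Proof.
move=> Su Hv uv; split=> //; case: (ltgtP 0 (v.2 : R)) => // v0.
  have Sv : on_sheet (- v).
    split; last by rewrite /= oppr_gt0.
    by rewrite -Hv /mink /=; ring.
  have := hcosh_ge1 u.1 (- v).1; rewrite /hcosh !sheet_lift //.
  have -> : mink u (- v) = - mink u v by rewrite /mink /=; ring.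
  lra.
have := sqr_ge0 (v.1.1 : R); have := sqr_ge0 (v.1.2 : R).
by move: Hv; rewrite /mink -v0 !expr2; lra.
Qed.

Lemma refl_sheet s (u : E3) : on_sheet u -> on_sheet (refl s u).
Proof.
move=> Su; apply: (same_sheet Su).
  by rewrite (refl_form (@mink_sym R) (@mink_lin R) al1); case: Su.
rewrite mink_sym /refl (formD (@mink_lin R)) (formN (@mink_lin R)) (formZ (@mink_lin R)).
by rewrite (mink_sym (al s)) Su.1; have := sqr_ge0 (mink u (al s)); rewrite expr2; lra.
Qed.

Lemma lin_sheet g (u : E3) : on_sheet u -> on_sheet (lin g u).
Proof.
have [w <- _] := red_word g; rewrite lin_cls.
by elim: w => [|s w IH] //= /IH; exact: refl_sheet.
Qed.

Definition gact g p : R * R := (lin g (hlift p)).1.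

Lemma hlift_gact g p : hlift (gact g p) = lin g (hlift p).
Proof. exact/sheet_lift/lin_sheet/hlift_sheet. Qed.

Lemma gact1 p : gact 1%g p = p. Proof. by rewrite /gact lin1. Qed.

Lemma gactM g h p : gact (g * h)%g p = gact g (gact h p).
Proof. by rewrite /gact hlift_gact linM. Qed.

Lemma gact_hcosh g p q : hcosh (gact g p) (gact g q) = hcosh p q.
Proof. by rewrite /hcosh !hlift_gact lin_form. Qed.

Lemma gact_hcoshV g p q : hcosh (gact g p) q = hcosh p (gact g^-1%g q).
Proof. by rewrite -(gact_hcosh g p) -gactM gmulrV gact1. Qed.

Definition chamber p := forall s, Q s -> 0 <= mink (hlift p) (al s).

(** By [roots_positive] the product of the centre with the next root is at least
[inrad], so that each letter moves the image of the centre further away. *)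
Lemma orbit_center_far (w : seq V) : all Q w -> red w ->
  1 + 2 * inrad ^+ 2 * (size w)%:R <= hcosh 0 (gact (cls w) 0).
Proof.
elim/last_ind: w => [_ _|w s IH]; first by rewrite cls_nil gact1 hcosh_xx mulr0 addr0.
rewrite all_rcons => /andP[Qs Qw] rw; have := IH Qw (red_rcons rw).
have lin2 k (a b : E3) : mink (hlift 0) (k *: a + b) = k * mink (hlift 0) a + mink (hlift 0) b.
  by rewrite mink_sym mink_lin !(mink_sym _ (hlift 0)).
have phi_al t (Qt : Q t) : inrad <= mink (hlift 0) (al t) by rewrite al_center.
have [pos _] := roots_positive e_sym (@mink_sym R) (@mink_lin R) al1 al_edge
  lin2 (ltW inrad0) phi_al al_unit al_far Qw (red_rcons rw).
have := pos s Qs rw; rewrite -lin_cls /hcosh !hlift_gact cls_rcons linM lin_gen /refl al_center //.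
rewrite linBZ minkBZ size_rcons -natr1 => h1 h2.
have := ler_wpM2l (ltW inrad0) h1; rewrite !expr2; lra.
Qed.

Lemma gact_gen_chamber x s : Q s -> hcosh x 0 <= hcosh x (gact (gen s) 0) ->
  0 <= mink (hlift x) (al s).
Proof.
move=> Qs; rewrite /hcosh hlift_gact lin_gen /refl al_center // minkBZ => H.
have : 0 <= inrad * mink (hlift x) (al s) by lra.
by rewrite pmulr_rge0.
Qed.

(** Among the translates of the centre, the one nearest to [x] exists, because only
finitely many are near by [orbit_center_far]. None of the reflections of its
chamber brings the centre nearer to [x], which means that [x] lies in this chamber. *)
Lemma chamber_covers x : exists2 g, special Q g & chamber (gact g x).
Proof.
set c := hcosh x 0; have c1 : 1 <= c := hcosh_ge1 x 0.
(* Words of length above n move the centre farther away than x is from it. *)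
pose n := Num.truncn (c ^+ 2 / inrad ^+ 2).
have i2 : 0 < inrad ^+ 2 by rewrite exprn_gt0.
have nP : c ^+ 2 < inrad ^+ 2 * n.+1%:R by rewrite mulrC -ltr_pdivrMr // truncnS_gt.
pose F (b : n.-bseq V) := hcosh x (gact (cls b) 0).
have [b Qb bmin] := @arg_minP _ R _ (nil_bseq n V) (fun b : n.-bseq V => all Q b) F isT.
have Fmin g : special Q g -> F b <= hcosh x (gact g 0).
  move=> Sg; have [u Eu ru] := red_word g.
  have Qu : all Q u by apply: special_red ru _; rewrite Eu.
  rewrite -Eu; case: (leqP (size u) n) => un; first exact: (bmin (Bseq un)).
  apply: le_trans (bmin (nil_bseq n V) isT) _; rewrite /F /= gact1 -/c.
  have := orbit_center_far Qu ru; have := hcosh_triangle2 0 x (gact (cls u) 0).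
  rewrite (hcosh_sym 0 x) -/c => h1 h2.
  have : inrad ^+ 2 * n.+1%:R <= inrad ^+ 2 * (size u)%:R by rewrite ler_pM2l // ler_nat.
  move=> h3; have : c * c < c * hcosh x (gact (cls u) 0) by move: nP; rewrite expr2; lra.
  by rewrite ltr_pM2l ?(lt_le_trans ltr01) // => /ltW.
have Sb : special Q (cls b) by exists b.
exists (cls b)^-1%g; first exact: specialV.
move=> s Qs; apply: gact_gen_chamber => //; rewrite !gact_hcoshV invgK -gactM.
by apply: Fmin; apply: specialM => //; exists [:: s]; rewrite //= Qs.
Qed.

Lemma coset_even g : special Q g ->
  even_special Q (g * (cls (coset_word g))^-1)%g.
Proof.
move=> Sg; split=> [|v].
  by apply: specialM => //; apply: specialV; exists (coset_word g) => //; exact: coset_word_special.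
by rewrite parityM parityV parity_coset_word addbb.
Qed.

Lemma gact_word_bound u p : all Q u ->
  hcosh 0 (gact (cls u) p) <= (2 * (1 + 2 * inrad ^+ 2)) ^+ size u * hcosh 0 p.
Proof.
elim: u => [_|s u IH] /=; first by rewrite cls_nil gact1 expr0 mul1r.
move=> /andP[Qs /IH {}IH]; rewrite cls_cons gactM hcosh_sym gact_hcoshV gen_inv hcosh_sym.
apply: le_trans (hcosh_triangle2 _ 0 _) _.
have -> : hcosh (gact (gen s) 0) 0 = 1 + 2 * inrad ^+ 2.
  rewrite hcosh_sym /hcosh hlift_gact lin_gen /refl minkBZ al_center // (hlift_sheet 0).1.
  by rewrite expr2; ring.
have k0 : 0 < 2 * (1 + 2 * inrad ^+ 2) by have := exprn_gt0 2 inrad0; lra.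
by rewrite (exprS _ (size u)) -[leRHS]mulrA (ler_pM2l k0).
Qed.

Lemma hcosh_coord p : `|p.1| <= hcosh 0 p /\ `|p.2| <= hcosh 0 p.
Proof.
have -> : hcosh 0 p = Num.sqrt (1 + p.1 ^+ 2 + p.2 ^+ 2).
  rewrite /hcosh /mink /= !mul0r expr0n /= !addr0 sqrtr1; ring.
have := sqr_ge0 p.1; have := sqr_ge0 p.2 => h2 h1.
by split; rewrite -sqrtr_sqr ler_sqrt; lra.
Qed.

(** A point is moved into the chamber by the special subgroup, and the moving element
is even up to a coset word, which has bounded length. *)
Lemma even_special_cocompact : exists rad, forall p, exists2 g, even_special Q g &
  `|(gact g p).1| <= rad /\ `|(gact g p).2| <= rad.
Proof.
pose k := 2 * (1 + 2 * inrad ^+ 2).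
have k1 : 1 <= k by rewrite /k; have := exprn_gt0 2 inrad0; lra.
exists (k ^+ #|V| * Z) => p; have [g Sg Cg] := chamber_covers p.
pose c := coset_word g^-1%g.
have Hk := coset_even (specialV Sg); rewrite -/c in Hk.
have [_ _ HV] := @even_special_subgroup V e Q.
exists (g^-1 * (cls c)^-1)^-1%g; first exact: HV.
have Qc : all Q c by apply: coset_word_special; exact: specialV.
have : hcosh 0 (gact (g^-1 * (cls c)^-1)^-1%g p) <= k ^+ #|V| * Z.
  rewrite ginvM !invgK gactM; apply: le_trans (gact_word_bound _ Qc) _.
  apply: ler_pM; rewrite ?exprn_ge0 ?(le_trans ler01 k1) ?(le_trans ler01 (hcosh_ge1 _ _)) //.
    by rewrite ler_weXn2l // size_filter cardE count_size.
  exact: chamber_bounded.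
by move=> h; have [h1 h2] := hcosh_coord (gact (g^-1 * (cls c)^-1)^-1%g p);
   split; apply: le_trans h.
Qed.

Lemma left_factor (J : pred V) h : exists u h', [/\ h = (cls u * h')%g, all J u,
  len h = (size u + len h')%N & forall s, J s -> ~~ ldesc s h'].
Proof.
have [k] := ubnP (len h); elim: k h => // k IH h lt.
case: (pselect (exists2 s, J s & ldesc s h)) => [[s Js sh]|N].
  have ls := ldescT sh; have [|u [h' [E Ju L D]]] := IH (gen s * h)%g.
    by move: lt; rewrite ls => ?; len_lia.
  exists (s :: u), h'; split=> //=; first by rewrite cls_cons -gmulA -E genK.
    by rewrite Js.
  by rewrite ls L.
exists [::], h; split=> //; first by rewrite cls_nil gmul1.
by move=> s Js; apply/negP => sh; apply: N; exists s.
Qed.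

Let eps := Num.sqrt ((gap - 1) / 2).
Let eps2 : eps ^+ 2 = (gap - 1) / 2.
Proof. by rewrite sqr_sqrtr // divr_ge0 // subr_ge0 ltW. Qed.
Let eps0 : 0 < eps.
Proof. by rewrite sqrtr_gt0 divr_gt0 // subr_gt0. Qed.

Let phi_lin y k (a b : E3) : mink (hlift y) (k *: a + b) = k * mink (hlift y) a + mink (hlift y) b.
Proof. by rewrite mink_sym mink_lin !(mink_sym _ (hlift y)). Qed.

Let chamber_root y w s : chamber y -> all Q w -> Q s -> red (rcons w s) ->
  0 <= mink (hlift y) (lin (cls w) (al s)).
Proof.
move=> Cy Qw Qs rw; rewrite lin_cls.
have [pos _] := roots_positive e_sym (@mink_sym R) (@mink_lin R) al1 al_edge
  (phi_lin y) (lexx 0) Cy al_unit al_far Qw (red_rcons rw).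
exact: pos.
Qed.

(** A point cannot be near to two walls that do not cross, because these are at a
positive distance from each other: this follows from the Gram determinant of
[hlift y] and the two normals, and it is where [1 < gap] is essential. *)
Lemma near_walls_adjacent y s t : chamber y -> Q s -> Q t -> s != t ->
  mink (hlift y) (al s) < eps -> mink (hlift y) (al t) < eps -> e s t.
Proof.
move=> Cy Qs Qt st ys yt; apply: contrapT => /negP est.
have g1 := al_gap Qs Qt st est; have := gram (hlift y) (al s) (al t).
rewrite (hlift_sheet y).1 !al_unit //.
have := Cy s Qs; have := Cy t Qt; move: ys yt g1.
set a := mink _ (al s); set b := mink (hlift y) (al t); set g := mink (al s) (al t).
move=> ae be gg b0 a0; rewrite !expr2 => H.
have aa : a * a <= eps ^+ 2 by rewrite expr2; apply: ler_pM => //; exact: ltW.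
have bb : b * b <= eps ^+ 2 by rewrite expr2; apply: ler_pM => //; exact: ltW.
have ab : a * b < eps ^+ 2 by rewrite expr2; apply: ltr_pM.
have gab : - g * (a * b) < - g * eps ^+ 2 by rewrite ltr_pM2l //; have := gap1; lra.
have : (- g - 1) * (- g + 1) < 2 * eps ^+ 2 * (- g + 1).
  rewrite mulrDr mulr1; lra.
rewrite ltr_pM2r; last by have := gap1; lra.
by rewrite eps2; lra.
Qed.

(** Write [h = u h'] with [u] in the group generated by the reflections in the walls
near to [y], and [h'] without descents among these. Since [h] is even and [u] is a
product of distinct commuting letters, [h'] is not 1. The wall of a descent [j] of
[h'] separates [u^-1 y] from [h' y], and its distance from the first point has
hyperbolic sine at least [eps]. *)
Lemma displacement_chamber y h : chamber y -> even_special Q h -> h <> 1%g ->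
  1 + eps ^+ 2 <= hcosh y (gact h y) ^+ 2.
Proof.
move=> Cy [Sh Ph] h1; pose J := [pred s | Q s && (mink (hlift y) (al s) < eps)].
have [u [h' [E Ju L D]]] := left_factor J h.
have Qu : all Q u by apply/allP => s /(allP Ju) /andP[].
have ru : red u.
  by rewrite /red eqn_leq len_cls /=; have := len_mul (cls u) h'; rewrite -E L leq_add2r.
have uu : uniq u.
  apply: (red_uniq ru) => s t /(allP Ju) /andP[Qs ys] /(allP Ju) /andP[Qt yt] st.
  exact: (near_walls_adjacent Cy).
have [w' Ew' rw'] := red_word h'; case: w' => [|j w] in Ew' rw'.
  case: u => [|s u] in E uu {ru Qu L Ju}; first by case: h1; rewrite E -Ew' cls_nil gmul1.
  have := Ph s; rewrite E -Ew' cls_nil gmulr1 parity_cls /= eqxx.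
  by case/andP: uu => /count_memPn -> _.
have Sh' : special Q h'.
  have -> : h' = ((cls u)^-1 * h)%g by rewrite E gmulK.
  by apply: specialM => //; apply: specialV; exists u.
have /andP[Qj Qw] : all Q (j :: w) by apply: special_red rw' _; rewrite Ew'.
have nJj : ~~ J j by apply/negP => /D; rewrite -Ew' red_ldesc.
have yj : eps <= mink (hlift y) (al j).
  by move: nJj; rewrite /= Qj /= -leNgt.
pose x := gact (cls u)^-1%g y; pose x' := gact h' y.
have -> : hcosh y (gact h y) = hcosh x x'.
  by rewrite /x gact_hcoshV invgK /x' -gactM -E.
have xa : eps <= mink (hlift x) (al j).
  rewrite /x hlift_gact lin_formV invgK.
  have : all J u by []. have : red u by []. have : all Q u by [].
  elim/last_ind: (u) => [|v i IH]; first by rewrite lin1.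
  rewrite !all_rcons => /andP[Qi Qv] rv /andP[Ji Jv]; have {}IH := IH Qv (red_rcons rv) Jv.
  have ij : j != i by apply: contraNneq nJj => ->.
  have B0' : mink (al j) (al i) <= 0.
    case: (boolP (e j i)) => [/al_edge -> //|eji].
    by apply: le_trans (al_far Qj Qi ij eji) _; lra.
  rewrite cls_rcons linM lin_gen /refl linBZ minkBZ.
  have := chamber_root Cy Qv Qi rv => pos.
  have := mulr_ge0 (_ : 0 <= - (2 * mink (al j) (al i))) pos.
  by rewrite oppr_ge0 => /(_ ltac:(lra)); lra.
have xb : mink (hlift x') (al j) <= 0.
  rewrite /x' hlift_gact lin_formV -Ew' cls_cons ginvM gen_inv linM lin_gen lin_refl_root //.
  rewrite linN -scaleN1r -[_ *: _]addr0 phi_lin -cls_rev.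
  have -> : mink (hlift y) 0 = 0 by rewrite mink_sym (form0 (@mink_lin R)).
  have : 0 <= mink (hlift y) (lin (cls (rev w)) (al j)).
    by apply: chamber_root; rewrite ?all_rev // -rev_cons red_rev.
  lra.
have := gram (hlift x) (hlift x') (al j).
rewrite (hlift_sheet x).1 (hlift_sheet x').1 al_unit //.
have := hcosh_ge1 x x'; rewrite /hcosh; move: xa xb.
set a := mink _ (al j); set b := mink (hlift x') (al j); set c := mink _ _.
move=> ea b0 c1 H.
have e2a : eps ^+ 2 <= a ^+ 2 by rewrite ler_sqr ?nnegrE //; have := eps0; lra.
have : 0 <= c * (a * b).
  by rewrite mulr_le0 //; [lra|rewrite mulr_ge0_le0 //; have := eps0; lra].
have := sqr_ge0 b; move: H; rewrite !expr2; move: e2a; rewrite !expr2; lra.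
Qed.

(** The even elements are normal in the special subgroup, so that the point can be
moved into the chamber. *)
Lemma even_special_displacement : exists2 delta, 0 < delta &
  forall g p, even_special Q g -> g <> 1%g -> delta <= hdist p (gact g p).
Proof.
pose c := Num.sqrt (1 + eps ^+ 2); have e20 := exprn_gt0 2 eps0.
have c2 : c ^+ 2 = 1 + eps ^+ 2 by rewrite sqr_sqrtr //; lra.
have c1 : 1 < c by rewrite -(@ltr_pXn2r _ 2) ?nnegrE ?sqrtr_ge0 // c2 expr1n; lra.
have c0 : cosh 0 = 1 :> R by rewrite /cosh oppr0 expR0; lra.
exists (arcosh c).
  by rewrite -cosh_lt ?nnegrE ?arcosh_ge0 ?(ltW c1) // cosh_arcosh ?(ltW c1) // c0.
move=> h p Hh h1; have [g Sg Cg] := chamber_covers p.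
have Hh' : even_special Q (g * h * g^-1)%g.
  have [Sh Ph] := Hh; split; first by apply: specialM; [exact: specialM|exact: specialV].
  by move=> v; rewrite !parityM parityV addbAC addbb Ph.
have h1' : (g * h * g^-1)%g <> 1%g.
  move=> E; apply: h1; have : (g^-1 * (g * h * g^-1) * g = g^-1 * 1 * g)%g by rewrite E.
  by rewrite -!gmulA gmulK gmulV gmulr1 gmul1 gmulV.
have := displacement_chamber Cg Hh' h1'.
rewrite -gactM -!gmulA gmulV gmulr1 gactM gact_hcosh -c2 => le.
rewrite leNgt arcosh_lt ?hcosh_ge1 ?arcosh_ge0 ?(ltW c1) // cosh_arcosh ?(ltW c1) // -leNgt.
by rewrite -(@ler_pXn2r _ 2) ?nnegrE ?sqrtr_ge0 // (le_trans ler01) ?hcosh_ge1.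
Qed.

End PolygonAction.

(** * The regular right-angled polygon *)

Section RegularPolygon.
Variables (R : realType) (m : nat).
Hypothesis m5 : (5 <= m)%N.
Local Notation E3 := (R^o * R^o * R^o)%type.

Definition angle : R := pi *+ 2 / m%:R.
Definition cos_angle : R := cos angle.
Definition inradius : R := Num.sqrt (cos_angle / (1 - cos_angle)).
Definition normal_length : R := Num.sqrt (1 - cos_angle)^-1.
(** The unit normals of the sides of a regular polygon centred at the origin. Their
length and height are determined by the orthogonality of consecutive sides. *)
Definition wall_normal (k : nat) : E3 :=
  (normal_length * cos (k%:R * angle), normal_length * sin (k%:R * angle), - inradius).

Let m0 : 0 < m%:R :> R. Proof. by rewrite ltr0n; lia. Qed.

Let angle0 : 0 < angle.
Proof. by rewrite /angle divr_gt0 // pmulrn_lgt0 // pi_gt0. Qed.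

Let m_angle : m%:R * angle = pi *+ 2.
Proof. by rewrite mulrC divfK // gt_eqF. Qed.

Let angle_pihalf : angle < pi / 2.
Proof.
have m5R : 5 <= m%:R :> R by rewrite ler_nat.
rewrite -(ltr_pM2l m0) m_angle -mulr_natr.
have := ler_wpM2r (ltW (pi_gt0 R)) m5R; have := pi_gt0 R; lra.
Qed.

Let cos_angle_gt0 : 0 < cos_angle.
Proof. by apply: cos_gt0_pihalf; rewrite angle_pihalf andbT; have := pi_gt0 R; have := angle0; lra. Qed.

Let cos_angle_lt1 : cos_angle < 1.
Proof.
rewrite /cos_angle -(@cos0 R) ltr_cos ?in_itv /= ?lexx ?pi_ge0 ?(ltW angle0) //=.
by have := pi_gt0 R; have := angle_pihalf; lra.
Qed.

Lemma inradius_gt0 : 0 < inradius.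
Proof. by rewrite sqrtr_gt0 divr_gt0 // subr_gt0. Qed.

Lemma inradius2 : inradius ^+ 2 = cos_angle / (1 - cos_angle).
Proof. by rewrite sqr_sqrtr // divr_ge0 ?subr_ge0 // ltW. Qed.

Lemma normal_length2 : normal_length ^+ 2 = (1 - cos_angle)^-1.
Proof. by rewrite sqr_sqrtr // invr_ge0 subr_ge0 ltW. Qed.

Lemma mink_wall_normal i j :
  mink (wall_normal i) (wall_normal j) = (cos (i%:R * angle - j%:R * angle) - cos_angle) / (1 - cos_angle).
Proof.
rewrite /mink /= mulrACA [X in _ + X - _]mulrACA -mulrDr -cosB -!expr2 sqrrN.
by rewrite normal_length2 inradius2 mulrBl mulrC.
Qed.

Lemma wall_normal_unit i : mink (wall_normal i) (wall_normal i) = 1.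
Proof. by rewrite mink_wall_normal subrr cos0 divff // subr_eq0 gt_eqF. Qed.

Lemma wall_normal_center i : mink (hlift 0) (wall_normal i) = inradius.
Proof. by rewrite /mink /= !mul0r !expr0n /= !addr0 sqrtr1 mul1r opprK add0r. Qed.

Let trig_mod k : cos ((k %% m)%:R * angle) = cos (k%:R * angle) /\
  sin ((k %% m)%:R * angle) = sin (k%:R * angle).
Proof.
have E : k%:R * angle = (k %% m)%:R * angle + pi *+ 2 *+ (k %/ m).
  rewrite {1}(divn_eq k m) natrD mulrDl addrC natrM -mulrA m_angle.
  by rewrite (mulr_natl (pi *+ 2)) .
by rewrite E (periodicn (@cosD2pi R)) (periodicn (@sinD2pi R)).
Qed.

Lemma wall_normal_mod k : wall_normal (k %% m) = wall_normal k.
Proof. by rewrite /wall_normal; have [-> ->] := trig_mod k. Qed.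

Lemma wall_normal_succ k : mink (wall_normal k) (wall_normal (k.+1 %% m)) = 0.
Proof.
rewrite wall_normal_mod mink_wall_normal -mulrBl -natr1 opprD addrA subrr add0r mulN1r.
by rewrite cosN subrr mul0r.
Qed.

Definition wall_gap : R := 1 + 2 * cos_angle.

Lemma wall_gap_gt1 : 1 < wall_gap.
Proof. by rewrite /wall_gap; have := cos_angle_gt0; lra. Qed.

(** The cosine decreases on [0, pi], so that the extreme case is that of sides which
are two steps apart. *)
Lemma wall_normal_far i j : (i.+1 < j < m)%N -> (j - i < m.-1)%N ->
  mink (wall_normal i) (wall_normal j) <= - wall_gap.
Proof.
move=> /andP[ij jm] jim; rewrite mink_wall_normal -cosN opprB -mulrBl.
rewrite -natrB; last by lia.
set k := (j - i)%N; have k2 : (2 <= k)%N by rewrite /k; lia.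
have km : (k + 2 <= m)%N by rewrite /k; lia.
have mk : (m - k)%:R = m%:R - k%:R :> R by rewrite natrB //; lia.
clearbody k.
have c2 : cos (2 * angle) = 2 * cos_angle ^+ 2 - 1.
  by rewrite mulr_natl cos_mulr2n -/cos_angle mulr2n; ring.
have mono l : (2 <= l)%N -> (l%:R * angle <= pi) -> cos (l%:R * angle) <= cos (2 * angle).
  move=> l2 lpi; have l2a : 2 * angle <= l%:R * angle by rewrite ler_pM2r // ler_nat.
  have i2 : 2 * angle \in `[0, pi].
    by rewrite in_itv /= mulr_ge0 ?(ltW angle0) //=; exact: le_trans lpi.
  have il : l%:R * angle \in `[0, pi] by rewrite in_itv /= lpi mulr_ge0 ?(ltW angle0).
  by rewrite leNgt (ltr_cos il i2) -leNgt.
have cle : cos (k%:R * angle) <= cos (2 * angle).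
  case: (leP (k%:R * angle) pi) => kpi; first exact: mono.
  have -> : cos (k%:R * angle) = cos ((m - k)%:R * angle).
    by rewrite mk mulrBl m_angle -[RHS]cosN opprB -[RHS](@cosD2pi R) subrK.
  apply: mono; first by lia.
  by rewrite mk mulrBl m_angle mulr2n; lra.
rewrite ler_pdivrMr ?subr_gt0 // /wall_gap; apply: le_trans (lerB cle (lexx _)) _.
by rewrite c2 expr2; have := mulr_gt0 cos_angle_gt0 cos_angle_gt0; lra.
Qed.

Definition chamber_radius : R := Num.sqrt (1 + 2 * cos_angle / (1 - cos_angle)).

(** Let [i] be the side for which the horizontal linear form [t i] takes its smallest
value [u] at [p], and [v] the coordinate of [p] along this side. The comparison of
[u] with the values of the two neighbouring forms bounds [v] by [u], and the
inequality of the side [i] bounds [u] by the height of [p]. *)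
Lemma polygon_bounded (p : R * R) :
  (forall i : 'I_m, 0 <= mink (hlift p) (wall_normal i)) -> hcosh 0 p <= chamber_radius.
Proof.
move=> Hp; have mpos : (0 < m)%N by lia.
pose t (k : nat) := p.1 * cos (k%:R * angle) + p.2 * sin (k%:R * angle).
have [i _ imin] := @arg_minP _ R _ (Ordinal mpos) predT (fun i : 'I_m => t i) isT.
have tmod k : t (k %% m)%N = t k by rewrite /t; have [-> ->] := trig_mod k.
have tmin k : t i <= t k.
  have km : (k %% m < m)%N by rewrite ltn_mod.
  by rewrite -(tmod k); exact: (imin (Ordinal km)).
set phi := (i : nat)%:R * angle; pose u := t i; pose v := p.2 * cos phi - p.1 * sin phi.
pose s := sin angle.
have up : u <= u * cos_angle + v * s.
  have := tmin i.+1; rewrite {2}/t -natr1 mulrDl mul1r cosD sinD -/phi -/cos_angle -/s.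
  by rewrite -/u /v {3}/u /t -/phi; lra.
have down : u <= u * cos_angle - v * s.
  have := tmin (i + m.-1)%N; have -> : t (i + m.-1)%N = u * cos_angle - v * s; last by [].
  have E : (i + m.-1)%:R * angle = phi - angle + pi *+ 2.
    rewrite natrD -subn1 natrB // mulrDl mulrBl m_angle mul1r -/phi; ring.
  rewrite /t E (@cosD2pi R) (@sinD2pi R) cosB sinB -/cos_angle -/s /u /t -/phi /v; ring.
have rho : p.1 ^+ 2 + p.2 ^+ 2 = u ^+ 2 + v ^+ 2.
  have := cos2Dsin2 phi; rewrite /u /t -/phi /v => cs.
  rewrite -[LHS]mulr1 -cs; ring.
have s2 : s ^+ 2 = 1 - cos_angle ^+ 2 by rewrite /s sin2cos2.
have u0 : u <= 0.
  have H : 0 <= - (u * (1 - cos_angle)) by lra.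
  by rewrite -oppr_ge0; move: H; rewrite -mulNr pmulr_lge0 // subr_gt0.
have vs : (v * s) ^+ 2 <= (u * (1 - cos_angle)) ^+ 2.
  rewrite -(real_normK (num_real (v * s))) -(real_normK (num_real (u * (1 - cos_angle)))).
  rewrite ler_sqr ?nnegrE // (ler0_norm (_ : u * (1 - cos_angle) <= 0)); last first.
    by rewrite mulr_le0_ge0 // subr_ge0 ltW.
  by rewrite ler_norml; apply/andP; split; lra.
have v2 : v ^+ 2 * (1 + cos_angle) <= u ^+ 2 * (1 - cos_angle).
  have c1 : 0 < 1 - cos_angle by rewrite subr_gt0.
  rewrite -(ler_pM2r c1); move: vs; rewrite !exprMn s2.
  have -> : 1 - cos_angle ^+ 2 = (1 + cos_angle) * (1 - cos_angle) by ring.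
  by rewrite expr2 [X in _ <= _ * X]expr2 !mulrA.
pose z : R := Num.sqrt (1 + p.1 ^+ 2 + p.2 ^+ 2).
have z2 : z ^+ 2 = 1 + p.1 ^+ 2 + p.2 ^+ 2.
  by rewrite sqr_sqrtr //; have := sqr_ge0 p.1; have := sqr_ge0 p.2; lra.
have z0 : 0 <= z by exact: sqrtr_ge0.
have uz : u ^+ 2 <= cos_angle * z ^+ 2.
  have := Hp i; rewrite /mink /= -/z mulrCA [X in _ + X - _]mulrCA -mulrDr.
  rewrite -/phi -/(t i) -/u mulrN opprK => h.
  have c1 : 0 < (1 - cos_angle)^-1 by rewrite invr_gt0 subr_gt0.
  have : (normal_length * u) ^+ 2 <= (inradius * z) ^+ 2.
    have iz : 0 <= inradius * z by rewrite mulr_ge0 // ltW // inradius_gt0.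
    have nu : normal_length * u <= 0 by rewrite mulr_ge0_le0 // sqrtr_ge0.
    rewrite -(real_normK (num_real (normal_length * u))) ler_sqr ?nnegrE //.
    by rewrite ler0_norm //; lra.
  by rewrite !exprMn normal_length2 inradius2 [cos_angle / _]mulrC -mulrA ler_pM2l.
have -> : hcosh 0 p = z by rewrite /hcosh /mink /= !mul0r expr0n /= !addr0 sqrtr1 -/z; ring.
rewrite /z /chamber_radius ler_sqrt; last first.
  by rewrite addr_ge0 // divr_ge0 ?mulr_ge0 ?subr_ge0 // ltW.
rewrite -addrA lerD2l ler_pdivlMr ?subr_gt0 //.
by move: uz; rewrite z2 -addrA rho; move: v2; have := cos_angle_gt0; move: (u ^+ 2) (v ^+ 2) => a b; lra.
Qed.

End RegularPolygon.

(** * The marked cycle and the surface subgroup *)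

Definition cycle_adjacent (m i j : nat) :=
  [\/ i.+1 = j, j.+1 = i, i.+1 = m /\ j = 0%N | j.+1 = m /\ i = 0%N].

Lemma cycle_square m i j k l : (5 <= m)%N -> (i < m)%N -> (j < m)%N -> (k < m)%N ->
  (l < m)%N -> i <> j -> cycle_adjacent m k i -> cycle_adjacent m k j ->
  cycle_adjacent m l i -> cycle_adjacent m l j -> k = l.
Proof.
move=> m5 im jm km lm ij; case=> ?; case=> ?; try lia; case=> ?; try lia; case=> ?; lia.
Qed.

Lemma cycle_triangle m i j k : (5 <= m)%N -> (i < m)%N -> (j < m)%N -> (k < m)%N ->
  cycle_adjacent m i j -> cycle_adjacent m j k -> cycle_adjacent m i k -> False.
Proof. by move=> m5 im jm km; case=> ?; case=> ?; try lia; case=> ?; lia. Qed.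

Section Graph.
Variables (n m : nat) (p : 'I_m -> Gamma_vertex n).
Hypotheses (m5 : (5 <= m)%N) (adm : admissible p).
Local Notation V := (Gamma_vertex n).
Local Notation ladder := (Gamma_n_edge n).
Local Notation e := (Gamma_edge p).
Implicit Types (u v w c : V) (i j k : 'I_m).

Let p_inj : injective p := adm.1.

Lemma ladder_sym : symmetric ladder.
Proof. by move=> u v; rewrite /Gamma_n_edge orbC. Qed.

Lemma ladder_irr : irreflexive ladder.
Proof. by move=> u; rewrite /Gamma_n_edge orbb; apply/negbTE; rewrite gtn_eqF. Qed.

(** Each part contains, with a vertex, its twin on the same level, to which it is not
adjacent. *)
Lemma star_join v u : ladder v u ->
  is_join ladder [set w | ladder v w]%SET [set w | w.1 == v.1]%SET.
Proof.
move=> vu; pose flip w : V := (w.1, ~~ w.2).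
have flip_ne w : w != flip w by case: w => a []; rewrite xpair_eqE /= andbF.
have flip_far w : ~~ ladder w (flip w).
  by rewrite /Gamma_n_edge /= orbb gtn_eqF.
split.
- by apply/finset.set0Pn; exists u; rewrite finset.inE.
- by apply/finset.set0Pn; exists v; rewrite finset.inE.
- apply/setP => w; rewrite !finset.inE; apply/negP => /andP[vw /eqP E].
  by move: vw; rewrite /Gamma_n_edge E orbb gtn_eqF.
- move=> a b; rewrite !finset.inE => va /eqP E.
  by rewrite ladder_sym; move: va; rewrite /Gamma_n_edge E.
split; [exists u, (flip u)|exists v, (flip v)]; rewrite !finset.inE /=; split=> //.
Qed.

Lemma marked_no_join i j : i != j -> ~ in_common_join ladder (p i) (p j).
Proof.
move=> ij [A [B [AB iAB jAB]]]; have [_ far] := adm.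
case: (ltngtP i j) => lt.
- by apply: (far _ _ lt); exists A, B.
- by apply: (far _ _ lt); exists A, B.
- by move/negP: ij; apply; apply/eqP/val_inj.
Qed.

Lemma marked_no_edge i j : ~~ ladder (p i) (p j).
Proof.
apply/negP => ij; have [E|ne] := eqVneq i j; first by move: ij; rewrite E ladder_irr.
apply: (marked_no_join ne); exists [set w | ladder (p i) w]%SET, [set w | w.1 == (p i).1]%SET.
by split; [exact: star_join ij|rewrite !finset.inE eqxx orbT|rewrite !finset.inE ij].
Qed.

Lemma marked_no_common_neighbour i j c : i != j -> ladder c (p i) -> ladder c (p j) -> False.
Proof.
move=> ne ci cj; apply: (marked_no_join ne).
exists [set w | ladder c w]%SET, [set w | w.1 == c.1]%SET.
by split; [exact: star_join ci|rewrite !finset.inE ci|rewrite !finset.inE cj].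
Qed.

Definition consecutive i j := (j == ordS i) || (i == ordS j).

Lemma consecutiveP i j : consecutive i j -> cycle_adjacent m i j.
Proof.
have succ (k l : 'I_m) : k = ordS l -> l.+1 = k \/ l.+1 = m /\ k = 0%N :> nat.
  move=> ->; rewrite /=; have := ltn_ord l; rewrite leq_eqVlt => /orP[/eqP E|lt].
    by right; split; rewrite ?E ?modnn.
  by left; rewrite modn_small.
move=> /orP[/eqP/succ|/eqP/succ] [?|?]; by [constructor 1|constructor 3|constructor 2|constructor 4].
Qed.

Lemma consecutive_intro i j : cycle_adjacent m i j -> consecutive i j.
Proof.
have succ (k l : 'I_m) : l.+1 = k \/ l.+1 = m /\ k = 0%N :> nat -> k = ordS l.
  move=> H; apply: val_inj => /=; case: H => [E|[-> ->]]; last by rewrite modnn.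
  by rewrite E modn_small.
by case=> H; apply/orP; [left|right|left|right]; apply/eqP/succ; [left|left|right|right].
Qed.

Lemma Gamma_edge_sym : symmetric e.
Proof.
move=> u v; rewrite /Gamma_edge ladder_sym; congr (_ || _).
by apply: eq_existsb => i; rewrite orbC.
Qed.

Lemma marked_edge i j : e (p i) (p j) = consecutive i j.
Proof.
rewrite /Gamma_edge (negPf (marked_no_edge i j)) /=; apply/existsP/idP.
  move=> [k /orP[] /andP[/eqP/p_inj -> /eqP/p_inj ->]]; rewrite /consecutive eqxx ?orbT //.
move=> /orP[/eqP ->|/eqP ->]; [exists i|exists j]; by rewrite !eqxx ?orbT.
Qed.

Lemma Gamma_edge_irr : irreflexive e.
Proof.
move=> u; rewrite /Gamma_edge ladder_irr /=; apply/negbTE/existsPn => i; rewrite orbb.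
apply/negP => /andP[/eqP -> /eqP/p_inj E].
have : consecutive i i by rewrite /consecutive -E eqxx.
by move=> /consecutiveP []; lia.
Qed.

Definition marked v := [exists i, p i == v].

Lemma markedP v : reflect (exists i, v = p i) (marked v).
Proof. by apply: (iffP existsP) => [[i /eqP <-]|[i ->]]; exists i. Qed.

Lemma marked_triangle s t r : marked s -> marked t -> marked r ->
  e s t -> e t r -> e s r -> False.
Proof.
move=> /markedP[i ->] /markedP[j ->] /markedP[k ->]; rewrite !marked_edge.
move=> /consecutiveP ij /consecutiveP jk /consecutiveP ik.
exact: (cycle_triangle m5 (ltn_ord i) (ltn_ord j) (ltn_ord k) ij jk ik).
Qed.

(** A common neighbour within the ladder would give a join, and no edge of the ladder
connects two marked vertices; only the new edges remain. *)
Lemma common_neighbour c i j : i != j -> e c (p i) -> e c (p j) ->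
  exists k, [/\ c = p k, consecutive k i & consecutive k j].
Proof.
have nbr l : e c (p l) -> ladder c (p l) \/ exists k, c = p k.
  move=> /orP[|/existsP[k /orP[] /andP[/eqP E1 /eqP E2]]]; first by left.
    by right; exists k.
  by right; exists (ordS k).
move=> ij ci cj; case: (nbr i ci) => [li|[k Ek]]; last first.
  by exists k; rewrite -!marked_edge -Ek.
case: (nbr j cj) => [lj|[k Ek]]; first by case: (marked_no_common_neighbour ij li lj).
by exists k; rewrite -!marked_edge -Ek.
Qed.

Lemma marked_square s t c c' : marked s -> marked t -> s != t -> ~~ e s t ->
  e c s -> e c t -> e c' s -> e c' t -> c = c'.
Proof.
move=> /markedP[i ->] /markedP[j ->] st _.
have ij : i != j by apply: contraNneq st => ->.
move=> ci cj c'i c'j; have [k [-> ki kj]] := common_neighbour ij ci cj.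
have [l [-> li lj]] := common_neighbour ij c'i c'j; congr (p _); apply: val_inj => /=.
have nij : (i : nat) <> j by move=> E; move/eqP: ij; apply; exact: val_inj.
by apply: (cycle_square m5 (ltn_ord i) (ltn_ord j) (ltn_ord k) (ltn_ord l) nij);
  exact: consecutiveP.
Qed.

Variable R : realType.
Local Notation E3 := (R^o * R^o * R^o)%type.

(** With the normal 0, the other generators act trivially, so that the action of the
whole group factors through the retraction onto the special subgroup. *)
Definition marked_normal v : E3 :=
  if [pick i | p i == v] is Some i then wall_normal R m i else 0.

Lemma marked_normalE i : marked_normal (p i) = wall_normal R m i.
Proof.
rewrite /marked_normal; case: pickP => [j /eqP/p_inj -> //|/(_ i)].
by rewrite eqxx.
Qed.

Lemma marked_normal_out v : ~~ marked v -> marked_normal v = 0.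
Proof.
rewrite /marked_normal; case: pickP => [j /eqP <-|//]; by case/markedP; exists j.
Qed.

Lemma marked_normal_edge u v : e u v -> mink (marked_normal u) (marked_normal v) = 0.
Proof.
have mink0 (x : E3) : mink 0 x = 0 by rewrite /mink /= !mul0r; ring.
case: (boolP (marked u)) => [/markedP[i ->]|/marked_normal_out ->]; last by rewrite mink0.
case: (boolP (marked v)) => [/markedP[j ->]|/marked_normal_out ->]; last by rewrite mink_sym mink0.
rewrite marked_edge !marked_normalE => /orP[/eqP ->|/eqP ->].
  exact: wall_normal_succ.
by rewrite mink_sym; exact: wall_normal_succ.
Qed.

Lemma marked_normal_far u v : marked u -> marked v -> u != v -> ~~ e u v ->
  mink (marked_normal u) (marked_normal v) <= - wall_gap R m.
Proof.
move=> /markedP[i ->] /markedP[j ->] uv; rewrite marked_edge !marked_normalE.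
have ij : i != j by apply: contraNneq uv => ->.
wlog lt : i j ij {uv} / (i < j)%N => [W nc|nc].
  case: (ltngtP i j) => h; first exact: W.
    by rewrite mink_sym; apply: W => //; rewrite 1?eq_sym // /consecutive orbC.
  by case/eqP: ij; exact: val_inj.
have h1 : (i.+1 != j)%N by apply: contraNneq nc => E; apply: consecutive_intro; constructor 1.
have h2 : ~ (j.+1 = m /\ i = 0%N :> nat).
  by move=> E; move/negP: nc; apply; apply: consecutive_intro; constructor 4.
by have := ltn_ord j => ?; apply: wall_normal_far => //; lia.
Qed.

Lemma surface_subgroup : exists H : set (racg e),
  (exists (M : metricType R) (x0 : M),
     closed_hyperbolic_surface M /\ isomorphic_to_pi1 R x0 H) /\ stable R H.
Proof.
have gap := wall_gap_gt1 R m5; have inrad := inradius_gt0 R m5.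
have unit v : marked v -> mink (marked_normal v) (marked_normal v) = 1.
  by move=> /markedP[i ->]; rewrite marked_normalE wall_normal_unit.
have center v : marked v -> mink (hlift 0) (marked_normal v) = inradius R m.
  by move=> /markedP[i ->]; rewrite marked_normalE wall_normal_center.
have bounded (q : R * R) : (forall v, marked v -> 0 <= mink (hlift q) (marked_normal v)) ->
    hcosh 0 q <= chamber_radius R m.
  move=> H; apply: polygon_bounded => // i; rewrite -marked_normalE.
  by apply: H; apply/markedP; exists i.
have [delta d0 far] := even_special_displacement Gamma_edge_sym
  marked_normal_out unit marked_normal_edge gap marked_normal_far inrad center.
have [rad near] := even_special_cocompact Gamma_edge_sym
  marked_normal_out unit marked_normal_edge gap marked_normal_far inrad center bounded.
exists (even_special marked); split.
  apply: (quotient_surface (@even_special_subgroup _ e marked) _ _ _ d0 far near).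
  - exact: (gact1 marked_normal_out unit marked_normal_edge).
  - exact: (gactM marked_normal_out unit marked_normal_edge).
  - exact: (gact_hcosh marked_normal_out unit marked_normal_edge).
apply: (special_subgroup_stable Gamma_edge_sym Gamma_edge_irr marked_triangle marked_square).
- exact: even_special_subgroup.
- by move=> g [].
- exact: even_special_undistorted.
Qed.

End Graph.

Theorem proposition2p2 (R : realType) (n m : nat) (p : 'I_m -> Gamma_vertex n) :
  (5 <= m)%N -> admissible p ->
  exists H : set (racg (Gamma_edge p)),
    (exists (M : metricType R) (x0 : M),
       closed_hyperbolic_surface M /\ isomorphic_to_pi1 R x0 H) /\
    stable R H.
Proof. by move=> m5 adm; exact: surface_subgroup. Qed.
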